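(* Suppose that for each investor $m=1,\dots,M$ the strategy $\boldsymbol{L}^m$ satisfies: (C1) there is a $\mathcal{P}\otimes\mathcal{B}(\mathbb{R}^M_+)$-measurable function $v^m_t(\omega,z)$ with values in $\mathbb{R}^N_+$ such that for all $\omega\in\Omega$, $y\in D$, $t\ge0$, $n=1,\dots,N$, $$\boldsymbol{L}^{m,n}_t(\omega,y)=\int_0^t v^{m,n}_s(\omega,y_{s-})\,\mathbb{1}\big(\inf_{u<s}y^m_u>0\big)\,dG_s(\omega)\qquad(y_{0-}:=y_0),$$ and for all $\omega,z\in\mathbb{R}^M_+,t$: $|v^m_t(\omega,z)|\,\Delta G_t(\omega)\le z^m$; (C2) there are sets $\Pi^{m,n}\in\mathcal{P}$ ($n=1,\dots,N$), a non-random function $C^m\colon\mathbb{R}^M_+\to(0,\infty)$ and a predictable càdlàg process $\delta^m>0$ such that $v^{m,n}_t(\omega,z)=0$ for all $(\omega,t)\in\Pi^{m,n}$ and all $z\in\mathbb{R}^M_+$, and for all $(\omega,t)\notin\Pi^{m,n}$ and all $z,\tilde z,a\in\mathbb{R}^M_+$ with $z^k,\tilde z^k\in[a^k/2,2a^k]$ for every $k$: $v^{m,n}_t(\omega,z)\ge (C^m(a)\delta^m_t(\omega))^{-1}$ if $z^m>0$; $v^{m,n}_t(\omega,z)\le C^m(a)\delta^m_t(\omega)$; and $|v^{m,n}_t(\omega,z)-v^{m,n}_t(\omega,\tilde z)|\le C^m(a)\delta^m_t(\omega)|z-\tilde z|$. Then for every initial wealth $y_0\in\mathbb{R}^M_{++}$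 and every predictable nondecreasing càdlàg process $H$ with $G\ll H$, the wealth equation $$Y^m_t=y^m_0-|L^m_t|+\sum_{n=1}^N\int_0^t\frac{l^{m,n}_s}{|l^{\cdot,n}_s|}dX^n_s,\quad m=1,\dots,M,$$ with $L^m_t(\omega)=\boldsymbol{L}^m_t(\omega,Y(\omega))$ and $l=dL/dH$, has a unique (up to indistinguishability) nonnegative càdlàg adapted $\mathbb{R}^M_+$-valued solution $Y$.
   Context: Setting: $(\Omega,\mathcal{F},\mathbb{F}=(\mathcal{F}_t)_{t\ge0},\mathbb{P})$ is a filtered probability space with the usual conditions, $\mathcal{P}$ the predictable $\sigma$-algebra on $\Omega\times\mathbb{R}_+$; equalities of processes are up to indistinguishability. For $x\in\mathbb{R}^N$, $|x|=\sum_n|x^n|$; for $x\in\mathbb{R}^{MN}$, $x^m=(x^{m,1},\dots,x^{m,N})$ and $x^{\cdot,n}=(x^{1,n},\dots,x^{M,n})$. $\mathbb{R}^M_{++}$ is the set of vectors with all coordinates strictly positive. There are $M\ge2$ investors and $N\ge1$ assets. The payoff process $X$ is adapted, nondecreasing, càdlàg, $\mathbb{R}^N_+$-valued with $X_0=0$; $X^c_t=X_t-\sum_{0<s\le t}\Delta X_s$; $\nu$ is the compensator of the jump measure of $X$ and $f*\nu_t=\int_0^t\int f(s,x)\nu(ds,dx)$. The operational time is $G_t=|X^c_t|+(|x|\wedge1)*\nu_t$. $G\ll H$ means that for a.a. $\omega$ the measure $dG_t(\omega)$ is absolutely continuous with respect to $dH_t(\omega)$. In the wealth equation $l^{m,n}/|l^{\cdot,n}|:=0$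 when $|l^{\cdot,n}|=0$, and integrals are pathwise Lebesgue–Stieltjes. Strategies: $D$ is the space of càdlàg $y\colon\mathbb{R}_+\to\mathbb{R}^M_+$ with $\mathcal{D}_t=\sigma(y_u,u\le t)$, $E=\Omega\times D$, $\mathcal{E}_t=\mathcal{F}_t\otimes\mathcal{D}_t$, and $\mathcal{P}^E$ the $\sigma$-algebra on $E\times\mathbb{R}_+$ generated by measurable functions left-continuous in $t$ and $\mathcal{E}_t$-measurable for fixed $t$. A strategy is a $\mathcal{P}^E$-measurable function $\boldsymbol{L}_t(\omega,y)\in\mathbb{R}^N_+$ with $\boldsymbol{L}_0=0$, nondecreasing and càdlàg in $t$. Lebesgue derivatives: for $\sigma$-finite measures $P,\tilde P$, the Lebesgue derivative $d\tilde P/dP$ is a measurable $Z\ge0$ for which there is a set $\Gamma$ with $P(\Gamma)=0$ and $\tilde P(A)=\int_AZ\,dP+\tilde P(A\cap\Gamma)$ for all $A$. For nondecreasing càdlàg predictable processes $H,\tilde G$, $\mathbb{P}\otimes H(A)=\mathbb{E}\int_0^\infty\mathbb{1}_A(s)\,dH_s$ on $\mathcal{P}$, and $d\tilde G/dH$ denotes any predictable version of $d(\mathbb{P}\otimes\tilde G)/d(\mathbb{P}\otimes H)$ (componentwise for vector processes). *)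

(* Defs.v *)
From HB Require Import structures.
From mathcomp Require Import all_boot all_order all_algebra.
From mathcomp Require Import all_classical all_reals all_analysis.

Set Implicit Arguments.
Unset Strict Implicit.
Unset Printing Implicit Defensive.

Import Order.TTheory GRing.Theory Num.Theory.
Import numFieldNormedType.Exports.

Local Open Scope classical_set_scope.
Local Open Scope ring_scope.

Section PathwiseDefs.
Context {R : realType}.

Definition vnorm {I : finType} (x : I -> R) : R := \sum_(i : I) `|x i|.

Definition nonneg {I : finType} (x : I -> R) : Prop := forall i, 0 <= x i.

(** time runs in R_+ = [0, +oo); functions R -> R are only looked at on R_+ *)
Definition nondec (f : R -> R) : Prop :=
  forall s t, 0 <= s -> s <= t -> f s <= f t.

Definition cadlag (f : R -> R) : Prop :=
  (forall t, 0 <= t -> f x @[x --> at_right t] --> f t) /\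
  (forall t, 0 < t -> cvg (f x @[x --> at_left t])).

Definition lm (f : R -> R) (t : R) : R :=
  if (0 < t)%R then lim (f x @[x --> at_left t]) else f t.

Definition jump (f : R -> R) (t : R) : R := f t - lm f t.

Definition ext0 (f : R -> R) : R -> R := fun s => f (Num.max s 0).

(** The Lebesgue-Stieltjes measure df on R; it charges only (0,+oo)
    (since ext0 f is constant on (-oo,0]) and gives (a,b] mass f b - f a.
    It is the zero measure when f is not nondecreasing and right-continuous. *)
Definition LSm (f : R -> R) : {measure set (measurableTypeR R) -> \bar R} :=
  match pselect (nondecreasing (ext0 f) /\ right_continuous (ext0 f)) with
  | left H => lebesgue_stieltjes_measure
       (HB.pack (ext0 f) (isCumulative.Build R _ R (ext0 f) (proj1 H) (proj2 H)))
  | right _ => mzero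
  end.

Definition oc0 (t : R) : set R := `]0, t].
Definition pos0 : set R := `]0, +oo[.

Definition jsum (j : R -> R) (t : R) : R :=
  fine (\esum_(s in `]0, t]) (j s)%:E).

End PathwiseDefs.

Section ProcessDefs.
Context {R : realType} {d : measure_display} {Omega : measurableType d}.
Variable P : probability Omega R.

Definition usual_filtration (F : R -> set (set Omega)) : Prop :=
  [/\ forall t, 0 <= t -> sigma_algebra setT (F t),
      forall t A, 0 <= t -> F t A -> measurable A,
      forall s t A, 0 <= s -> s <= t -> F s A -> F t A,
      forall t A, 0 <= t -> (forall s, t < s -> F s A) -> F t A &
      forall N0 A, measurable A -> P A = 0%E -> N0 `<=` A -> F 0 N0].

Definition adapted (F : R -> set (set Omega)) (Z : Omega -> R -> R) : Prop :=
  forall t, 0 <= t -> forall B : set R, measurable B -> F t (Z ^~ t @^-1` B).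

Definition Dom0 : set (Omega * R) := setT `*` `[0, +oo[.

Definition pred_gen (F : R -> set (set Omega)) : set (set (Omega * R)) :=
  [set C | exists A s t, [/\ 0 <= s, F s A & C = A `*` `]s, t]]] `|`
  [set C | exists A, F 0 A /\ C = A `*` [set 0]].

Definition predictable (F : R -> set (set Omega)) : set (set (Omega * R)) :=
  <<s Dom0, pred_gen F >>.

Definition pred_fun (F : R -> set (set Omega)) (Z : Omega -> R -> R) : Prop :=
  forall B : set R, measurable B ->
    predictable F (Dom0 `&` [set p | B (Z p.1 p.2)]).

Definition PxH (H Z : Omega -> R -> R) (A : set (Omega * R)) : \bar R :=
  (\int[P]_w (\int[LSm (H w)]_(s in pos0)
      ((Z w s)%:E * ((asbool (A (w, s)))%:R)%:E)))%E.

Definition lebesgue_deriv (F : R -> set (set Omega)) (Gt H Z : Omega -> R -> R)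
  : Prop :=
  [/\ pred_fun F Z, (forall w t, 0 <= t -> 0 <= Z w t) &
      exists Gam, [/\ predictable F Gam,
        PxH H (fun _ _ => 1%R) Gam = 0%E &
        forall A, predictable F A ->
          PxH Gt (fun _ _ => 1%R) A = (PxH H Z A + PxH Gt (fun _ _ => 1%R) (A `&` Gam))%E]].

Definition payoff (F : R -> set (set Omega)) {N : nat} (X : Omega -> R -> 'I_N -> R)
  : Prop :=
  [/\ forall n, adapted F (fun w t => X w t n),
      forall w n, nondec (fun t => X w t n) /\ cadlag (fun t => X w t n),
      forall w n t, 0 <= t -> 0 <= X w t n &
      forall w n, X w 0 n = 0].

Definition Xc {N : nat} (X : Omega -> R -> 'I_N -> R) (w : Omega) (t : R) (n : 'I_N)
  : R := X w t n - jsum (jump (fun u => X w u n)) t.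

(** (|x| /\ 1) * mu^X_t = sum_{0<s<=t} (|Delta X_s| /\ 1) *)
Definition Ajump {N : nat} (X : Omega -> R -> 'I_N -> R) (w : Omega) (t : R) : R :=
  jsum (fun s => Num.min (vnorm (fun n => jump (fun u => X w u n) s)) 1) t.

Definition compensator (F : R -> set (set Omega)) (A B : Omega -> R -> R) : Prop :=
  [/\ pred_fun F B,
      forall w, nondec (B w) /\ cadlag (B w),
      forall w, B w 0 = 0 &
      forall W, pred_fun F W -> (forall w t, 0 <= t -> 0 <= W w t) ->
        (\int[P]_w (\int[LSm (A w)]_(s in pos0) (W w s)%:E) =
         \int[P]_w (\int[LSm (B w)]_(s in pos0) (W w s)%:E))%E].

(** operational time G_t = |X^c_t| + (|x| /\ 1) * nu_t, where B is
    (|x| /\ 1) * nu, the compensator of (|x| /\ 1) * mu^X *)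
Definition opG {N : nat} (X : Omega -> R -> 'I_N -> R) (B : Omega -> R -> R)
  (w : Omega) (t : R) : R := vnorm (Xc X w t) + B w t.

Definition abs_cont (G H : Omega -> R -> R) : Prop :=
  exists N0, [/\ measurable N0, P N0 = 0%E &
    forall w, ~ N0 w -> forall A : set (measurableTypeR R), measurable A ->
      LSm (H w) A = 0%E -> LSm (G w) A = 0%E].

Definition inD {M : nat} (y : R -> 'I_M -> R) : Prop :=
  forall k, cadlag (fun t => y t k) /\ (forall t, 0 <= t -> 0 <= y t k).

Definition DomE {M : nat} : set (Omega * (R -> 'I_M -> R)) :=
  setT `*` [set y | inD y].

Definition Egen (F : R -> set (set Omega)) {M : nat} (t : R)
  : set (set (Omega * (R -> 'I_M -> R))) :=
  [set C | exists A u k (B : set R), [/\ F t A, 0 <= u <= t, measurable B &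
      C = A `*` [set y | inD y /\ B (y u k)]]].

Definition Esig (F : R -> set (set Omega)) {M : nat} (t : R) :=
  <<s (@DomE M), Egen F t >>.

Definition PEdom {M : nat} : set ((Omega * (R -> 'I_M -> R)) * R) :=
  DomE `*` `[0, +oo[.

Definition PEgen (F : R -> set (set Omega)) {M : nat}
  : set (set ((Omega * (R -> 'I_M -> R)) * R)) :=
  [set C | exists S s t, [/\ 0 <= s, Esig F s S & C = S `*` `]s, t]]] `|`
  [set C | exists S, Esig F 0 S /\ C = S `*` [set 0]].

Definition PE (F : R -> set (set Omega)) {M : nat} :=
  <<s (@PEdom M), PEgen F >>.

Definition strategy (F : R -> set (set Omega)) {M N : nat}
  (L : Omega -> (R -> 'I_M -> R) -> R -> 'I_N -> R) : Prop :=
  [/\ forall n (B : set R), measurable B ->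
        PE F (PEdom `&` [set p | B (L p.1.1 p.1.2 p.2 n)]),
      forall w y n, inD y -> L w y 0 n = 0 &
      forall w y n, inD y ->
        nondec (fun t => L w y t n) /\ cadlag (fun t => L w y t n)].

Definition PBdom {M : nat} : set ((Omega * R) * ('I_M -> R)) :=
  Dom0 `*` [set z | nonneg z].

Definition PBgen (F : R -> set (set Omega)) {M : nat}
  : set (set ((Omega * R) * ('I_M -> R))) :=
  [set C | exists A k (B : set R), [/\ predictable F A, measurable B &
      C = A `*` [set z | nonneg z /\ B (z k)]]].

Definition PB (F : R -> set (set Omega)) {M : nat} := <<s (@PBdom M), PBgen F >>.

Definition PB_fun (F : R -> set (set Omega)) {M N : nat}
  (v : Omega -> R -> ('I_M -> R) -> 'I_N -> R) : Prop :=
  forall n (B : set R), measurable B ->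
    PB F (PBdom `&` [set p | B (v p.1.1 p.1.2 p.2 n)]).

Definition C1 (F : R -> set (set Omega)) {M N : nat} (G : Omega -> R -> R)
  (L : Omega -> (R -> 'I_M -> R) -> R -> 'I_N -> R) (m : 'I_M)
  (v : Omega -> R -> ('I_M -> R) -> 'I_N -> R) : Prop :=
  [/\ PB_fun F v,
      (forall w t z n, 0 <= t -> nonneg z -> 0 <= v w t z n),
      (forall w y t n, inD y -> 0 <= t ->
         (L w y t n)%:E =
         (\int[LSm (G w)]_(s in oc0 t)
            ((v w s (fun k => lm (fun u => y u k) s) n *
              (asbool (0 < inf [set y u m | u in `[0, s[]))%:R)%:E))%E) &
      (forall w z t, 0 <= t -> nonneg z -> vnorm (v w t z) * jump (G w) t <= z m)].

Definition C2 (F : R -> set (set Omega)) {M N : nat} (m : 'I_M)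
  (v : Omega -> R -> ('I_M -> R) -> 'I_N -> R) : Prop :=
  exists (Pi : 'I_N -> set (Omega * R)) (C : ('I_M -> R) -> R)
         (delta : Omega -> R -> R),
  [/\ forall n, predictable F (Pi n),
      forall a, 0 < C a,
      [/\ pred_fun F delta, forall w, cadlag (delta w) &
          forall w t, 0 <= t -> 0 < delta w t],
      forall n w t z, 0 <= t -> Pi n (w, t) -> nonneg z -> v w t z n = 0 &
      forall n w t z zt a, 0 <= t -> ~ Pi n (w, t) ->
        nonneg z -> nonneg zt -> nonneg a ->
        (forall k, a k / 2 <= z k <= 2 * a k /\ a k / 2 <= zt k <= 2 * a k) ->
        [/\ 0 < z m -> (C a * delta w t)^-1 <= v w t z n,
            v w t z n <= C a * delta w t &
            `|v w t z n - v w t zt n| <= C a * delta w t * vnorm (z \- zt)]].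

Definition ratio {M : nat} (l : 'I_M -> Omega -> R -> R) (w : Omega) (s : R)
  (m : 'I_M) : R :=
  let den := vnorm (fun k => l k w s) in
  if den == 0 then 0 else l m w s / den.

Definition wealth_solution (F : R -> set (set Omega)) {M N : nat}
  (X : Omega -> R -> 'I_N -> R) (H : Omega -> R -> R)
  (L : 'I_M -> Omega -> (R -> 'I_M -> R) -> R -> 'I_N -> R)
  (y0 : 'I_M -> R) (Y : Omega -> R -> 'I_M -> R) : Prop :=
  [/\ forall w, inD (Y w),
      forall m, adapted F (fun w t => Y w t m) &
      exists l : 'I_M -> 'I_N -> Omega -> R -> R,
        (forall m n, lebesgue_deriv F (fun w t => L m w (Y w) t n) H (l m n)) /\
        exists N0, [/\ measurable N0, P N0 = 0%E &
          forall w, ~ N0 w -> forall t m, 0 <= t ->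
            (Y w t m)%:E =
            ((y0 m - vnorm (L m w (Y w) t))%:E +
             \sum_(n < N) \int[LSm (fun s => X w s n)]_(s in oc0 t)
                 (ratio (fun k => l k n) w s m)%:E)%E]].

Definition indist {M : nat} (Y1 Y2 : Omega -> R -> 'I_M -> R) : Prop :=
  exists N0, [/\ measurable N0, P N0 = 0%E &
    forall w, ~ N0 w -> forall t, 0 <= t -> Y1 w t = Y2 w t].

End ProcessDefs.

(* Main.v *)
Require Import Defs.
From HB Require Import structures.
From mathcomp Require Import all_boot all_order all_algebra finmap.
From mathcomp Require Import all_classical all_reals all_analysis.
From mathcomp Require Import measurable_realfun.
From mathcomp Require Import ring lra.
Set Implicit Arguments.
Unset Strict Implicit.
Unset Printing Implicit Defensive.
Import Order.TTheory GRing.Theory Num.Theory.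
Import numFieldNormedType.Exports.
Local Open Scope classical_set_scope.
Local Open Scope ring_scope.

(** Almost surely the wealth equation is a pathwise equation that does not involve H. Indeed the
    derivative dL^m/dH is the rate v^m(Y_-), switched off after the death of investor m, times
    dG/dH; the factor dG/dH cancels in the ratio l^{m,n} / |l^{.,n}| outside of a predictable
    G-null set, and predictable G-null sets are X-null, since X^c is dominated by G and the jumps
    of X are compensated by a part of G. What remains is
    dY = b(s, living investors, Y_-) dA, driven by G and X^1, ..., X^N.

    By (C2) the coefficient b is bounded and Lipschitz in Y on every box in which the living
    coordinates range over [1/j, j] and the others are 0: each rate v^{k,n} is either zero or
    bounded away from zero there, which controls the denominators. The equation is solved death by
    death: with at most i deaths solved, the equation with the argument clamped to the j-th box
    is solved by Picard iteration, and the solutions for growing j extend one another up to the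
    exit from the box. By the budget constraint in (C1) they are nonnegative, so what is invested
    is at most the initial wealth plus the payoffs, and the pieces converge monotonically up to the
    next death. Predictability is preserved by all these steps. For uniqueness, right after every
    time t a solution stays in a box, so that two solutions which agree up to t agree a little
    longer, by a Gronwall argument. *)

(** * Lebesgue-Stieltjes measures *)

(** The coefficient is discontinuous at a death, so no Lipschitz estimate reaches across one. Each
    stage therefore reads the set of living investors off the path built so far, not off the
    unknown. That path is frozen once [i] investors are dead, which keeps the set constant for the
    rest of the stage. The rates may be unbounded towards the next death; integrability of the limit
    comes from the budget constraint alone, through a bound that is uniform over the boxes.
    Integrands see the unknown only through its left limit, and an exponential weight then gives a
    contraction across jumps. Exit times do not occur: they are replaced by induction along the
    half-line and by predictable flags which record that a path has stayed in its box so far. The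
    existence part of the pathwise equation holds for every [w]; null sets enter only with the
    derivatives with respect to H. *)

Section RealLine.
Context {R : realType}.
Local Notation mR := (measurableTypeR R).
Implicit Types (f g : R -> R) (a b s t : R).

(** Take the supremum of the initial segments on which [P] holds; the base case is the first premise
    at 0. In most applications left limits give the first premise and right-continuity the
    second. *)
Lemma real_ind (P : R -> Prop) :
  (forall t, 0 <= t -> (forall u : R, 0 <= u -> u < t -> P u) -> P t) ->
  (forall t, 0 <= t -> (forall u : R, 0 <= u -> u <= t -> P u) ->
     exists2 h, 0 < h & forall u, t < u -> u <= t + h -> P u) ->
  forall t, 0 <= t -> P t.
Proof.
move=> closedP openP T T0; apply: contrapT => nPT.
pose S := [set t | 0 <= t /\ forall u : R, 0 <= u -> u <= t -> P u].
have P0 : P 0.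
  apply: closedP => // u u0 /(le_lt_trans u0).
  by rewrite ltxx.
have S0 : S 0.
  split=> // u u0 u0'.
  by have -> : u = 0 by apply/eqP; rewrite eq_le u0 u0'.
have ubS : ubound S T.
  move=> t [t0 Pt]; rewrite leNgt; apply/negP => Tt.
  by apply: nPT; apply: Pt => //; exact: ltW.
have hS : has_sup S by split; [exists 0|exists T].
have e0 : 0 <= sup S by apply: ub_le_sup => //; exists T.
have ltS (u : R) : 0 <= u -> u < sup S -> P u.
  move=> u0 ue; have [t [t0 Pt] ut] : exists2 t, S t & u < t.
    have d0 : 0 < sup S - u by rewrite subr_gt0.
    by have [t St] := sup_adherent d0 hS; rewrite subKr; exists t.
  by apply: Pt => //; exact: ltW.
have leS (u : R) : 0 <= u -> u <= sup S -> P u.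
  move=> u0; rewrite le_eqVlt => /orP[/eqP ->|]; last exact: ltS.
  exact: closedP.
have [h h0 hP] := openP _ e0 leS.
suff : sup S + h <= sup S by rewrite gerDl leNgt h0.
apply: ub_le_sup; first by exists T.
split=> [|u u0 uh]; first by rewrite addr_ge0// ltW.
by have [/leS|eu] := leP u (sup S); [exact|exact: hP].
Qed.

Lemma ext0E f t : 0 <= t -> ext0 f t = f t.
Proof. by move=> t0; rewrite /ext0 max_l. Qed.

Lemma ext0_le0 f t : t <= 0 -> ext0 f t = f 0.
Proof. by move=> t0; rewrite /ext0 max_r. Qed.

Lemma ext0_nondec f : nondec f -> nondecreasing (ext0 f).
Proof.
move=> ndf s t st; apply: ndf; first by rewrite le_max lexx orbT.
by rewrite ge_max !le_max st lexx orbT.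
Qed.

Lemma ext0_rc f : cadlag f -> right_continuous (ext0 f).
Proof.
move=> [rcf _] t; have [t0|t0] := leP 0 t.
  rewrite ext0E//; have := rcf _ t0; apply: cvg_trans; apply: near_eq_cvg.
  near=> x; rewrite ext0E//; apply: (le_trans t0); near: x.
  exact: nbhs_right_ge.
rewrite ext0_le0 ?ltW//; apply: cvg_near_cst.
near=> x; apply: ext0_le0; near: x.
exact: nbhs_right_le.
Unshelve. all: by end_near. Qed.

Lemma cvg_right_epsP f t l : f x @[x --> at_right t] --> l <->
  forall e, 0 < e -> exists2 d, 0 < d & forall x, t < x -> x < t + d -> `|l - f x| < e.
Proof.
split=> [/cvgrPdist_lt h e e0|h].
  have /= [d d0 hd] := h e e0; exists d => // x tx xd; apply: hd => //=.
  by rewrite ltr0_norm ?subr_lt0// opprB ltrBlDl.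
apply/cvgrPdist_lt => e e0; have [d d0 hd] := h e e0.
exists d => //= x xd tx; apply: hd => //.
by move: xd => /=; rewrite ltr_distlC => /andP[].
Qed.

Lemma cvg_left_epsP f t l : f x @[x --> at_left t] --> l <->
  forall e, 0 < e -> exists2 d, 0 < d & forall x, t - d < x -> x < t -> `|l - f x| < e.
Proof.
split=> [/cvgrPdist_lt h e e0|h].
  have /= [d d0 hd] := h e e0; exists d => // x xd tx; apply: hd => //=.
  by rewrite gtr0_norm ?subr_gt0// ltrBlDl -ltrBlDr.
apply/cvgrPdist_lt => e e0; have [d d0 hd] := h e e0.
exists d => //= x xd tx; apply: hd => //.
by move: xd => /=; rewrite ltr_distlC => /andP[].
Qed.

Lemma cadlag_lm f t : cadlag f -> 0 < t -> f x @[x --> at_left t] --> lm f t.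
Proof. by move=> [_ /(_ t)] h t0; rewrite /lm t0; exact: h. Qed.

Lemma lm_unique f t l : 0 < t -> f x @[x --> at_left t] --> l -> lm f t = l.
Proof. by move=> t0 fl; rewrite /lm t0; apply/cvg_lim. Qed.

Definition gcum f (H : nondecreasing (ext0 f) /\ right_continuous (ext0 f)) :
   cumulative R R :=
  HB.pack (ext0 f) (isCumulative.Build R _ R (ext0 f) (proj1 H) (proj2 H)).

Lemma LSmE f : nondec f -> cadlag f ->
  exists2 F : cumulative R R, F = ext0 f :> (R -> R) &
    LSm f = lebesgue_stieltjes_measure F.
Proof.
move=> ndf cf; rewrite /LSm; case: pselect => [H|[]]; last first.
  by split; [exact: ext0_nondec|exact: ext0_rc].
by exists (gcum H).
Qed.

Lemma LSm_ocitv f a b : nondec f -> cadlag f -> a <= b ->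
  LSm f `]a, b]%classic = (ext0 f b - ext0 f a)%:E.
Proof.
move=> ndf cf ab; have [F FE ->] := LSmE ndf cf.
rewrite -FE; transitivity (wlength F `]a, b]%classic).
  by apply: measurable_mu_extE; exact: is_ocitv.
rewrite wlength_itv/= lte_fin; case: ltP => //.
by move=> ba; have -> : a = b by [apply/eqP; rewrite eq_le ab ba]; rewrite subrr.
Qed.

Lemma LSm_oc f a b : nondec f -> cadlag f -> 0 <= a -> a <= b ->
  LSm f `]a, b]%classic = (f b - f a)%:E.
Proof.
by move=> ndf cf a0 ab; rewrite LSm_ocitv// !ext0E// (le_trans a0).
Qed.

Lemma LSm_oc0 f t : nondec f -> cadlag f -> 0 <= t -> LSm f (oc0 t) = (f t - f 0)%:E.
Proof. by move=> ndf cf t0; rewrite LSm_oc. Qed.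

Lemma measurable_oc0 t : measurable (oc0 t : set mR).
Proof. exact: measurable_itv. Qed.

Lemma measurable_pos0 : measurable (pos0 : set mR).
Proof. exact: measurable_itv. Qed.

Lemma oc0_pos0 t : oc0 t `<=` pos0.
Proof. by move=> x; rewrite /oc0 /pos0/= !in_itv/= => /andP[->]. Qed.

Lemma pos0_bigcup : pos0 = \bigcup_(n : nat) oc0 (n%:R : R).
Proof.
apply/seteqP; split => x; last by case=> n _; exact: oc0_pos0.
rewrite /pos0/= in_itv/= andbT => x0; exists (Num.bound x) => //.
by rewrite /oc0/= in_itv/= x0/=; exact/ltW/archi_boundP/ltW.
Qed.

Lemma oc0_nd s t : s <= t -> oc0 s `<=` oc0 t.
Proof.
move=> st x; rewrite /oc0/= !in_itv/= => /andP[-> /le_trans]/=.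
exact.
Qed.

End RealLine.
#[global] Hint Extern 0 (measurable (oc0 _)) => exact: measurable_oc0 : core.
#[global] Hint Extern 0 (measurable pos0) => exact: measurable_pos0 : core.

(** * Distribution functions of locally finite measures *)

Section Distribution.
Context {R : realType}.
Local Notation mR := (measurableTypeR R).
Implicit Types (f g : R -> R) (a b s t : R).

Lemma nondec_cvg_right f t : nondec f -> 0 <= t ->
  f (t + n.+1%:R^-1) @[n --> \oo] --> f t ->
  f x @[x --> at_right t] --> f t.
Proof.
move=> ndf t0 /cvgrPdist_lt h; apply/cvg_right_epsP => e e0.
have [n _ hn] := h e e0.
exists (n.+1%:R^-1) => [|x tx xn]; first by rewrite invr_gt0.
have := hn n (leqnn n).
have ft1 : f t <= f x by apply: ndf => //; exact: ltW.
have ft2 : f t <= f (t + n.+1%:R^-1) by apply: ndf => //; rewrite lerDl invr_ge0.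
rewrite !ler0_norm ?subr_le0// !opprB.
apply: le_lt_trans; rewrite lerD2r; apply: ndf; rewrite ?ltW//.
exact: le_lt_trans tx.
Qed.

Lemma nondec_is_cvg_left f t : nondec f -> 0 < t -> cvg (f x @[x --> at_left t]).
Proof.
move=> ndf t0; apply: nondecreasing_at_left_is_cvgr.
  near=> x => a b; rewrite !in_itv/= => /andP[xa _] _; apply: ndf.
  rewrite (le_trans _ (ltW xa))//; near: x.
  exact: nbhs_left_ge.
near=> x; exists (f t) => _ [y + <-]; rewrite /= in_itv/= => /andP[xy yt].
apply: ndf; rewrite ?ltW// (le_lt_trans _ xy)//; near: x.
exact: nbhs_left_ge.
Unshelve. all: by end_near. Qed.

Lemma cvg_sub_harmonic t : t - n.+1%:R^-1 @[n --> \oo] --> t.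
Proof.
rewrite -[X in _ --> X]subr0; apply: cvgB; first exact: cvg_cst.
exact: cvg_harmonic.
Qed.

Section Dist.
Variable mu : {measure set mR -> \bar R}.
Hypothesis mufin : forall t, (mu (oc0 t) < +oo)%E.
Let F t := fine (mu (oc0 t)).

Lemma dist_EFin t : (F t)%:E = mu (oc0 t).
Proof. by rewrite fineK// ge0_fin_numE. Qed.

Lemma dist0 : F 0 = 0.
Proof. by rewrite /F /oc0 set_itvoc0 measure0. Qed.

Lemma dist_nondec : nondec F.
Proof.
move=> s t s0 st; rewrite -lee_fin !dist_EFin le_measure ?inE//.
exact: oc0_nd.
Qed.

(** Monotonicity already provides a left limit, so it is enough to identify it along [t - 1/(n+1)],
    by continuity from below. *)
Lemma dist_oo t : 0 < t -> F x @[x --> at_left t] --> fine (mu `]0, t[%classic).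
Proof.
move=> t0.
have /cvg_ex[/= l Fl] := nondec_is_cvg_left dist_nondec t0.
suff -> : fine (mu `]0, t[%classic) = l by [].
have := Fl => /cvg_at_leftP/(_ (fun n => t - n.+1%:R^-1)) Fnl.
have {}Fnl : F (t - n.+1%:R^-1) @[n --> \oo] --> l.
  apply: Fnl; split=> [n|]; last exact: cvg_sub_harmonic.
  by rewrite gtrBl invr_gt0.
have ocE : `]0, t[%classic = \bigcup_n oc0 (t - n.+1%:R^-1).
  apply/seteqP; split => x /=.
    rewrite in_itv/= => /andP[x0 xt].
    have [n] := ltr_add_invr xt; exists n => //.
    by rewrite /oc0/= in_itv/= x0/= lerBrDr ltW.
  move=> [n _]; rewrite /oc0/= !in_itv/= => /andP[->/=] /le_lt_trans; apply.
  by rewrite gtrBl invr_gt0.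
have moo : (mu `]0%R, t[%classic < +oo)%E.
  apply: le_lt_trans (mufin t); rewrite le_measure ?inE//.
  by move=> x; rewrite /oc0/= !in_itv/= => /andP[->/= /ltW].
have : mu (oc0 (t - n.+1%:R^-1)) @[n --> \oo] --> (fine (mu `]0, t[%classic))%:E.
  rewrite fineK ?ge0_fin_numE// ocE; apply: nondecreasing_cvg_mu => //.
    by apply: bigcup_measurable => n _.
  move=> m n mn; apply/subsetPset/oc0_nd.
  by rewrite lerD2l lerN2 lef_pV2 ?posrE// ler_nat.
move=> /fine_cvg h; exact: (cvg_unique _ h Fnl).
Qed.

Lemma dist_cadlag : cadlag F.
Proof.
split=> [t t0|t t0]; last exact: nondec_is_cvg_left dist_nondec t0.
apply: nondec_cvg_right => //; first exact: dist_nondec.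
apply: fine_cvg; rewrite dist_EFin.
have ocE : oc0 t = \bigcap_n oc0 (t + n.+1%:R^-1).
  apply/seteqP; split => x /=.
    move=> xt n _; apply: (oc0_nd _ xt); by rewrite lerDl invr_ge0.
  move=> h; have := h 0%N I; rewrite /oc0/= !in_itv/= => /andP[-> _]/=.
  rewrite leNgt; apply/negP => tx; have [n] := ltr_add_invr tx.
  by have := h n I; rewrite /oc0/= in_itv/= => /andP[_]; rewrite leNgt => /negP.
rewrite [in X in _ --> X]ocE; apply: nonincreasing_cvg_mu => //.
  by apply: bigcap_measurable => // n _.
move=> m n mn; apply/subsetPset/oc0_nd.
by rewrite lerD2l lef_pV2 ?posrE// ler_nat.
Qed.

Lemma dist_lm t : 0 < t -> lm F t = fine (mu `]0, t[%classic).
Proof. by move=> t0; apply: lm_unique => //; exact: dist_oo. Qed.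

End Dist.

(** The tool for recognizing a Stieltjes measure: values on the intervals []0, t]] suffice. The
    intersection with [pos0] is there because [mu] may charge other times, which [LSm f] never
    does. *)
Lemma LSm_unique (mu : {measure set mR -> \bar R}) f : nondec f -> cadlag f ->
  (forall t, 0 <= t -> mu (oc0 t) = (f t - f 0)%:E) ->
  forall A, measurable A -> LSm f A = mu (A `&` pos0).
Proof.
move=> ndf cf muf A mA; have [F FE ->] := LSmE ndf cf.
rewrite -/(mrestr mu measurable_pos0 A).
apply: lebesgue_stieltjes_measure_unique => // X /ocitvP[->|[[a b]/= ab ->]].
  by rewrite !measure0.
transitivity (wlength F `]a, b]%classic).
  by apply: measurable_mu_extE; exact: is_ocitv.
rewrite wlength_itv/= lte_fin ab FE /mrestr.
(* []a, b]] lies to the left of 0, to the right of 0, or around 0; only its positive part has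
   mass. *)
have [b0|b0] := leP b 0.
  rewrite !ext0_le0// ?(le_trans (ltW ab))// subee// (_ : _ `&` _ = set0) ?measure0//.
  apply/seteqP; split => // x [] /=; rewrite /pos0/= !in_itv/= andbT => /andP[_ xb].
  by move=> x0; have := lt_le_trans x0 (le_trans xb b0); rewrite ltxx.
have [a0|a0] := leP 0 a.
  rewrite !ext0E ?(ltW b0)// setIidl; last first.
    move=> x; rewrite /pos0/= !in_itv/= andbT => /andP[+ _].
    exact: le_lt_trans.
  have := muf _ (ltW b0).
  rewrite (_ : oc0 b = oc0 a `|` `]a, b]%classic); last first.
    apply/seteqP; split => x; rewrite /oc0/= !in_itv/=.
      by move=> /andP[-> ->]; rewrite andbT/=; have [|] := leP x a; [left|right].
    by move=> [/andP[-> /le_trans]/=|/andP[/(le_lt_trans a0) ->]//]; apply; exact: ltW.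
  rewrite measureU//; last first.
    apply/seteqP; split => // x []; rewrite /oc0/= !in_itv/= => /andP[_ xa] /andP[].
    by rewrite ltNge xa.
  rewrite [X in (X + _)%E](muf _ a0) => e.
  transitivity ((f b - f 0) - (f a - f 0))%:E; first by congr (_%:E); ring.
  by rewrite EFinB -e addeC addeA [(- _ + _)%E]addeC subee// add0e.
rewrite (ext0_le0 _ (ltW a0)) (ext0E _ (ltW b0)) -EFinB -muf ?(ltW b0)//.
congr (mu _); apply/seteqP; split => x; rewrite /oc0 /pos0/= !in_itv/= andbT.
  by move=> /andP[x0 ->]; rewrite x0 (lt_trans a0).
by move=> [/andP[_ ->] ->].
Qed.

Lemma LSm_dist (mu : {measure set mR -> \bar R}) :
  (forall t, (mu (oc0 t) < +oo)%E) ->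
  forall A, measurable A -> LSm (fun t => fine (mu (oc0 t))) A = mu (A `&` pos0).
Proof.
move=> mufin; apply: LSm_unique; [exact: dist_nondec|exact: dist_cadlag|].
by move=> t t0; rewrite dist0 subr0 dist_EFin.
Qed.

Section LSmTheory.
Variable f : R -> R.
Hypotheses (ndf : nondec f) (cf : cadlag f).

Lemma LSm_pos0 A : measurable A -> LSm f A = LSm f (A `&` pos0).
Proof. by apply: LSm_unique => // t t0; rewrite LSm_oc0. Qed.

Lemma LSm_oc0_fin t : (LSm f (oc0 t) < +oo)%E.
Proof.
have [t0|t0] := leP 0 t; first by rewrite LSm_oc0// ltry.
by rewrite /oc0 set_itv_ge ?measure0// bnd_simp -leNgt ltW.
Qed.

Lemma LSm_distE t : 0 <= t -> fine (LSm f (oc0 t)) = f t - f 0.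
Proof. by move=> t0; rewrite LSm_oc0. Qed.

Lemma LSm_oo t : 0 < t -> LSm f `]0, t[%classic = (lm f t - f 0)%:E.
Proof.
move=> t0; rewrite -[LHS]fineK; last first.
  rewrite ge0_fin_numE//; apply: le_lt_trans (LSm_oc0_fin t).
  rewrite le_measure ?inE//.
  by move=> x; rewrite /oc0/= !in_itv/= => /andP[->/= /ltW].
congr (_%:E); rewrite -dist_lm//; last exact: LSm_oc0_fin.
apply: lm_unique => //; have := cadlag_lm cf t0.
move=> h; have {}h : f x - f 0 @[x --> at_left t] --> lm f t - f 0.
  by apply: cvgB => //; exact: cvg_cst.
apply: cvg_trans h; apply: near_eq_cvg; near=> x.
rewrite LSm_distE//; near: x; exact: nbhs_left_ge.
Unshelve. all: by end_near. Qed.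

Lemma LSm_set1 t : 0 < t -> LSm f [set t] = (jump f t)%:E.
Proof.
move=> t0; have := LSm_oc0 ndf cf (ltW t0).
have -> : oc0 t = `]0, t[%classic `|` [set t].
  apply/seteqP; split => x; rewrite /oc0/= !in_itv/=.
    by move=> /andP[-> /=]; rewrite le_eqVlt => /orP[/eqP ->|->]; [right|left].
  by move=> [/andP[-> /ltW->]//|->]; rewrite t0/=.
rewrite measureU//; last first.
  by apply/seteqP; split => // x [/= + xt]; rewrite xt in_itv/= ltxx andbF.
rewrite [X in (X + _)%E]LSm_oo// => e; rewrite /jump.
have e2 : f t - lm f t = (f t - f 0) - (lm f t - f 0) by ring.
by rewrite e2 EFinB -e addeC addeA [(- _ + _)%E]addeC subee// add0e.
Qed.

Lemma jump_ge0 t : 0 <= t -> 0 <= jump f t.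
Proof.
rewrite le_eqVlt => /orP[/eqP <-|t0]; first by rewrite /jump /lm ltxx subrr.
by rewrite -lee_fin -LSm_set1.
Qed.

End LSmTheory.

Lemma LSmD f g : nondec f -> cadlag f -> nondec g -> cadlag g ->
  forall A, measurable A -> LSm (fun t => f t + g t) A = (LSm f A + LSm g A)%E.
Proof.
move=> ndf cf ndg cg A mA.
have -> : (LSm f A + LSm g A)%E = measure_add (LSm f) (LSm g) (A `&` pos0).
  by rewrite measure_addE -!LSm_pos0.
apply: LSm_unique => //.
- by move=> s t s0 st; rewrite lerD ?ndf ?ndg.
- split=> [t t0|t t0]; first by apply: cvgD; [exact: cf.1|exact: cg.1].
  by apply: is_cvgD; [exact: cf.2|exact: cg.2].
- move=> t t0; rewrite [LHS]measure_addE !LSm_oc0// -EFinD.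
  by congr (_%:E); ring.
Qed.

End Distribution.

(** * Sums of jumps and the continuous part of a monotone path *)

Section JumpSum.
Context {R : realType}.
Local Notation mR := (measurableTypeR R).
Implicit Types (f g j : R -> R) (a b s t : R).

(** The absolute value makes this a measure for every [j]; it disappears for nonnegative [j], see
    [emeas_ge0]. *)
Definition atomic (j : mR -> R) (A : set mR) : \bar R := \esum_(s in A) `|j s|%:E.

Section atomic_measure.
Variable j : mR -> R.

Let atomic0 : atomic j set0 = 0%E.
Proof. by rewrite /atomic esum_set0. Qed.

Let atomic_ge0 A : (0 <= atomic j A)%E.
Proof. by apply: esum_ge0 => x _; rewrite lee_fin. Qed.

Let atomic_sigma_additive : semi_sigma_additive (atomic j).
Proof.
move=> B mB tB _; rewrite /atomic nneseries_sum_bigcup//.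
  apply: is_cvg_nneseries => n _ _; exact: esum_ge0.
Qed.

HB.instance Definition _ := isMeasure.Build _ _ _ (atomic j)
  atomic0 atomic_ge0 atomic_sigma_additive.
End atomic_measure.

Lemma LSm_finite_set f F : nondec f -> cadlag f -> finite_set F -> F `<=` pos0 ->
  LSm f F = (\sum_(s \in F) (jump f s)%:E)%E.
Proof.
move=> ndf cf finF F0; have FE : F = \bigcup_(s in F) [set s] by rewrite bigcup_imset1 image_id.
rewrite [in LHS]FE measure_fin_bigcup//.
- apply: eq_fsbigr => s /set_mem/F0; rewrite /pos0/= in_itv/= andbT.
  exact: LSm_set1.
- by move=> x y _ _ [z [-> ->]].
Qed.

Lemma esum_jump_le f A : nondec f -> cadlag f -> measurable A -> A `<=` pos0 ->
  (\esum_(s in A) (jump f s)%:E <= LSm f A)%E.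
Proof.
move=> ndf cf mA A0; apply: ge_ereal_sup => _ [F [finF FA] <-].
rewrite -LSm_finite_set//; last exact: subset_trans A0.
rewrite le_measure ?inE//.
by rewrite -(image_id F) -bigcup_imset1; apply: fin_bigcup_measurable.
Qed.

Lemma emeas_ge0 j A : (forall s, 0 <= j s) ->
  \esum_(s in A) (j s)%:E = atomic j A.
Proof. by move=> j0; apply: eq_esum => s _; rewrite ger0_norm. Qed.

Section jsum.
Variable j : R -> R.
Hypotheses (j0 : forall s, 0 <= j s)
           (jfin : forall t, (\esum_(s in oc0 t) (j s)%:E < +oo)%E).

Let jE : jsum j = fun t => fine (atomic j (oc0 t)).
Proof. by apply/funext => t; rewrite /jsum emeas_ge0. Qed.

Let jfin' t : (atomic j (oc0 t) < +oo)%E.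
Proof. by rewrite -emeas_ge0. Qed.

Lemma jsum_nondec : nondec (jsum j).
Proof. by rewrite jE; exact: dist_nondec jfin'. Qed.

Lemma jsum_cadlag : cadlag (jsum j).
Proof. by rewrite jE; exact: dist_cadlag jfin'. Qed.

Lemma LSm_jsum (A : set mR) : measurable A ->
  LSm (jsum j) A = (\esum_(s in A `&` pos0) (j s)%:E)%E.
Proof. by move=> mA; rewrite jE (LSm_dist jfin')// emeas_ge0. Qed.

Lemma jump_jsum t : 0 < t -> jump (jsum j) t = j t.
Proof.
move=> t0; apply: EFin_inj; rewrite -LSm_set1//; last 2 first.
- exact: jsum_nondec.
- exact: jsum_cadlag.
rewrite LSm_jsum// setIidl; last first.
  by move=> _ ->; rewrite /pos0/= in_itv/= t0.
by rewrite esum_set1// lee_fin.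
Qed.
End jsum.

Section continuous_part.
Variable f : R -> R.
Hypotheses (ndf : nondec f) (cf : cadlag f).

Lemma jump_ge0T s : 0 <= jump f s.
Proof.
have [/jump_ge0|s0] := leP 0 s; first exact.
by rewrite /jump /lm ltNge (ltW s0)/= subrr.
Qed.

Lemma jump_esum_fin t : (\esum_(s in oc0 t) (jump f s)%:E < +oo)%E.
Proof.
apply: le_lt_trans (LSm_oc0_fin ndf cf t).
by apply: esum_jump_le => //; exact: oc0_pos0.
Qed.

Let J := jsum (jump f).
Let ndJ : nondec J := jsum_nondec jump_ge0T jump_esum_fin.
Let cJ : cadlag J := jsum_cadlag jump_ge0T jump_esum_fin.

Definition cpart t := f t - J t.

(** The jumps in []s, t]] carry at most the mass [f t - f s] of that interval. *)
Lemma cpart_nondec : nondec cpart.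
Proof.
move=> s t s0 st; have sub : `]s, t]%classic `<=` (pos0 : set mR).
  move=> x; rewrite /pos0/= !in_itv/= andbT => /andP[+ _].
  exact: le_lt_trans.
have := @esum_jump_le f `]s, t]%classic ndf cf (measurable_itv _) sub.
have := @LSm_jsum _ jump_ge0T jump_esum_fin `]s, t]%classic (measurable_itv _).
rewrite setIidl// => <-; rewrite !LSm_oc// lee_fin /cpart.
by rewrite -/J; lra.
Qed.

Lemma cpart_cadlag : cadlag cpart.
Proof.
split=> [t t0|t t0]; first by apply: cvgB; [exact: cf.1|exact: cJ.1].
by apply: is_cvgB; [exact: cf.2|exact: cJ.2].
Qed.

Lemma lmD g h t : 0 < t -> cadlag g -> cadlag h ->
  lm (fun s => g s + h s) t = lm g t + lm h t.
Proof. by move=> t0 cg ch; apply: lm_unique => //; apply: cvgD; exact: cadlag_lm. Qed.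

Lemma lmB g h t : 0 < t -> cadlag g -> cadlag h ->
  lm (fun s => g s - h s) t = lm g t - lm h t.
Proof. by move=> t0 cg ch; apply: lm_unique => //; apply: cvgB; exact: cadlag_lm. Qed.

(** The jump sum has exactly the jumps of [f], so none is left in the difference. Left-continuity is
    what will make the continuous part predictable. *)
Lemma cpart_lm t : 0 < t -> lm cpart t = cpart t.
Proof.
move=> t0; rewrite lmB//.
have := jump_jsum jump_ge0T jump_esum_fin t0; rewrite /jump -/J /cpart -/J.
by move=> h; lra.
Qed.

Lemma LSm_cpart (A : set mR) : measurable A ->
  LSm f A = (LSm cpart A + \esum_(s in A `&` pos0) (jump f s)%:E)%E.
Proof.
move=> mA; rewrite -LSm_jsum//; last 2 first.
- exact: jump_ge0T.
- exact: jump_esum_fin.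
rewrite -LSmD//.
- by congr (LSm _ _); apply/funext => t; rewrite /cpart subrK.
- exact: cpart_nondec.
- exact: cpart_cadlag.
Qed.

Lemma jsum_le t : 0 <= t -> J t <= f t - f 0.
Proof.
move=> t0; have := esum_jump_le ndf cf (measurable_oc0 t) (@oc0_pos0 _ t).
rewrite LSm_oc0// => h; rewrite -lee_fin (le_trans _ h)// /J /jsum fineK//.
rewrite ge0_fin_numE ?jump_esum_fin// esum_ge0// => s _.
by rewrite lee_fin jump_ge0T.
Qed.
End continuous_part.

End JumpSum.

(** * Measures given by a density *)

Section Density.
Import HBNNSimple.
Context {d} {T : measurableType d} {R : realType}.
Variable mu : {measure set T -> \bar R}.

Lemma density_ex (h : T -> R) : measurable_fun setT h -> (forall x, 0 <= h x) ->
  exists nu : {measure set T -> \bar R}, forall A, nu A = (\int[mu]_(x in A) (h x)%:E)%E.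
Proof.
move=> mh h0; pose nu A := (\int[mu]_(x in A) (h x)%:E)%E.
have nu0 : nu set0 = 0%E by rewrite /nu integral_set0.
have nu_ge0 A : (0 <= nu A)%E by apply: integral_ge0 => x _; rewrite lee_fin.
have mh' : measurable_fun setT (EFin \o h) by exact/measurable_EFinP.
have h0' x : (0 <= (EFin \o h) x)%E by rewrite lee_fin.
have nus := semi_sigma_additive_nng_induced (mu := mu) mh' h0'.
pose m : {measure set T -> \bar R} :=
  HB.pack nu (isMeasure.Build _ _ _ nu nu0 nu_ge0 nus).
by exists m.
Qed.

(** Both sides are limits along simple functions increasing to [f]; for one value of a simple
    function the claim is the formula for [nu]. *)
Lemma integral_density (nu : {measure set T -> \bar R}) (h : T -> R) (f : T -> \bar R) :
  measurable_fun setT h -> (forall x, 0 <= h x) ->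
  (forall A, measurable A -> nu A = (\int[mu]_(x in A) (h x)%:E)%E) ->
  measurable_fun setT f -> (forall x, (0 <= f x)%E) ->
  (\int[nu]_x f x = \int[mu]_x (f x * (h x)%:E))%E.
Proof.
move=> mh h0 nuE mf f0.
have mhE : measurable_fun setT (EFin \o h) by exact/measurable_EFinP.
pose f_ := nnsfun_approx measurableT mf.
have f_f x : (f_ n x)%:E @[n --> \oo] --> f x.
  exact: cvg_nnsfun_approx.
have ndf x m n : (m <= n)%N -> f_ m x <= f_ n x.
  by move=> mn; exact/lefP/nd_nnsfun_approx.
transitivity (limn (fun n => \int[nu]_x (f_ n x)%:E)%E).
  rewrite -monotone_convergence//.
  - by apply: eq_integral => x _; apply/esym/cvg_lim => //; exact: f_f.
  - by move=> n; apply/measurable_EFinP.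
  - by move=> n x _; rewrite lee_fin.
  - by move=> x _ m n mn; rewrite lee_fin ndf.
transitivity (limn (fun n => \int[mu]_x ((f_ n x)%:E * (h x)%:E))%E); last first.
  rewrite -monotone_convergence//.
  - apply: eq_integral => x _; apply/cvg_lim => //.
    by apply: cvgeZr => //; exact: f_f.
  - by move=> n; apply: emeasurable_funM => //; apply/measurable_EFinP.
  - by move=> n x _; rewrite mule_ge0// lee_fin.
  - by move=> x _ m n mn; rewrite lee_wpmul2r ?lee_fin// ndf.
congr (limn _); apply/funext => n.
transitivity (\int[nu]_x
   (\sum_(y \in range (f_ n)) (y * \1_(f_ n @^-1` [set y]) x)%:E))%E.
  by apply: eq_integral => t tE; rewrite /= fimfunE -fsumEFin.
have indich m r : measurable_fun setT (fun x => (r * \1_(f_ m @^-1` [set r]) x)%:E).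
  by apply: (measurable_comp measurableT) => //; exact: measurable_funM.
rewrite ge0_integral_fsum//; last by move=> m y Ey; exact: nnfun_muleindic_ge0.
transitivity (\int[mu]_x (\sum_(y \in range (f_ n))
    (y * \1_(f_ n @^-1` [set y]) x)%:E * (h x)%:E))%E; last first.
  under [RHS]eq_integral => x xE.
    rewrite fimfunE -fsumEFin// ge0_mule_fsuml; last first.
      by move=> y; exact: nnfun_muleindic_ge0.
    over.
  by [].
rewrite ge0_integral_fsum//; last 2 first.
  - by move=> y; apply: emeasurable_funM.
  - by move=> m y Ey; apply: mule_ge0; [exact: nnfun_muleindic_ge0|rewrite lee_fin].
apply: eq_fsbigr => r rhn.
under [LHS]eq_integral do rewrite EFinM.
rewrite integralZl_indic_nnsfun//=.
under [RHS]eq_integral do rewrite EFinM -muleA.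
rewrite ge0_integralZl//.
- under [in RHS]eq_integral do rewrite muleC.
  rewrite [in RHS](eq_integral ((EFin \o h) \_ (f_ n @^-1` [set r]))); last first.
    by move=> x xE; rewrite epatch_indic.
  by rewrite -integral_mkcond -nuE// integral_indic// setIT.
- by apply: emeasurable_funM => //; exact/measurable_EFinP.
- by move=> t Et; rewrite mule_ge0 ?lee_fin.
- by move: rhn; rewrite inE => -[t _ <-]; rewrite lee_fin.
Qed.
End Density.

(** * Indefinite integrals *)

Section StieltjesIntegral.
Context {R : realType}.
Local Notation mR := (measurableTypeR R).
Variable mu : {measure set mR -> \bar R}.
Hypothesis mufin : forall t, (mu (oc0 t) < +oo)%E.

Definition locint (h : mR -> R) := forall t, mu.-integrable (oc0 t) (EFin \o h).

(** The indefinite integral is the distribution function of the measure with density [h], so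
    everything proved for distribution functions applies. *)
Lemma nng_dist (h : mR -> R) : measurable_fun setT h -> (forall x, 0 <= h x) -> locint h ->
  let I := fun t => \int[mu]_(s in oc0 t) h s in
  [/\ nondec I, cadlag I,
     forall t, 0 < t -> lm I t = \int[mu]_(s in `]0, t[%classic) h s &
     forall A, measurable A -> LSm I A = (\int[mu]_(x in A `&` pos0) (h x)%:E)%E].
Proof.
move=> mh h0 ih I; have [nu nuE] := density_ex mu mh h0.
have IE : I = fun t => fine (nu (oc0 t)) by apply/funext => t; rewrite nuE.
have nufin t : (nu (oc0 t) < +oo)%E.
  rewrite nuE; have /integrableP[_] := ih t; apply: le_lt_trans.
  apply: ge0_le_integral => //.
  - by move=> x _; rewrite lee_fin.
  - by apply/measurable_EFinP; exact: measurable_funTS.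
  - by apply/measurable_EFinP; apply: measurableT_comp => //; exact: measurable_funTS.
  - by move=> x _; rewrite lee_fin ler_norm.
rewrite IE; split.
- exact: dist_nondec nufin.
- exact: dist_cadlag nufin.
- by move=> t t0; rewrite (dist_lm nufin)// nuE.
- by move=> A mA; rewrite (LSm_dist nufin)// nuE.
Qed.

Lemma locint_measurable (h : mR -> R) : locint h -> measurable_fun pos0 h.
Proof.
move=> ih; rewrite pos0_bigcup; apply/measurable_fun_bigcup => // n.
by have /integrableP[/measurable_EFinP] := ih n%:R.
Qed.

Lemma measurable_patch0 (h : mR -> R) : measurable_fun pos0 h -> measurable_fun setT (h \_ pos0).
Proof.
by move=> mh; apply/(measurable_restrictT h measurable_pos0).
Qed.

Lemma le_locint (h g : mR -> R) : measurable_fun pos0 h -> locint g ->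
  (forall s, 0 < s -> `|h s| <= g s) -> locint h.
Proof.
move=> mh ig hg t; apply: le_integrable (ig t) => //.
  apply/measurable_EFinP; apply: measurable_funS mh => //; exact: oc0_pos0.
move=> s /oc0_pos0; rewrite /pos0/= in_itv/= andbT => s0; rewrite lee_fin.
by rewrite (le_trans (hg _ s0))// ler_norm.
Qed.

Lemma eq_locint (h g : mR -> R) : (forall s, 0 < s -> h s = g s) -> locint g -> locint h.
Proof.
move=> hg ig t; apply: eq_integrable (ig t) => // s /set_mem/oc0_pos0.
by rewrite /pos0/= in_itv/= andbT => s0 /=; rewrite hg.
Qed.

Lemma locintD (h g : mR -> R) : locint h -> locint g -> locint (fun s => h s + g s).
Proof. by move=> ih ig t; exact: integrableD (ih t) (ig t). Qed.

Lemma locintN (h : mR -> R) : locint h -> locint (fun s => - h s).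
Proof. by move=> ih t; exact: integrableN (ih t). Qed.

Lemma locintB (h g : mR -> R) : locint h -> locint g -> locint (fun s => h s - g s).
Proof. by move=> ih ig; exact: locintD ih (locintN ig). Qed.

Lemma locint_sub (h : mR -> R) A t : locint h -> measurable A -> A `<=` oc0 t ->
  mu.-integrable A (EFin \o h).
Proof. by move=> ih mA At; exact: integrableS (ih t). Qed.

Lemma bounded_locint (h : mR -> R) : measurable_fun pos0 h ->
  (forall t, exists K, forall s, 0 < s -> s <= t -> `|h s| <= K) -> locint h.
Proof.
move=> mh bh t; have [K hK] := bh t.
apply: (@measurable_bounded_integrable _ _ _ mu (h : mR -> R) (oc0 t)) => //.
  apply: measurable_funS mh => //; exact: oc0_pos0.
exists K; split; first exact: num_real.
move=> x Kx s; rewrite /= /oc0/= in_itv/= => /andP[s0 st].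
exact: le_trans (hK _ s0 st) (ltW Kx).
Qed.

(** Local integrability constrains [h] at positive times only, whereas a density lives on the whole
    line: [h] is set to 0 outside [pos0] before it is split into positive and negative part. *)
Lemma locint_pm (h : mR -> R) : locint h ->
  exists hp hm : mR -> R, [/\ measurable_fun setT hp /\ measurable_fun setT hm,
    (forall s, 0 <= hp s) /\ (forall s, 0 <= hm s),
    locint hp /\ locint hm & forall s, 0 < s -> h s = hp s - hm s].
Proof.
move=> ih; have mh := locint_measurable ih.
pose g : mR -> R := h \_ pos0.
have mg : measurable_fun setT g by exact: measurable_patch0.
have gE s : 0 < s -> g s = h s.
  by move=> s0; rewrite /g patchE mem_set// /pos0/= in_itv/= s0.
have ig : locint g by exact: eq_locint ih.
exists (fun s => Num.max (g s) 0), (fun s => Num.max (- g s) 0).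
have mp : measurable_fun setT (fun s : mR => Num.max (g s) 0).
  by apply: measurable_maxr => //; exact: measurable_cst.
have mm : measurable_fun setT (fun s : mR => Num.max (- g s) 0).
  apply: measurable_maxr; last exact: measurable_cst.
  exact: measurableT_comp.
have ig' : locint (fun s => `|g s|).
  by move=> t; have := integrable_abse (ig t).
split.
- by split.
- by split=> s; rewrite le_max lexx orbT.
- split; (apply: le_locint ig' _ => [|s _]; first exact: measurable_funTS).
    by rewrite ger0_norm ?le_max ?lexx ?orbT// ge_max ler_norm normr_ge0.
  by rewrite ger0_norm ?le_max ?lexx ?orbT// ge_max normr_ge0 -normrN ler_norm.
- move=> s s0; rewrite -gE//; case: (leP 0 (g s)) => g0.
    by rewrite max_r ?subr0// oppr_le0.
  by rewrite max_l ?oppr_ge0 ?ltW// add0r opprK.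
Qed.

Lemma locint_cadlag (h : mR -> R) : locint h ->
  let I := fun t => \int[mu]_(s in oc0 t) h s in
  cadlag I /\ forall t, 0 < t -> lm I t = \int[mu]_(s in `]0, t[%classic) h s.
Proof.
move=> ih I; have [hp [hm [[mp mm] [p0 m0] [ip im] hE]]] := locint_pm ih.
have oE t s : oc0 t s -> 0 < s.
  by move=> /oc0_pos0; rewrite /pos0/= in_itv/= andbT.
have IE : I = fun t => \int[mu]_(s in oc0 t) hp s - \int[mu]_(s in oc0 t) hm s.
  apply/funext => t; rewrite -RintegralB//.
  by apply: eq_Rintegral => s /set_mem/oE/hE.
have [_ cp lp _] := nng_dist mp p0 ip.
have [_ cm lmm _] := nng_dist mm m0 im.
rewrite IE; split.
  split=> [t t0|t t0]; first by apply: cvgB; [exact: cp.1|exact: cm.1].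
  by apply: is_cvgB; [exact: cp.2|exact: cm.2].
move=> t t0; rewrite lmB// lp// lmm// -RintegralB//.
- by apply: eq_Rintegral => s /set_mem/=; rewrite in_itv/= => /andP[/hE].
- apply: (locint_sub (t := t) ip) => //.
  by move=> x; rewrite /oc0/= !in_itv/= => /andP[-> /ltW].
- apply: (locint_sub (t := t) im) => //.
  by move=> x; rewrite /oc0/= !in_itv/= => /andP[-> /ltW].
Qed.

Lemma oc0_split (s t : R) : 0 <= s -> s <= t -> oc0 t = oc0 s `|` `]s, t]%classic.
Proof.
move=> s0 st; apply/seteqP; split => x; rewrite /oc0/= !in_itv/=.
  by move=> /andP[-> ->]; rewrite andbT/=; have [|] := leP x s; [left|right].
move=> [/andP[-> /le_trans]/=|/andP[/(le_lt_trans s0) ->]//]; exact.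
Qed.

Lemma oc0_disj (s t : R) : [disjoint oc0 s & `]s, t]%classic].
Proof.
apply/disj_setPS => x []; rewrite /oc0/= !in_itv/= => /andP[_ xa] /andP[].
by rewrite ltNge xa.
Qed.

Lemma Rintegral_oc0B (h : mR -> R) s t : locint h -> 0 <= s -> s <= t ->
  \int[mu]_(x in oc0 t) h x - \int[mu]_(x in oc0 s) h x =
  \int[mu]_(x in `]s, t]%classic) h x.
Proof.
move=> ih s0 st; rewrite (oc0_split s0 st) Rintegral_setU//.
- by rewrite addrAC subrr add0r.
- by rewrite -oc0_split//; exact: ih.
- exact: oc0_disj.
Qed.

(** Isolates the atom at [t]. With [locint_cadlag] it becomes the decomposition of an integral into
    its left limit and its jump. *)
Lemma Rintegral_oc0_last (h : mR -> R) t : locint h -> 0 < t ->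
  \int[mu]_(x in oc0 t) h x =
  \int[mu]_(x in `]0, t[%classic) h x + h t * fine (mu [set t]).
Proof.
move=> ih t0; have E : oc0 t = `]0, t[%classic `|` [set t].
  apply/seteqP; split => x; rewrite /oc0/= !in_itv/=.
    by move=> /andP[-> /=]; rewrite le_eqVlt => /orP[/eqP ->|->]; [right|left].
  by move=> [/andP[-> /ltW->]//|->]; rewrite t0/=.
rewrite E Rintegral_setU//.
- congr (_ + _); rewrite -Rintegral_cst//.
  by apply: eq_Rintegral => x /set_mem ->.
- by rewrite -E.
- apply/disj_setPS => x [/= + xt]; rewrite xt in_itv/= ltxx andbF.
  by [].
Qed.

End StieltjesIntegral.

Lemma integral_mrestr {d} {T : measurableType d} {R : realType}
    (mu : {measure set T -> \bar R}) (D : set T) (mD : measurable D) (f : T -> \bar R) :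
  measurable_fun setT f -> (forall x, (0 <= f x)%E) ->
  (\int[mrestr mu mD]_x f x = \int[mu]_(x in D) f x)%E.
Proof.
move=> mf f0; rewrite (@integral_density _ _ _ mu _ (\1_D : T -> R))//.
- rewrite [RHS]integral_mkcond; apply: eq_integral => x _.
  by rewrite epatch_indic.
- by move=> A mA; rewrite integral_indic// setIC.
Qed.

(** * Predictable sets and processes *)

Section Predictable.
Context {R : realType} {d : measure_display} {Omega : measurableType d}.
Variable F : R -> set (set Omega).

(** Weak enough to admit constant filtrations. Through these, facts about deterministic paths and
    about merely measurable processes are instances of facts about adapted processes. *)
Definition filtration := (forall t, 0 <= t -> sigma_algebra setT (F t)) /\
  (forall s t A, 0 <= s -> s <= t -> F s A -> F t A).

Hypothesis filtF : filtration.

Local Notation mR := (measurableTypeR R).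
Local Notation PT := (g_sigma_algebraType (pred_gen F)).
Local Notation FT t := (g_sigma_algebraType (F t)).

Lemma FsetT t : 0 <= t -> F t setT.
Proof. by move=> t0; have [] := filtF.1 t t0 => F0 /(_ _ F0); rewrite setD0. Qed.

Lemma Fset0 t : 0 <= t -> F t set0.
Proof. by move=> t0; have [] := filtF.1 t t0. Qed.

Lemma measurable_FT t (A : set Omega) : 0 <= t -> measurable (A : set (FT t)) <-> F t A.
Proof. by move=> t0; rewrite (measurable_g_measurableTypeE (filtF.1 t t0)). Qed.

Lemma FsetI t (A B : set Omega) : 0 <= t -> F t A -> F t B -> F t (A `&` B).
Proof.
move=> t0 /(measurable_FT _ t0) mA /(measurable_FT _ t0) mB.
by apply/(measurable_FT _ t0); exact: measurableI.
Qed.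

Lemma FT_subset s t (A : set Omega) : 0 <= s -> s <= t ->
  measurable (A : set (FT s)) -> measurable (A : set (FT t)).
Proof.
move=> s0 st /(measurable_FT _ s0) As.
by apply/measurable_FT; [exact: le_trans st|exact: filtF.2 As].
Qed.

Lemma pred_oc A s t : 0 <= s -> F s A -> measurable (A `*` `]s, t]%classic : set PT).
Proof. by move=> s0 FA; apply: sub_sigma_algebra; left; exists A, s, t. Qed.

Lemma pred_0 A : F 0 A -> measurable (A `*` [set 0] : set PT).
Proof. by move=> FA; apply: sub_sigma_algebra; right; exists A. Qed.

Lemma Dom0E : Dom0 = setT `*` [set 0] `|` \bigcup_(n : nat) (setT `*` `]0, n%:R]%classic)
  :> set (Omega * R).
Proof.
apply/seteqP; split => -[w s]/=; rewrite /Dom0/=.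
  rewrite in_itv/= andbT => -[_]; rewrite le_eqVlt => /orP[/eqP <-|s0]; first by left.
  right; exists (Num.bound s) => //=; split=> //.
  rewrite in_itv/= s0/=; exact/ltW/archi_boundP/ltW.
move=> [[_ ->]|[n _ [_ /=]]]; rewrite !in_itv/= ?lexx//.
by move=> /andP[/ltW ->].
Qed.

Lemma measurable_Dom0 : measurable (Dom0 : set PT).
Proof.
rewrite Dom0E; apply: measurableU; first by apply: pred_0; exact: FsetT.
by apply: bigcupT_measurable => n; apply: pred_oc => //; exact: FsetT.
Qed.

Lemma pred_oo A s : 0 <= s -> F s A -> measurable (A `*` `]s, +oo[%classic : set PT).
Proof.
move=> s0 FA; rewrite (_ : _ `*` _ = \bigcup_(n : nat) (A `*` `]s, n%:R]%classic)).
  by apply: bigcupT_measurable => n; exact: pred_oc.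
apply/seteqP; split => -[w u]/=.
  rewrite in_itv/= andbT => -[Aw su]; exists (Num.bound u) => //=; split=> //.
  by rewrite in_itv/= su/=; exact/ltW/archi_boundP/(le_trans s0)/ltW.
by move=> [n _ [Aw /=]]; rewrite !in_itv/= => /andP[->].
Qed.

(** [predictable F] is a sigma-algebra on [Dom0], while [PT] carries the one generated on all of
    [Omega * R]. As [Dom0] belongs to the latter, the former is its trace. *)
Lemma predictableP A : predictable F A <-> measurable (A : set PT) /\ A `<=` Dom0.
Proof.
split.
  suff : predictable F `<=` [set A | measurable (A : set PT) /\ A `<=` Dom0] by exact.
  apply: smallest_sub.
    split.
    - by split=> //; exact: measurable0.
    - move=> B [mB BD]; split; last exact: subDsetl.
      by apply: measurableD => //; exact: measurable_Dom0.
    - move=> B h; split; first by apply: bigcupT_measurable => n; exact: (h n).1.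
      by move=> x [n _]; exact: (h n).2.
  move=> B GB; split; first exact: sub_sigma_algebra.
  case: GB => [[C [s [t [s0 _ ->]]]]|[C [_ ->]]] [w u] [_ /=].
    rewrite !in_itv/= => /andP[su _]; rewrite /Dom0/= in_itv/= andbT; split=> //.
    exact: le_trans (ltW su).
  by move=> ->; rewrite /Dom0/= in_itv/= lexx.
move=> [mA AD]; rewrite -(setIidl AD); move: mA => {AD}.
have sD : sigma_algebra Dom0 (predictable F) by exact: smallest_sigma_algebra.
suff : (measurable : set (set PT)) `<=` [set A | predictable F (A `&` Dom0)] by exact.
apply: smallest_sub.
  split=> /=.
  - by rewrite set0I; case: sD.
  - move=> B mB; rewrite setTD (_ : _ `&` _ = Dom0 `\` (B `&` Dom0)).
      by case: sD => _ + _; exact.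
    by rewrite setDIr setDv setU0 setDE setIC.
  - by move=> B mB; rewrite setI_bigcupl; case: sD => _ _; exact.
move=> B GB /=; rewrite setIidl; first exact: sub_gen_smallest.
case: GB => [[C [s [t [s0 _ ->]]]]|[C [_ ->]]] [w u] [_ /=].
  rewrite !in_itv/= => /andP[su _]; rewrite /Dom0/= in_itv/= andbT; split=> //.
  exact: le_trans (ltW su).
by move=> ->; rewrite /Dom0/= in_itv/= lexx.
Qed.

Lemma pred_funP (Z : Omega -> R -> R) :
  pred_fun F Z <-> @measurable_fun _ _ PT R Dom0 (fun p => Z p.1 p.2).
Proof.
split=> [h _ B mB|h B mB]; last first.
  apply/predictableP; split; last exact: subIsetl.
  exact: h measurable_Dom0 B mB.
have [hm _] := (predictableP _).1 (h B mB).
exact: hm.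
Qed.

Lemma measurable_section (w : Omega) : @measurable_fun _ _ mR PT setT (fun s => (w, s)).
Proof.
apply: (@measurability _ _ mR PT setT _ (pred_gen F)) => // _ [B GB <-]; rewrite setTI.
case: GB => [[C [s [t [s0 _ ->]]]]|[C [_ ->]]].
  have [Cw|Cw] := pselect (C w).
    rewrite (_ : _ @^-1` _ = `]s, t]%classic); first exact: measurable_itv.
    by apply/seteqP; split => u //= [].
  rewrite (_ : _ @^-1` _ = set0); first exact: measurable0.
  by apply/seteqP; split => u //= [].
have [Cw|Cw] := pselect (C w).
  rewrite (_ : _ @^-1` _ = [set 0]); first exact: measurable_set1.
  by apply/seteqP; split => u //= [].
rewrite (_ : _ @^-1` _ = set0); first exact: measurable0.
by apply/seteqP; split => u //= [].
Qed.

Lemma adaptedP (Z : Omega -> R -> R) :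
  adapted F Z <-> forall t, 0 <= t -> @measurable_fun _ _ (FT t) R setT (Z ^~ t).
Proof.
split=> [h t t0 _ B mB|h t t0 B mB].
  by rewrite setTI; apply/(measurable_FT _ t0); exact: h.
by apply/(measurable_FT _ t0); have := h t t0 measurableT B mB; rewrite setTI.
Qed.

Lemma adapted_le Z s t : adapted F Z -> 0 <= s -> s <= t ->
  @measurable_fun _ _ (FT t) R setT (Z ^~ s).
Proof.
move=> aZ s0 st _ B mB; rewrite setTI; apply: (FT_subset s0 st).
by apply/(measurable_FT _ s0); exact: aZ s s0 B mB.
Qed.

Lemma measurable_xsec (U : set PT) w : measurable U ->
  measurable ([set s | U (w, s)] : set mR).
Proof. by move=> mU; rewrite -[X in measurable X]setTI; exact: measurable_section. Qed.

(** For a measure [mu], the image of its restriction to [D] under [s |-> (w, s)]: as [w] varies, a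
    kernel from [Omega] to the predictable space. The proof [mD] is an argument so that the measure
    structure can be attached to the definition. *)
Definition secmeas (mu : set mR -> \bar R) (w : Omega) (D : set mR) (mD : measurable D)
  (U : set PT) : \bar R := mu ([set s | U (w, s)] `&` D).

Section SectionMeasure.
Variables (mu : {measure set mR -> \bar R}) (w : Omega) (D : set mR) (mD : measurable D).

Local Notation secmeas := (secmeas mu w mD).

Let secmeas0 : secmeas set0 = 0%E.
Proof. by rewrite /secmeas (_ : _ `&` _ = set0) ?measure0// -subset0 => s []. Qed.

Let secmeas_ge0 U : (0 <= secmeas U)%E.
Proof. exact: measure_ge0. Qed.

Let secmeas_sigma_additive : semi_sigma_additive secmeas.
Proof.
move=> U mU tU mUU; rewrite /secmeas.
rewrite [X in mu X](_ : _ = \bigcup_n ([set s | U n (w, s)] `&` D)); last first.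
  by rewrite -setI_bigcupl; congr (_ `&` _); apply/seteqP; split => s [n _ ?]; exists n.
have ms n : measurable ([set s | U n (w, s)] `&` D).
  by apply: measurableI => //; exact: measurable_xsec.
apply: measure_semi_sigma_additive => //; last exact: bigcupT_measurable.
apply/trivIsetP => m n _ _ mn; rewrite -subset0 => s [[/= Um _] [Un _]].
by move/trivIsetP : tU => /(_ m n I I mn) h; suff : set0 (w, s) by []; rewrite -h.
Qed.

HB.instance Definition _ := isMeasure.Build _ _ _ secmeas secmeas0 secmeas_ge0
  secmeas_sigma_additive.

End SectionMeasure.

Lemma integral_secmeas (mu : {measure set mR -> \bar R}) w (D : set mR) (mD : measurable D)
    (f : PT -> \bar R) :
  measurable_fun setT f -> (forall x, (0 <= f x)%E) ->
  (\int[secmeas mu w mD]_p f p = \int[mu]_(s in D) f (w, s))%E.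
Proof.
move=> mf f0; have ms := measurable_section w.
rewrite -[RHS](integral_mrestr mu mD); last 2 first.
- exact: measurableT_comp mf ms.
- by move=> s; exact: f0.
rewrite -(ge0_integral_pushforward ms _ measurableT)//.
Qed.

End Predictable.

(** * Stieltjes masses of the sections of a predictable set *)

Section Kernel.
Context {R : realType} {d : measure_display} {Omega : measurableType d}.
Variable F : R -> set (set Omega).
Hypothesis filtF : filtration F.
Local Notation mR := (measurableTypeR R).
Local Notation PT := (g_sigma_algebraType (pred_gen F)).
Local Notation FT t := (g_sigma_algebraType (F t)).

Lemma pred_gen_setI : setI_closed (pred_gen F).
Proof.
move=> _ _ [[A [s [t [s0 FA ->]]]]|[A [FA ->]]] [[A' [s' [t' [s0' FA' ->]]]]|[A' [FA' ->]]].
- left; exists (A `&` A'), (Num.max s s'), (Num.min t t').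
  have ss : 0 <= Num.max s s' by rewrite le_max s0.
  split=> //.
    apply: FsetI => //.
      by apply: (filtF.2 s) => //; rewrite le_max lexx.
    by apply: (filtF.2 s') => //; rewrite le_max lexx orbT.
  rewrite -setXI; congr (_ `*` _); apply/seteqP; split => x /=; rewrite !in_itv/=.
    by move=> [/andP[a b] /andP[c e]]; rewrite gt_max le_min a b c e.
  by rewrite gt_max le_min => /andP[/andP[-> ->] /andP[-> ->]].
- right; exists set0; split; first exact: Fset0.
  rewrite set0X -subset0 => -[w u] /= [[_]] /[swap] -[_ ->].
  by rewrite in_itv/= ltNge s0.
- right; exists set0; split; first exact: Fset0.
  rewrite set0X -subset0 => -[w u] /= [[_ ->]] -[_].
  by rewrite in_itv/= ltNge s0'.
- right; exists (A `&` A'); split; first exact: FsetI.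
  by rewrite -setXI setIid.
Qed.

Variable A : Omega -> R -> R.
Hypotheses (ndA : forall w, nondec (A w)) (cA : forall w, cadlag (A w)) (aA : adapted F A).

(** Dynkin's lemma on the generators: for [C] in [F s], the section of [C * ]s, u]] has up to [t]
    the mass [1_C (A (min u t) - A s)], which is known at time [t]. *)
Lemma measurable_LSm_section t (U : set PT) : 0 <= t -> measurable U ->
  @measurable_fun _ _ (FT t) (\bar R) setT
    (fun w => LSm (A w) ([set s | U (w, s)] `&` oc0 t)).
Proof.
move=> t0 mU; have mx (V : set PT) w : measurable V ->
    measurable ([set s | V (w, s)] `&` oc0 t : set mR).
  by move=> mV; apply: measurableI => //; exact: measurable_xsec.
have mAt s : 0 <= s -> s <= t -> @measurable_fun _ _ (FT t) R setT (A ^~ s).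
  by move=> s0 st; exact: adapted_le.
pose P (U : set PT) := @measurable_fun _ _ (FT t) (\bar R) setT
    (fun w => LSm (A w) ([set s | U (w, s)] `&` oc0 t)).
have PT0 : @measurable_fun _ _ (FT t) (\bar R) setT (fun w => LSm (A w) (oc0 t)).
  apply: (@eq_measurable_fun _ _ (FT t) (\bar R) setT (fun w => (A w t - A w 0)%:E)).
    by move=> w _; rewrite LSm_oc0.
  by apply/measurable_EFinP; apply: measurable_funB; exact: mAt.
apply: (@dynkin_induction _ PT (pred_gen F) P) => //.
- exact: pred_gen_setI.
- by rewrite /P; under eq_fun do rewrite setTI.
- move=> _ [[C [s [u [s0 FC ->]]]]|[C [FC ->]]]; rewrite /P; last first.
    apply: (@eq_measurable_fun _ _ (FT t) (\bar R) setT (fun w => 0%E)); last exact: measurable_cst.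
    move=> w _; rewrite (_ : _ `&` _ = set0) ?measure0// -subset0 => x [[_ /= ->]].
    by rewrite /oc0/= in_itv/= ltxx.
  have [su|us] := leP s (Num.min u t); last first.
    apply: (@eq_measurable_fun _ _ (FT t) (\bar R) setT (fun w => 0%E)); last exact: measurable_cst.
    move=> w _; rewrite (_ : _ `&` _ = set0) ?measure0// -subset0 => x [[_ /=]].
    rewrite /oc0/= !in_itv/= => /andP[sx xu] /andP[_ xt].
    by move: us; rewrite ltNge le_min !(le_trans (ltW sx)).
  have st : s <= t by move: su; rewrite le_min => /andP[].
  have ut0 : 0 <= Num.min u t by exact: le_trans su.
  apply: (@eq_measurable_fun _ _ (FT t) (\bar R) setT (fun w => (\1_C w * (A w (Num.min u t) - A w s))%:E)).
    move=> w _; rewrite indicE.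
    have [Cw|Cw] := boolP (w \in C).
      rewrite mul1r (_ : _ `&` _ = `]s, Num.min u t]%classic) ?LSm_oc//.
      apply/seteqP; split=> x; rewrite /oc0/= !in_itv/= le_min.
        by move=> [[_ /andP[-> ->]] /andP[_ ->]].
      move=> /and3P[sx -> ->]; rewrite sx (le_lt_trans s0 sx).
      by split=> //; split=> //; exact: set_mem.
    rewrite mul0r (_ : _ `&` _ = set0) ?measure0// -subset0 => x [[/= Cw']].
    by move: Cw; rewrite notin_setE.
  apply/measurable_EFinP; apply: measurable_funM.
    apply: (@measurable_indic _ (FT t)).
    by apply/(measurable_FT filtF _ t0); apply: (filtF.2 s).
  by apply: measurable_funB; apply: mAt => //; rewrite ge_min lexx orbT.
- move=> S mS PS; rewrite /P.
  apply: (@eq_measurable_fun _ _ (FT t) (\bar R) setT (fun w => LSm (A w) (oc0 t) -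
      LSm (A w) ([set s | S (w, s)] `&` oc0 t))%E).
    move=> w _; rewrite (_ : _ `&` _ = oc0 t `\` ([set s | S (w, s)] `&` oc0 t)).
      rewrite measureD//; [|exact: mx|exact: LSm_oc0_fin].
      by rewrite [oc0 t `&` _]setIidr//; exact: subIsetr.
    by apply/seteqP; split=> x /=; [move=> [h1 h2]; split=> // -[]|move=> [h1 h2]; split=> // h; apply: h2].
  by apply: emeasurable_funB.
- move=> S mS tS PS; rewrite /P.
  apply: (@eq_measurable_fun _ _ (FT t) (\bar R) setT (fun w => \sum_(n <oo | n \in predT)
     LSm (A w) ([set s | S n (w, s)] `&` oc0 t))%E).
    move=> w _; rewrite (_ : _ `&` _ = \bigcup_n ([set s | S n (w, s)] `&` oc0 t)).
      rewrite measure_semi_bigcup//.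
      + by move=> n; exact: mx.
      + apply/trivIsetP => m n _ _ mn; rewrite -subset0 => s [[/= Um _] [Un _]].
        move/trivIsetP : tS => /(_ m n I I mn) h.
        by suff : set0 (w, s) by []; rewrite -h.
      + by apply: bigcupT_measurable => n; exact: mx.
    by rewrite -setI_bigcupl; congr (_ `&` _); apply/seteqP; split => s [n _ ?]; exists n.
  by apply: ge0_emeasurable_sum => // n _; exact: PS.
Qed.

Lemma measurable_LSm_integral t (f : PT -> \bar R) : 0 <= t ->
  measurable_fun setT f -> (forall x, (0 <= f x)%E) ->
  @measurable_fun _ _ (FT t) (\bar R) setT
    (fun w => \int[LSm (A w)]_(s in oc0 t) f (w, s))%E.
Proof.
move=> t0 mf f0.
have h : @measurable_fun _ _ (FT t) (\bar R) setT (fun w =>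
    \int[@secmeas _ _ _ F (LSm (A w)) w _ (measurable_oc0 t)]_p f p)%E.
  apply: (@measurable_fun_integral_kernel _ _ (FT t) PT R) => // U mU.
  exact: measurable_LSm_section.
apply: eq_measurable_fun h => w _; rewrite integral_secmeas//.
Qed.

End Kernel.

(** The indicator in (C1). The infimum runs over times before [s], so a path that jumps to 0 at [s]
    is still alive at [s]. For [s <= 0] the infimum is over the empty set and equals 0, so nothing
    is alive. *)
Definition alive {R : realType} (y : R -> R) (s : R) : bool :=
  0 < inf [set y u | u in `[0, s[].

(** * Predictability of left limits and of survival *)

Section PredictableProcesses.
Context {R : realType} {d : measure_display} {Omega : measurableType d}.
Variable F : R -> set (set Omega).
Hypothesis filtF : filtration F.
Local Notation mR := (measurableTypeR R).
Local Notation PT := (g_sigma_algebraType (pred_gen F)).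
Local Notation FT t := (g_sigma_algebraType (F t)).
Implicit Types (Z : Omega -> R -> R).

(** Stieltjes measures charge positive times only, so processes are mostly considered here; time 0
    would need separate treatment for left limits and for [alive]. *)
Definition Dpos : set (Omega * R) := setT `*` pos0.
Definition Dzero : set (Omega * R) := setT `*` [set 0].

Lemma measurable_Dpos : measurable (Dpos : set PT).
Proof. by apply: pred_oo => //; exact: FsetT. Qed.

Lemma measurable_Dzero : measurable (Dzero : set PT).
Proof. by apply: pred_0; exact: FsetT. Qed.

Lemma Dom0U : Dom0 = Dzero `|` Dpos.
Proof.
apply/seteqP; split => -[w s]; rewrite /Dom0 /Dpos /pos0.
  move=> [_ /=]; rewrite in_itv/= andbT le_eqVlt => /orP[/eqP<-|s0]; [by left|right].
  by split=> //=; rewrite in_itv/= s0.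
move=> [[_ /= ->]|]; first by split=> //=; rewrite in_itv/= lexx.
by move=> [_ /=]; rewrite in_itv/= andbT => s0; split=> //=; rewrite in_itv/= ltW.
Qed.

Lemma DposE (p : Omega * R) : Dpos p <-> 0 < p.2.
Proof.
rewrite /Dpos /pos0; split=> [[_ /=]|h]; first by rewrite in_itv/= andbT.
by split=> //=; rewrite in_itv/= h.
Qed.

Lemma pred_fun_pos Z : pred_fun F Z -> @measurable_fun _ _ PT R Dpos (fun p => Z p.1 p.2).
Proof.
move=> /(pred_funP filtF); apply: measurable_funS; first exact: measurable_Dom0.
by rewrite Dom0U; exact: subsetUr.
Qed.

Lemma pred_measurable_section Z w : pred_fun F Z -> measurable_fun pos0 (Z w : mR -> R).
Proof.
move=> /pred_fun_pos mZ _ B mB; have mS := mZ measurable_Dpos B mB.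
rewrite (_ : _ `&` _ = [set s | ((Dpos : set PT) `&` (fun p => Z p.1 p.2) @^-1` B) (w, s)]).
  exact: measurable_xsec.
by apply/seteqP; split => s /=; rewrite /Dpos/=; [move=> []|move=> [[]]].
Qed.

(* For s > 0: the k such that s lies in the grid cell ]k / (n + 1), (k + 1) / (n + 1)]. *)
Definition gidx (n : nat) (s : R) : nat := `|Num.ceil (s * n.+1%:R)|%N.-1.

Lemma gidxP n s : 0 < s -> (gidx n s)%:R / n.+1%:R < s <= (gidx n s).+1%:R / n.+1%:R.
Proof.
move=> s0; have sn0 : 0 < s * n.+1%:R by rewrite mulr_gt0.
have := ceil_itv (s * n.+1%:R); rewrite ltr_pdivrMr// ler_pdivlMr// /gidx.
have : (0 < Num.ceil (s * n.+1%:R))%R by rewrite ceil_gt0.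
case: (Num.ceil (s * n.+1%:R)) => // -[//|k] _.
by rewrite -{1}addn1 PoszD addrK.
Qed.

Lemma gidx_unique n s k : k%:R / n.+1%:R < s <= k.+1%:R / n.+1%:R -> gidx n s = k.
Proof.
rewrite ltr_pdivrMr// ler_pdivlMr// => /andP[h1 h2].
rewrite /gidx (_ : Num.ceil _ = k.+1%:Z)//.
by apply: ceil_def; rewrite -{1}addn1 PoszD addrK h1 h2.
Qed.

(** On each grid cell the process is a single random variable known at the left end of the cell, so
    its level sets are countable unions of predictable rectangles. *)
Lemma measurable_grid n (W : nat -> Omega -> R) :
  (forall k (B : set R), measurable B -> F (k%:R / n.+1%:R) (W k @^-1` B)) ->
  @measurable_fun _ _ PT R Dpos (fun p => W (gidx n p.2) p.1).
Proof.
move=> mW.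
have -> : Dpos = \bigcup_(k : nat) (setT `*` `](k%:R / n.+1%:R), (k.+1%:R / n.+1%:R)]%classic)
    :> set (Omega * R).
  apply/seteqP; split => [p /DposE s0|p [k _ [_ /=]]]; last first.
    by rewrite in_itv/= => /andP[ks _]; apply/DposE/(le_lt_trans _ ks).
  by exists (gidx n p.2) => //; split=> //=; rewrite in_itv/= gidxP.
apply/measurable_fun_bigcup => [k|k].
  apply: pred_oc; first by rewrite divr_ge0.
  by apply: FsetT => //; rewrite divr_ge0.
move=> _ B mB; rewrite (_ : _ `&` _ = (W k @^-1` B) `*`
    `](k%:R / n.+1%:R), (k.+1%:R / n.+1%:R)]%classic).
  by apply: pred_oc; rewrite ?divr_ge0//; exact: mW.
by apply/seteqP; split => -[w s]/=; [move=> [[_ sI]]|move=> [h sI]];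
  move: (sI); rewrite in_itv => /gidx_unique ->.
Qed.

(** The values of [Z] at the left end of the cell containing [s] are taken strictly before [s] and
    tend to the left limit as the mesh goes to 0. *)
Lemma measurable_left_limit Z : adapted F Z -> forall V : Omega -> R -> R,
  (forall w s, 0 < s -> Z w x @[x --> at_left s] --> V w s) ->
  @measurable_fun _ _ PT R Dpos (fun p => V p.1 p.2).
Proof.
move=> aZ V ZV.
apply: (@measurable_fun_cvg _ PT R Dpos
    (fun n p => Z p.1 ((gidx n p.2)%:R / n.+1%:R))) => [n|[w s] /DposE/= s0].
  apply: (@measurable_grid n (fun k w => Z w (k%:R / n.+1%:R))) => k B mB.
  by apply: aZ => //; rewrite divr_ge0.
have /cvg_left_epsP h := ZV w s s0; apply/cvgrPdist_lt => e e0.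
have [del del0 hd] := h e e0; near=> n.
have /andP[h1 h2] := gidxP n s0.
apply: hd => //; rewrite ltrBlDr; apply: le_lt_trans h2 _.
rewrite -natr1 mulrDl ltrD2l mul1r.
by near: n; exact: near_infty_natSinv_lt (PosNum del0).
Unshelve. all: by end_near. Qed.

Lemma adapted_lm Z : (forall w, cadlag (Z w)) -> adapted F Z ->
  pred_fun F (fun w s => lm (Z w) s).
Proof.
move=> cZ aZ; apply/(pred_funP filtF); rewrite Dom0U.
apply/measurable_funU; [exact: measurable_Dzero|exact: measurable_Dpos|split].
  move=> _ B mB; rewrite (_ : _ `&` _ = (Z ^~ 0 @^-1` B) `*` [set 0]).
    by apply: pred_0; exact: aZ.
  apply/seteqP; split => -[w s]/=; first by move=> [[_ /= ->]]; rewrite /lm ltxx.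
  by move=> [? ->]; rewrite /lm ltxx.
by apply: (@measurable_left_limit Z aZ (fun w s => lm (Z w) s)) => w s s0; exact: cadlag_lm.
Qed.

(** A violation [Z u < c] persists shortly after [u] by right-continuity, hence also occurs at a
    rational time [q] before [s]; from [q] on it is the predictable set [E q]. *)
Lemma pred_lower Z c : (forall w, cadlag (Z w)) -> adapted F Z ->
  measurable ([set p | 0 < p.2 /\ forall u, 0 <= u -> u < p.2 -> c <= Z p.1 u] : set PT).
Proof.
move=> cZ aZ.
pose E (q : rat) := [set w | 0 <= (ratr q : R) /\ Z w (ratr q) < c] `*` `](ratr q : R), +oo[%classic.
rewrite (_ : [set p | _] = Dpos `\` \bigcup_q E q).
  apply: measurableD; first exact: measurable_Dpos.
  apply: bigcupT_measurable_rat => q.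
  have [q0|q0] := leP (0 : R) (ratr q).
    apply: pred_oo => //; rewrite (_ : [set w | _] = Z ^~ (ratr q) @^-1` `]-oo, c[).
      exact: aZ.
    by apply/seteqP; split => w /=; rewrite in_itv/= => // -[].
  rewrite (_ : E q = set0); first exact: measurable0.
  by rewrite -subset0 => -[w s] [[/=]]; rewrite leNgt q0.
apply/seteqP; split => -[w s]/=; rewrite /Dpos /pos0/= in_itv/= andbT.
  move=> [s0 h]; split=> // -[q _]; rewrite /E/= in_itv/= andbT => -[[q0 Zq] qs].
  by have := h _ q0 qs; rewrite leNgt Zq.
move=> [[_ s0] h]; split=> // u u0 us; rewrite leNgt; apply/negP => Zu.
have cu : 0 < c - Z w u by rewrite subr_gt0.
have /cvg_right_epsP/(_ _ cu)[del del0 hd] := (cZ w).1 u u0.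
have um : u < Num.min s (u + del) by rewrite lt_min us ltrDl.
have [q] := rat_in_itvoo um; rewrite in_itv/= lt_min => /and3P[uq qs qd].
apply: h; exists q => //; rewrite /E; split=> /=; last by rewrite in_itv/= qs.
split; first exact: le_trans (ltW uq).
have := hd _ uq qd; rewrite ltr_distlC => /andP[_].
by rewrite addrC subrK.
Qed.

Lemma aliveP (y : R -> R) (s : R) : (forall u, 0 <= u -> 0 <= y u) -> 0 < s ->
  alive y s <-> exists2 e, 0 < e & forall u, 0 <= u -> u < s -> e <= y u.
Proof.
move=> y0 s0; rewrite /alive.
have lb0 : lbound [set y u | u in `[0, s[] 0.
  by move=> _ [u /= +  <-]; rewrite in_itv/= => /andP[/y0].
have ne : [set y u | u in `[0, s[] !=set0.
  by exists (y 0), 0 => //=; rewrite in_itv/= lexx s0.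
split=> [h|[e e0 h]].
  exists (inf [set y u | u in `[0, s[]) => // u u0 us.
  by apply: ge_inf; [exists 0|exists u => //=; rewrite in_itv/= u0 us].
apply: lt_le_trans e0 _; apply: lb_le_inf => // _ [u /= + <-].
by rewrite in_itv/= => /andP[u0 us]; exact: h.
Qed.

Lemma alive0 (y : R -> R) s : s <= 0 -> alive y s = false.
Proof.
move=> s0; rewrite /alive (_ : [set _ | _ in _] = set0) ?inf0 ?ltxx//.
by rewrite -subset0 => _ [u /= + _]; rewrite in_itv/= => /andP[/le_lt_trans h /h]; rewrite ltNge s0.
Qed.

Lemma pred_alive Z : (forall w, cadlag (Z w)) -> adapted F Z ->
  (forall w u, 0 <= u -> 0 <= Z w u) ->
  measurable ([set p | alive (Z p.1) p.2] : set PT).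
Proof.
move=> cZ aZ Z0; rewrite (_ : [set p | _] = \bigcup_(n : nat)
   [set p | 0 < p.2 /\ forall u, 0 <= u -> u < p.2 -> n.+1%:R^-1 <= Z p.1 u]).
  by apply: bigcupT_measurable => n; exact: pred_lower.
apply/seteqP; split => -[w s]/=.
  have [s0|s0] := leP s 0; first by rewrite alive0.
  move=> /(aliveP (Z0 w) s0)[e e0 h].
  have [n hn] := ltr_add_invr e0; exists n => //=; split=> // u u0 us.
  by rewrite (le_trans _ (h u u0 us))// ltW// -[_^-1]add0r.
move=> [n _ /= [s0 h]]; apply/(aliveP (Z0 w) s0).
by exists (n.+1%:R^-1) => //; rewrite invr_gt0.
Qed.

End PredictableProcesses.

Section AdaptedIntegral.
Context {R : realType} {d : measure_display} {Omega : measurableType d}.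
Variable F : R -> set (set Omega).
Hypothesis filtF : filtration F.
Local Notation mR := (measurableTypeR R).
Local Notation PT := (g_sigma_algebraType (pred_gen F)).
Local Notation FT t := (g_sigma_algebraType (F t)).

Lemma adapted_Rintegral (A Z : Omega -> R -> R) :
  (forall w, nondec (A w)) -> (forall w, cadlag (A w)) -> adapted F A ->
  @measurable_fun _ _ PT R Dpos (fun p => Z p.1 p.2) ->
  (forall w, locint (LSm (A w)) (Z w)) ->
  adapted F (fun w t => \int[LSm (A w)]_(s in oc0 t) Z w s).
Proof.
move=> ndA cA aA mZ iZ; apply/(adaptedP filtF) => t t0.
pose g : PT -> R := (fun p => Z p.1 p.2) \_ Dpos.
have mg : measurable_fun setT g.
  by apply/(measurable_restrictT _ (measurable_Dpos filtF)).
have gE w s : oc0 t s -> g (w, s) = Z w s.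
  move=> /oc0_pos0; rewrite /pos0/= in_itv/= andbT => s0.
  by rewrite /g patchE mem_set//; exact/DposE.
pose gp : PT -> R := fun p => Num.max (g p) 0.
pose gm : PT -> R := fun p => Num.max (- g p) 0.
have mgp : measurable_fun setT gp.
  by apply: measurable_maxr => //; exact: measurable_cst.
have mgm : measurable_fun setT gm.
  by apply: measurable_maxr; [exact: measurableT_comp|exact: measurable_cst].
have ig w : (LSm (A w)).-integrable (oc0 t) (EFin \o (fun s => g (w, s))).
  by apply: eq_integrable (iZ w t) => // s /set_mem/(gE w) /= ->.
have igp w : (LSm (A w)).-integrable (oc0 t) (EFin \o (fun s => gp (w, s))).
  apply: le_integrable (ig w) => //.
    apply/measurable_EFinP; apply: measurable_funTS.
    exact: measurableT_comp mgp (measurable_section w).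
  move=> s _; change (`|gp (w, s)|%:E <= `|g (w, s)|%:E)%E; rewrite lee_fin /gp.
  by rewrite ger0_norm ?le_max ?lexx ?orbT// ge_max ler_norm normr_ge0.
have igm w : (LSm (A w)).-integrable (oc0 t) (EFin \o (fun s => gm (w, s))).
  apply: le_integrable (ig w) => //.
    apply/measurable_EFinP; apply: measurable_funTS.
    exact: measurableT_comp mgm (measurable_section w).
  move=> s _; change (`|gm (w, s)|%:E <= `|g (w, s)|%:E)%E; rewrite lee_fin /gm.
  by rewrite ger0_norm ?le_max ?lexx ?orbT// ge_max normr_ge0 -normrN ler_norm.
have IE w : \int[LSm (A w)]_(s in oc0 t) Z w s =
  fine (\int[LSm (A w)]_(s in oc0 t) (gp (w, s))%:E)%E -
  fine (\int[LSm (A w)]_(s in oc0 t) (gm (w, s))%:E)%E.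
  rewrite -[RHS](RintegralB (measurable_oc0 t) (igp w) (igm w)).
  apply: eq_Rintegral => s /set_mem/(gE w) <-.
  rewrite /gp /gm; case: (leP 0 (g (w, s))) => g0.
    by rewrite max_r ?subr0// oppr_le0.
  by rewrite max_l ?oppr_ge0 ?ltW// add0r opprK.
apply: (@eq_measurable_fun _ _ (FT t) R setT (fun w =>
  fine (\int[LSm (A w)]_(s in oc0 t) (gp (w, s))%:E)%E -
  fine (\int[LSm (A w)]_(s in oc0 t) (gm (w, s))%:E)%E)).
  by move=> w _; rewrite IE.
have mfin (f : PT -> R) : measurable_fun setT f -> (forall p, 0 <= f p) ->
    @measurable_fun _ _ (FT t) R setT (fun w => fine (\int[LSm (A w)]_(s in oc0 t) (f (w, s))%:E)%E).
  move=> mf f0; apply: (@measurableT_comp _ _ _ (FT t) (\bar R) R fine).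
    exact: fine_measurable.
  apply: (@measurable_LSm_integral _ _ _ F filtF A ndA cA aA t (EFin \o f)) => //.
    exact/measurable_EFinP.
by apply: measurable_funB; apply: mfin => // p; rewrite le_max lexx orbT.
Qed.

End AdaptedIntegral.

(** * Adapted sums of jumps *)

Section Atoms.
Context {R : realType}.
Local Notation mR := (measurableTypeR R).
Variable f : R -> R.
Hypotheses (ndf : nondec f) (cf : cadlag f).

Lemma finite_atoms t c : 0 < c -> finite_set [set s | oc0 t s /\ c <= jump f s].
Proof.
move=> c0; apply: contrapT => infS.
have LSfin := LSm_oc0_fin ndf cf t.
have := LSfin; rewrite -ge0_fin_numE// => /fineK LSE.
have [B BS Bn] := infinite_set_fset (Num.bound (fine (LSm f (oc0 t)) / c)).+1 infS.
have : (LSm f [set` B] <= LSm f (oc0 t))%E.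
  have finB : finite_set [set` B] by exact: finite_fset.
  rewrite le_measure ?inE//.
    rewrite -(image_id [set` B]) -bigcup_imset1.
    by apply: fin_bigcup_measurable => // s _; exact: measurable_set1.
  by move=> s /BS[].
rewrite LSm_finite_set//; last by move=> s /BS[/oc0_pos0].
rewrite fsbig_finite//= set_fsetK sumEFin -LSE lee_fin leNgt => /negP; apply.
apply: (@lt_le_trans _ _ (\sum_(s <- B) c)); last first.
  by rewrite !big_seq; apply: ler_sum => s sB; have [] := BS s sB.
rewrite big_const_seq count_predT iter_addr addr0 -mulr_natr mulrC -ltr_pdivrMr//.
apply: lt_le_trans (_ : (Num.bound (fine (LSm f (oc0 t)) / c))%:R <= _).
  by apply: archi_boundP; rewrite divr_ge0 ?fine_ge0// ltW.
by rewrite ler_nat ltnW.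
Qed.

(** Writes the sum of the jumps as the mass of one random set, so that the measurability of
    Stieltjes masses applies to it. The jump times are exhausted by the finite sets of jumps of size
    at least [1/(n+1)]. *)
Lemma jsum_atoms t :
  jsum (jump f) t = fine (LSm f ([set s | 0 < jump f s] `&` oc0 t)).
Proof.
congr fine; pose S n := [set s | oc0 t s /\ n.+1%:R^-1 <= jump f s].
have fS n : finite_set (S n) by apply: finite_atoms; rewrite invr_gt0.
have mS n : measurable (S n : set mR).
  rewrite -(image_id (S n)) -bigcup_imset1.
  by apply: fin_bigcup_measurable => // s _; exact: measurable_set1.
have SE : [set s | 0 < jump f s] `&` oc0 t = \bigcup_n S n.
  apply/seteqP; split => s /=.
    move=> [fs st]; have [n hn] := ltr_add_invr fs; exists n => //; split=> //.
    by rewrite -[_^-1]add0r ltW.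
  by move=> [n _ [st h]]; split=> //; apply: lt_le_trans h; rewrite invr_gt0.
have mU : measurable (\bigcup_n S n : set mR) by exact: bigcupT_measurable.
have SU : \bigcup_n S n `<=` pos0 by rewrite -SE => s [_ /oc0_pos0].
apply/eqP; rewrite eq_le; apply/andP; split.
  rewrite SE; apply: le_trans (esum_jump_le ndf cf mU SU).
  rewrite -SE esum_mkcond [leRHS]esum_mkcond; apply: le_esum => s _.
  have [st|] := boolP (s \in `]0, t]%classic); last first.
    by case: ifP => // _; rewrite lee_fin jump_ge0T.
  case: ifPn => // h; rewrite lee_fin leNgt; apply: contra h => fs.
  by apply/mem_set; split=> //; exact: set_mem.
have ndS : {homo S : m n / (m <= n)%N >-> (m <= n)%O}.
  move=> m n mn; apply/subsetPset => s [st h]; split=> //.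
  by apply: le_trans h; rewrite lef_pV2 ?posrE// ler_nat.
have := nondecreasing_cvg_mu (mu := LSm f) mS mU ndS; rewrite -SE => /cvg_lim <- //.
apply: lime_le.
  by apply/cvg_ex; exists (LSm f (\bigcup_n S n)); exact: nondecreasing_cvg_mu.
near=> n; rewrite /= LSm_finite_set//; last by move=> s [/oc0_pos0].
rewrite -esum_fset//; last by move=> s _; rewrite lee_fin jump_ge0T.
rewrite esum_mkcond [leRHS]esum_mkcond; apply: le_esum => s _.
case: ifPn => [/set_mem[st _]|_]; first by rewrite mem_set.
by case: ifP => // _; rewrite lee_fin jump_ge0T.
Unshelve. all: by end_near. Qed.

End Atoms.

Section JumpAdapted.
Context {R : realType} {d : measure_display} {Omega : measurableType d}.
Variable G : set (set Omega).
Hypothesis sG : sigma_algebra setT G.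
Let F := fun _ : R => G.

Lemma const_filtration : filtration F.
Proof. by split. Qed.

Variable X : Omega -> R -> R.
Hypotheses (ndX : forall w, nondec (X w)) (cX : forall w, cadlag (X w)) (aX : adapted F X).

Local Notation PT := (g_sigma_algebraType (pred_gen F)).

(* With a constant filtration no information has to be delayed, so that every adapted cadlag
   process is predictable. *)
Lemma measurable_jump_const : @measurable_fun _ _ PT R Dpos (fun p => jump (X p.1) p.2).
Proof.
have filtF := const_filtration.
have mX : @measurable_fun _ _ PT R Dpos (fun p => X p.1 p.2).
  apply: (@measurable_fun_cvg _ PT R Dpos
      (fun n p => X p.1 ((gidx n p.2).+1%:R / n.+1%:R))) => [n|[w s] /DposE/= s0].
    apply: (@measurable_grid _ _ _ F filtF n (fun k w => X w (k.+1%:R / n.+1%:R))) => k B mB.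
    by apply: (aX (t := k.+1%:R / n.+1%:R)); rewrite // divr_ge0.
  have /cvg_right_epsP h := (cX w).1 s (ltW s0); apply/cvgrPdist_lt => e e0.
  have [del del0 hd] := h e e0; near=> n.
  have /andP[h1 h2] := gidxP n s0.
  have [es|ne] := eqVneq s ((gidx n s).+1%:R / n.+1%:R); first by rewrite -es subrr normr0.
  apply: hd => //; first by rewrite lt_neqAle ne.
  rewrite -natr1 mulrDl mul1r; apply: ltrD => //.
  by near: n; exact: near_infty_natSinv_lt (PosNum del0).
apply: measurable_funB => //.
exact: (pred_fun_pos filtF (adapted_lm filtF cX aX)).
Unshelve. all: by end_near. Qed.

Lemma jsum_const_adapted t : 0 <= t -> forall B : set R, measurable B ->
  G ((fun w => jsum (jump (X w)) t) @^-1` B).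
Proof.
have filtF := const_filtration; have mj := measurable_jump_const.
move=> t0; suff h : adapted F (fun w t => jsum (jump (X w)) t) by move=> B mB; exact: h.
apply/(adaptedP filtF) => u u0.
pose D : set PT := Dpos `&` (fun p => jump (X p.1) p.2) @^-1` `]0, +oo[.
have mD : measurable D by apply: mj => //; exact: measurable_Dpos.
apply: (@eq_measurable_fun _ _ (g_sigma_algebraType (F u)) R setT
  (fun w => fine (LSm (X w) ([set s | D (w, s)] `&` oc0 u)))).
  move=> w _; rewrite jsum_atoms//; congr (fine (LSm _ _)).
  apply/seteqP; split => s [/= h su]; split=> //=.
    by case: h => _; rewrite /= in_itv/= andbT.
  split; last by rewrite /= in_itv/= h.
  by apply/DposE; have := oc0_pos0 su; rewrite /pos0/= in_itv/= andbT.
apply: (@measurableT_comp _ _ _ (g_sigma_algebraType (F u)) (\bar R) R fine).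
  exact: fine_measurable.
exact: measurable_LSm_section.
Qed.

End JumpAdapted.

Section ContinuousPart.
Context {R : realType} {d : measure_display} {Omega : measurableType d}.
Variable F : R -> set (set Omega).
Hypothesis filtF : filtration F.
Variable X : Omega -> R -> R.
Hypotheses (ndX : forall w, nondec (X w)) (cX : forall w, cadlag (X w)) (aX : adapted F X).

(** For a fixed [t], stop the path at [t]: the stopped process is adapted to the constant filtration
    [F t] and has the same jumps up to [t], so the case of a constant filtration applies. *)
Lemma adapted_jsum : adapted F (fun w t => jsum (jump (X w)) t).
Proof.
move=> t t0 B mB; pose Xt w s := X w (Num.min s t).
have ndXt w : nondec (Xt w).
  move=> s u s0 su; apply: ndX; first by rewrite le_min s0.
  by rewrite le_min !ge_min su lexx orbT.
have Xlt w s : s < t -> Xt w s = X w s by move=> /ltW st; rewrite /Xt min_l.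
have Xge w s : t <= s -> Xt w s = X w t by move=> st; rewrite /Xt min_r.
have Xle w s : s <= t -> Xt w s = X w s by move=> st; rewrite /Xt min_l.
have lmX w s : 0 < s -> s <= t -> Xt w x @[x --> at_left s] --> lm (X w) s.
  move=> s0 st; have := cadlag_lm (cX w) s0; apply: cvg_trans; apply: near_eq_cvg.
  near=> x; rewrite Xle//; apply: le_trans st; near: x; exact: nbhs_left_le.
have cXt w : cadlag (Xt w).
  split=> s s0.
    have [st|ts] := ltP s t.
      rewrite Xlt//; have := (cX w).1 s s0; apply: cvg_trans; apply: near_eq_cvg.
      near=> x; rewrite Xlt//; near: x; exact: nbhs_right_lt.
    rewrite Xge//; apply: cvg_near_cst; near=> x; rewrite Xge//.
    apply: (le_trans ts); near: x; exact: nbhs_right_ge.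
  have [st|ts] := leP s t; first by apply/cvg_ex; exists (lm (X w) s); exact: lmX.
  apply/cvg_ex; exists (X w t); apply: cvg_near_cst; near=> x; rewrite Xge//.
  near: x; exact: nbhs_left_ge.
rewrite (_ : _ @^-1` B = (fun w => jsum (jump (Xt w)) t) @^-1` B).
  apply: (jsum_const_adapted (filtF.1 t t0)) => // s s0 C mC.
  have [st|ts] := leP s t.
    rewrite (_ : _ @^-1` C = X ^~ s @^-1` C); last by apply/funext => w /=; rewrite Xle.
    by apply: (filtF.2 s) => //; exact: aX.
  rewrite (_ : _ @^-1` C = X ^~ t @^-1` C); first exact: aX.
  by apply/funext => w /=; rewrite Xge// ltW.
apply/funext => w /=; congr B; congr fine; apply: eq_esum => s /=.
rewrite in_itv/= => /andP[s0 st]; rewrite /jump Xle//.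
by rewrite (lm_unique s0 (lmX w s s0 st)).
Unshelve. all: by end_near. Qed.

Lemma adapted_cpart : adapted F (fun w t => cpart (X w) t).
Proof.
apply/(adaptedP filtF) => t t0; apply: measurable_funB.
  by have /(adaptedP filtF) := aX; exact.
by have /(adaptedP filtF) := adapted_jsum; exact.
Qed.

Lemma pred_cpart : pred_fun F (fun w t => cpart (X w) t).
Proof.
(* The continuous part is its own left limit, and left limits of adapted processes are
   predictable. *)
suff -> : (fun w t => cpart (X w) t) = (fun w t => lm (cpart (X w)) t).
  by apply: (adapted_lm filtF) adapted_cpart => w; exact: cpart_cadlag.
apply/funext => w; apply/funext => s; have [s0|] := ltP 0 s.
  by rewrite cpart_lm.
by rewrite /lm leNgt => /negbTE ->.
Qed.

End ContinuousPart.

(** * Pathwise integral equations *)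

Section Cadlag.
Context {R : realType}.
Local Notation mR := (measurableTypeR R).
Implicit Types f g : R -> R.

Lemma cadlagD f g : cadlag f -> cadlag g -> cadlag (fun t => f t + g t).
Proof.
move=> cf cg; split=> [t t0|t t0]; first by apply: cvgD; [exact: cf.1|exact: cg.1].
by apply: is_cvgD; [exact: cf.2|exact: cg.2].
Qed.

Lemma cadlagB f g : cadlag f -> cadlag g -> cadlag (fun t => f t - g t).
Proof.
move=> cf cg; split=> [t t0|t t0]; first by apply: cvgB; [exact: cf.1|exact: cg.1].
by apply: is_cvgB; [exact: cf.2|exact: cg.2].
Qed.

Lemma cadlag_cst (a : R) : cadlag (fun=> a).
Proof. by split=> t t0; [exact: cvg_cst|exact: is_cvg_cst]. Qed.

Lemma cadlagZ a f : cadlag f -> cadlag (fun t => a * f t).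
Proof.
move=> cf; split=> [t t0|t t0]; first by apply: cvgMr; exact: cf.1.
by apply: is_cvgMr; exact: cf.2.
Qed.

Lemma cadlag_sum (I : finType) (f : I -> R -> R) :
  (forall i, cadlag (f i)) -> cadlag (fun t => \sum_i f i t).
Proof.
move=> cf; elim: (index_enum I) => [|i s ih].
  by under eq_fun do rewrite big_nil; exact: cadlag_cst.
by under eq_fun do rewrite big_cons; exact: cadlagD.
Qed.

Lemma lm_sum (I : finType) (f : I -> R -> R) t : 0 < t ->
  (forall i, cadlag (f i)) -> lm (fun t => \sum_i f i t) t = \sum_i lm (f i) t.
Proof.
move=> t0 cf; elim: (index_enum I) => [|i s ih].
  under eq_fun do rewrite big_nil; rewrite big_nil; apply: lm_unique => //.
  exact: cvg_cst.
under eq_fun do rewrite big_cons; rewrite big_cons lmD//; first by rewrite ih.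
elim: s {ih} => [|j s ih]; first by under eq_fun do rewrite big_nil; exact: cadlag_cst.
by under eq_fun do rewrite big_cons; exact: cadlagD.
Qed.

Lemma lmZ a f t : 0 < t -> cadlag f -> lm (fun t => a * f t) t = a * lm f t.
Proof. by move=> t0 cf; apply: lm_unique => //; apply: cvgMr; exact: cadlag_lm. Qed.

Lemma left_point (t b del : R) : b < t -> 0 < del ->
  exists s, [/\ b <= s, t - del < s & s < t].
Proof.
move=> bt del0; have : Num.max b (t - del) < t by rewrite gt_max bt gtrBl.
move=> /midf_lt[h1 h2]; exists ((Num.max b (t - del) + t) / 2); split=> //.
  by apply: le_trans (ltW h1); rewrite le_max lexx.
by apply: le_lt_trans h1; rewrite le_max lexx orbT.
Qed.

Lemma le_lm_cst f t (a b : R) : cadlag f -> b < t -> 0 <= b ->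
  (forall u, b <= u -> u < t -> f u <= a) -> lm f t <= a.
Proof.
move=> cf bt b0 h; have t0 : 0 < t by exact: le_lt_trans bt.
rewrite leNgt; apply/negP; rewrite -subr_gt0 => e0.
have /cvg_left_epsP/(_ _ e0)[del del0 hd] := cadlag_lm cf t0.
have [s [bs ds st]] := left_point bt del0.
have := hd s ds st; rewrite ltr_distlC => /andP[+ _].
by rewrite opprB addrC subrK ltNge h.
Qed.

Lemma ge_lm_cst f t (a b : R) : cadlag f -> b < t -> 0 <= b ->
  (forall u, b <= u -> u < t -> a <= f u) -> a <= lm f t.
Proof.
move=> cf bt b0 h; have t0 : 0 < t by exact: le_lt_trans bt.
rewrite leNgt; apply/negP; rewrite -subr_gt0 => e0.
have /cvg_left_epsP/(_ _ e0)[del del0 hd] := cadlag_lm cf t0.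
have [s [bs ds st]] := left_point bt del0.
have := hd s ds st; rewrite ltr_distlC => /andP[_].
by rewrite addrC subrK ltNge h.
Qed.

Lemma eq_lm f g t : cadlag f -> 0 < t -> (forall u, 0 <= u -> u < t -> f u = g u) ->
  lm g t = lm f t.
Proof.
move=> cf t0 fg; apply: lm_unique => //; have := cadlag_lm cf t0.
apply: cvg_trans; apply: near_eq_cvg; near=> u.
by apply: fg; near: u; [exact: nbhs_left_ge|exact: nbhs_left_lt].
Unshelve. all: by end_near. Qed.

(** By induction along the half-line: just before [t] the path is within 1 of its left limit, just
    after [t] within 1 of its value. *)
Lemma cadlag_bounded f : cadlag f -> forall t, 0 <= t ->
  exists2 B, 0 <= B & forall u, 0 <= u -> u <= t -> `|f u| <= B.
Proof.
move=> cf; apply: real_ind => t.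
  rewrite le_eqVlt => /orP[/eqP <- _|t0 ih].
    exists `|f 0| => // u u0 u0'; suff -> : u = 0 by [].
    by apply/eqP; rewrite eq_le u0 u0'.
  have /cvg_left_epsP/(_ _ ltr01)[del del0 hd] := cadlag_lm cf t0.
  have [s [s0 sd st]] := left_point t0 del0.
  have [B B0 hB] := ih s s0 st.
  exists (B + (`|lm f t| + 1) + `|f t|).
    by rewrite !addr_ge0.
  move=> u u0; rewrite le_eqVlt => /orP[/eqP ->|ut].
    by rewrite lerDr !addr_ge0.
  have [us|su] := leP u s.
    by apply: (le_trans (hB _ u0 us)); rewrite -addrA lerDl !addr_ge0.
  have : `|f u| <= `|lm f t| + 1.
    rewrite -[f u](subKr (lm f t)) (le_trans (ler_normB _ _))// lerD2l.
    by apply/ltW/hd => //; exact: lt_trans su.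
  by move=> h; apply: (le_trans h); rewrite -addrA addrCA lerDl addr_ge0.
move=> t0 /(_ t t0 (lexx _))[B B0 hB].
have /cvg_right_epsP/(_ _ ltr01)[del del0 hd] := cf.1 t t0.
exists (del / 2) => [|v tv vd]; first by rewrite divr_gt0.
exists (B + (`|f t| + 1)); first by rewrite !addr_ge0.
move=> u u0 uv; have [ut|tu] := leP u t.
  by apply: (le_trans (hB _ u0 ut)); rewrite lerDl addr_ge0.
have : `|f u| <= `|f t| + 1.
  rewrite -[f u](subKr (f t)) (le_trans (ler_normB _ _))// lerD2l.
  apply/ltW/hd => //; apply: (le_lt_trans uv); apply: (le_lt_trans vd).
  by rewrite ltrD2l; lra.
by move=> h; apply: (le_trans h); rewrite lerDr.
Qed.

Lemma cadlag_lm_bounded f t B : cadlag f -> 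
  (forall u, 0 <= u -> u <= t -> `|f u| <= B) -> forall s, 0 < s -> s <= t -> `|lm f s| <= B.
Proof.
move=> cf hB s s0 st; rewrite ler_norml; apply/andP; split.
  apply: (ge_lm_cst cf s0 (lexx 0)) => u u0 us.
  by have := hB u u0 (le_trans (ltW us) st); rewrite ler_norml => /andP[].
apply: (le_lm_cst cf s0 (lexx 0)) => u u0 us.
by have := hB u u0 (le_trans (ltW us) st); rewrite ler_norml => /andP[].
Qed.

(** The path is regarded as a process that does not depend on the sample point, adapted to the
    filtration of all subsets; the sample point 0 is arbitrary. *)
Lemma measurable_lm f : cadlag f -> measurable_fun pos0 (lm f : mR -> R).
Proof.
move=> cf; pose F := fun _ : R => [set: set mR].
have filtF : filtration F by split=> // t t0; split.
have := @adapted_lm _ _ _ F filtF (fun _ => f) (fun=> cf).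
by move=> /(_ (fun _ _ _ _ => I)) h; exact: (pred_measurable_section filtF (0 : mR) h).
Qed.

End Cadlag.

(** * Integrals against finitely many drivers and the exponential weight *)

Section StieltjesSum.
Context {R : realType} {C : finType}.
Local Notation mR := (measurableTypeR R).
Variable A : C -> R -> R.
Hypotheses (ndA : forall c, nondec (A c)) (cA : forall c, cadlag (A c)).
Implicit Types h g : C -> mR -> R.

Definition sint h : Prop := forall c, locint (LSm (A c)) (h c).
Definition SI h (t : R) : R := \sum_c \int[LSm (A c)]_(s in oc0 t) h c s.

Let muf c := LSm_oc0_fin (ndA c) (cA c).

Let cint h c : sint h -> cadlag (fun t => \int[LSm (A c)]_(s in oc0 t) h c s).
Proof. by move=> ih; have [] := locint_cadlag (ih c). Qed.

Let lint h c t : sint h -> 0 < t -> lm (fun t => \int[LSm (A c)]_(s in oc0 t) h c s) t =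
  \int[LSm (A c)]_(s in `]0, t[%classic) h c s.
Proof. by move=> ih; have [_] := locint_cadlag (ih c); exact. Qed.

Lemma SI_cadlag h : sint h -> cadlag (SI h).
Proof. by move=> ih; apply: cadlag_sum => c; exact: cint. Qed.

Lemma SI0 h : SI h 0 = 0.
Proof. by rewrite /SI big1// => c _; rewrite /oc0 set_itvoc0 Rintegral_set0. Qed.

Lemma SI_last h t : sint h -> 0 < t ->
  SI h t = lm (SI h) t + \sum_c h c t * jump (A c) t.
Proof.
move=> ih t0; rewrite /SI lm_sum//; last first.
  by move=> c; exact: cint.
rewrite -big_split/=; apply: eq_bigr => c _.
rewrite lint// Rintegral_oc0_last//.
by rewrite LSm_set1.
Qed.

Lemma eq_SI h g t : (forall c s, 0 < s -> s <= t -> h c s = g c s) -> SI h t = SI g t.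
Proof.
move=> hg; apply: eq_bigr => c _; apply: eq_Rintegral => s /set_mem.
by rewrite /oc0/= in_itv/= => /andP[]; exact: hg.
Qed.

Lemma SIB h g t : sint h -> sint g -> SI (fun c s => h c s - g c s) t = SI h t - SI g t.
Proof.
move=> ih ig; rewrite /SI -sumrB; apply: eq_bigr => c _.
by rewrite RintegralB//; [exact: ih|exact: ig].
Qed.

Lemma SID h g t : sint h -> sint g -> SI (fun c s => h c s + g c s) t = SI h t + SI g t.
Proof.
move=> ih ig; rewrite /SI -big_split/=; apply: eq_bigr => c _.
by rewrite RintegralD//; [exact: ih|exact: ig].
Qed.

Lemma SIZ a h t : sint h -> SI (fun c s => a * h c s) t = a * SI h t.
Proof.
move=> ih; rewrite /SI big_distrr/=; apply: eq_bigr => c _.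
by rewrite RintegralZl//; exact: ih.
Qed.

Lemma sintZ a h : sint h -> sint (fun c s => a * h c s).
Proof. by move=> ih c t; exact: (integrableZl (measurable_oc0 t) a (ih c t)). Qed.

Lemma sintB h g : sint h -> sint g -> sint (fun c s => h c s - g c s).
Proof. by move=> ih ig c; exact: locintB. Qed.

Lemma le_SI h g t : sint h -> sint g ->
  (forall c s, 0 < s -> s <= t -> h c s <= g c s) -> SI h t <= SI g t.
Proof.
move=> ih ig hg; apply: ler_sum => c _; apply: le_Rintegral => //; [exact: ih|exact: ig|].
by move=> s; rewrite /oc0/= in_itv/= => /andP[]; exact: hg.
Qed.

Lemma abs_SI_le h g t : sint h -> sint g ->
  (forall c s, 0 < s -> s <= t -> `|h c s| <= g c s) -> `|SI h t| <= SI g t.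
Proof.
move=> ih ig hg; rewrite ler_norml; apply/andP; split.
  rewrite -[- SI g t]mulN1r -SIZ//; apply: le_SI => //; first exact: sintZ.
  by move=> c s s0 st; rewrite mulN1r; have := hg c s s0 st; rewrite ler_norml => /andP[].
apply: le_SI => // c s s0 st.
by have := hg c s s0 st; rewrite ler_norml => /andP[].
Qed.

Definition totA t := \sum_c A c t.

Lemma totA_nondec : nondec totA.
Proof. by move=> s t s0 st; apply: ler_sum => c _; exact: ndA. Qed.

Lemma totA_cadlag : cadlag totA.
Proof. exact: cadlag_sum. Qed.

Lemma totA_lm t : 0 < t -> totA t - lm totA t = \sum_c jump (A c) t.
Proof. by move=> t0; rewrite /totA lm_sum// -sumrB. Qed.

Lemma abs_SIB_le h (s t b : R) : sint h -> 0 <= s -> s <= t ->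
  (forall c u, s < u -> u <= t -> `|h c u| <= b) ->
  `|SI h t - SI h s| <= b * (totA t - totA s).
Proof.
move=> ih s0 st hb; rewrite /SI /totA -!sumrB big_distrr/=.
apply: (le_trans (ler_norm_sum _ _ _)); apply: ler_sum => c _.
rewrite (Rintegral_oc0B (ih c))//.
have sub : `]s, t]%classic `<=` oc0 t.
  move=> u; rewrite /oc0/= !in_itv/= => /andP[su ->]; rewrite andbT.
  exact: le_lt_trans su.
have ih' : (LSm (A c)).-integrable `]s, t]%classic (EFin \o h c).
  exact: locint_sub (ih c) _ sub.
apply: (le_trans (le_normr_Rintegral _ ih')) => //.
have -> : A c t - A c s = fine (LSm (A c) `]s, t]%classic) by rewrite LSm_oc.
rewrite -Rintegral_cst//; apply: le_Rintegral => //.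
- exact: (integrable_abse ih').
- apply: (@measurable_bounded_integrable _ _ _ (LSm (A c)) (fun=> b : R)) => //.
    by rewrite LSm_oc// ltry.
  exists `|b|; split; first exact: num_real.
  by move=> x bx u _ /=; exact: ltW.
- by move=> u; rewrite /= in_itv/= => /andP[]; exact: hb.
Qed.

Lemma sint_cst (b : R) : sint (fun _ _ => b).
Proof.
by move=> c; apply: bounded_locint => [||t]; [exact: muf|exact: measurable_cst|exists `|b|].
Qed.

Lemma bounded_sint h : (forall c, measurable_fun pos0 (h c)) ->
  (forall t, 0 <= t -> exists K, forall c s, 0 < s -> s <= t -> `|h c s| <= K) -> sint h.
Proof.
move=> mh hb c; apply: bounded_locint => [||t]; [exact: muf|exact: mh|].
have [t0|t0] := leP 0 t; first by have [K hK] := hb t t0; exists K; exact: hK.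
by exists 0 => s s0 st; have := lt_trans (lt_le_trans s0 st) t0; rewrite ltxx.
Qed.

(* An exponential weight W = expR (4 V), V = K * totA, makes the integral operators with
   K-Lipschitz integrands contractions:  K * SI W_- <= W / 2. *)
Section Weight.
Variable K : R.
Hypothesis K0 : 0 <= K.
Definition wexp t := K * (totA t - totA 0).
Definition weight t := expR (4 * wexp t).
Definition weightl t := expR (4 * lm wexp t).

Lemma wexp_nondec : nondec wexp.
Proof. by move=> s t s0 st; rewrite ler_wpM2l// lerB//; exact: totA_nondec. Qed.

Lemma wexp_cadlag : cadlag wexp.
Proof. by apply/cadlagZ/cadlagB; [exact: totA_cadlag|exact: cadlag_cst]. Qed.

Lemma wexp_ge0 t : 0 <= t -> 0 <= wexp t.
Proof. by move=> t0; rewrite mulr_ge0// subr_ge0; exact: totA_nondec. Qed.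

Lemma wexp_lm t : 0 < t -> lm wexp t <= wexp t.
Proof.
move=> t0; apply: (le_lm_cst wexp_cadlag t0 (lexx 0)) => u u0 ut.
by apply: wexp_nondec; rewrite // ltW.
Qed.

Lemma weight_ge1 t : 0 <= t -> 1 <= weight t.
Proof. by move=> t0; rewrite -expR0 ler_expR mulr_ge0//; exact: wexp_ge0. Qed.

Lemma weight_le s t : 0 <= s -> s <= t -> weight s <= weight t.
Proof. by move=> s0 st; rewrite ler_expR ler_pM2l//; exact: wexp_nondec. Qed.

Lemma weight_lm t : 0 < t -> weight x @[x --> at_left t] --> weightl t.
Proof.
move=> t0; have := cadlag_lm wexp_cadlag t0 => h.
have {}h : 4 * wexp x @[x --> at_left t] --> 4 * lm wexp t by exact: cvgMr.
by apply: (cvg_comp _ _ h); exact: continuous_expR.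
Qed.

Lemma weightl_ge0 t : 0 <= weightl t. Proof. exact: expR_ge0. Qed.

Lemma weightl_le t : 0 < t -> weightl t <= weight t.
Proof. by move=> t0; rewrite ler_expR ler_pM2l// wexp_lm. Qed.

Lemma sint_weightl : sint (fun _ => weightl).
Proof.
apply: bounded_sint => [c|t t0].
  apply: measurableT_comp => //; apply: measurable_funM => //.
  exact: measurable_lm wexp_cadlag.
exists (weight t) => _ s s0 st; rewrite ger0_norm ?weightl_ge0//.
by apply: (le_trans (weightl_le s0)); apply: weight_le => //; exact: ltW.
Qed.

Let J t := K * SI (fun _ => weightl) t.

(** A change-of-variables inequality for [expR (4 wexp)], proved by induction along the half-line: a
    jump is handled exactly, a short interval to the right by small increments. *)
Lemma weight_integral t : 0 <= t -> K * SI (fun _ => weightl) t <= weight t / 2.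
Proof.
(* The sharper bound starts with equality at 0, as the induction requires. *)
move=> t0; suff : J t <= (weight t - 1) / 2 by rewrite /J; lra.
move: t t0; apply: real_ind => t.
  rewrite le_eqVlt => /orP[/eqP <- _|t0 ih].
    by rewrite /J SI0 mulr0 /weight /wexp subrr !mulr0 expR0 subrr mul0r.
  have lJ : K * lm (SI (fun _ => weightl)) t <= (weightl t - 1) / 2.
    rewrite -lmZ//; last exact: SI_cadlag sint_weightl.
    rewrite leNgt; apply/negP => lt.
    have cJ : cadlag J by apply/cadlagZ/SI_cadlag/sint_weightl.
    have : J x - (weight x - 1) / 2 @[x --> at_left t] --> lm J t - (weightl t - 1) / 2.
      apply: cvgB; first exact: cadlag_lm.
      by apply: cvgMl; apply: cvgB; [exact: weight_lm|exact: cvg_cst].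
    rewrite -subr_gt0 in lt.
    move=> /cvg_left_epsP/(_ _ lt)[del del0 hd].
    have [s [s0 ds st]] := left_point t0 del0.
    have := hd s ds st; rewrite ltr_distlC => /andP[+ _].
    by rewrite subrr subr_gt0 ltNge ih.
  rewrite /J SI_last//; last exact: sint_weightl.
  rewrite mulrDr -big_distrr/= -totA_lm//.
  have -> : totA t - lm totA t = (totA t - totA 0) - (lm totA t - totA 0) by ring.
  rewrite mulrCA mulrBr -/(wexp t).
  have -> : K * (lm totA t - totA 0) = lm wexp t.
    rewrite /wexp lmZ//; last by apply: cadlagB; [exact: totA_cadlag|exact: cadlag_cst].
    rewrite lmB//; [|exact: totA_cadlag|exact: cadlag_cst].
    by congr (_ * (_ - _)); apply/esym/lm_unique => //; exact: cvg_cst.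
  (* A jump [x] of [wexp] multiplies the weight by [expR (4 x) >= 1 + 4 x], while the factor
     [1 + 2 x] would suffice. *)
  have E : weight t = weightl t * expR (4 * (wexp t - lm wexp t)).
    by rewrite -expRD; congr expR; ring.
  have := expR_ge1Dx (4 * (wexp t - lm wexp t)).
  have := expR_gt0 (4 * lm wexp t); rewrite -/(weightl t) => w0 he.
  have : weightl t * (1 + 4 * (wexp t - lm wexp t)) <= weight t.
    by rewrite E ler_wpM2l// ltW.
  have : 0 <= weightl t * (wexp t - lm wexp t).
    by apply: mulr_ge0; [exact: ltW|rewrite subr_ge0; exact: wexp_lm].
  by lra.
move=> t0 /(_ t t0 (lexx _)) ih.
(* For [x <= 1/8] one has [expR (4 x) <= 2], hence [expR (4 x) * x <= 2 x <= (expR (4 x) - 1) / 2].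
   The integrand is bounded here by the weight at the right end, and this takes the full constant
   4. *)
have e0 : (0 : R) < 8%:R^-1 by rewrite invr_gt0.
have /cvg_right_epsP/(_ _ e0)[del del0 hd] := wexp_cadlag.1 t t0.
exists (del / 2) => [|u tu ud]; first by rewrite divr_gt0.
have u0 : 0 <= u by apply: (le_trans t0); exact: ltW.
have du : wexp u - wexp t <= 8%:R^-1.
  have ud' : u < t + del by apply: (le_lt_trans ud); lra.
  by have := hd u tu ud'; rewrite ltr_distlC => /andP[_ /ltW]; lra.
have := @abs_SIB_le (fun _ => weightl) t u (weight u) sint_weightl t0 (ltW tu).
have hb v : t < v -> v <= u -> `|weightl v| <= weight u.
  move=> tv vu; have v0 := le_lt_trans t0 tv.
  rewrite ger0_norm ?weightl_ge0//; apply: (le_trans (weightl_le v0)).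
  by apply: weight_le => //; exact: ltW.
move=> /(_ (fun _ => hb)) => h.
have {}h : J u - J t <= weight u * (wexp u - wexp t).
  rewrite /J -mulrBr; have := ler_wpM2l K0 (le_trans (ler_norm _) h).
  move=> /le_trans; apply; rewrite /wexp; lra.
have E : weight u = weight t * expR (4 * (wexp u - wexp t)).
  by rewrite -expRD; congr expR; ring.
set x := wexp u - wexp t in du h E.
have x0 : 0 <= x by rewrite subr_ge0; apply: wexp_nondec => //; exact: ltW.
have ge1 := expR_ge1Dx (4 * x).
have le2 : expR (4 * x) <= 2.
  have := expR_ge1Dx (- (4 * x)); rewrite expRN => h1.
  have p := expR_gt0 (4 * x).
  have : 2^-1 <= (expR (4 * x))^-1 by apply: le_trans h1; lra.
  by rewrite lef_pV2 ?posrE.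
have wt0 : 0 < weight t by exact: expR_gt0.
have : weight u * x <= (weight u - weight t) / 2.
  have h1 : weight t * (expR (4 * x) * x) <= weight t * ((expR (4 * x) - 1) / 2).
    apply: ler_wpM2l; first exact: ltW.
    have : expR (4 * x) * x <= 2 * x by rewrite ler_wpM2r.
    lra.
  rewrite E; move: h1; lra.
by lra.
Qed.

End Weight.
End StieltjesSum.

Section Vectors.
Context {R : realType} {M : nat}.
Implicit Types (z : 'I_M -> R) (y : R -> 'I_M -> R).

Definition cadlagv y := forall k, cadlag (fun t => y t k).
Definition lmv y (s : R) : 'I_M -> R := fun k => lm (fun u => y u k) s.

Lemma vnorm_ge0 z : 0 <= vnorm z.
Proof. exact: sumr_ge0. Qed.

Lemma vnorm_coord z k : `|z k| <= vnorm z.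
Proof. by rewrite /vnorm (bigD1 k)//= lerDl sumr_ge0. Qed.

Lemma vnorm_le z b : (forall k, `|z k| <= b) -> vnorm z <= M%:R * b.
Proof.
move=> zb; rewrite -[X in _ <= X%:R * _](card_ord M) mulr_natl -sumr_const.
by apply: ler_sum => k _; exact: zb.
Qed.

Lemma vnorm0 z z' : vnorm (z \- z') <= 0 -> z = z'.
Proof.
move=> h; apply/funext => k; apply/eqP; rewrite -subr_eq0 -normr_eq0 eq_le normr_ge0 andbT.
exact: le_trans (vnorm_coord (z \- z') k) h.
Qed.

Lemma eq_lmv y y' t : cadlagv y -> 0 < t ->
  (forall u, 0 <= u -> u < t -> y u = y' u) -> lmv y' t = lmv y t.
Proof.
move=> cy t0 yy; apply/funext => k; apply: eq_lm => // u u0 ut.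
by rewrite yy.
Qed.

Lemma cvg_vnorm_left y y' t : cadlagv y -> cadlagv y' -> 0 < t ->
  vnorm (y x \- y' x) @[x --> at_left t] --> vnorm (lmv y t \- lmv y' t).
Proof.
move=> cy cy' t0; rewrite /vnorm.
elim: (index_enum 'I_M) => [|k s ih].
  by under eq_fun do rewrite big_nil; rewrite big_nil; exact: cvg_cst.
under eq_fun do rewrite big_cons; rewrite big_cons; apply: cvgD => //.
by apply: cvg_norm; apply: cvgB; exact: cadlag_lm.
Qed.

Lemma le_cvg_left (f g : R -> R) t l l' : 0 < t ->
  f x @[x --> at_left t] --> l -> g x @[x --> at_left t] --> l' ->
  (forall u, 0 <= u -> u < t -> f u <= g u) -> l <= l'.
Proof.
move=> t0 fl gl fg; rewrite leNgt; apply/negP; rewrite -subr_gt0 => e0.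
have : g x - f x @[x --> at_left t] --> l' - l by exact: cvgB.
move=> /cvg_left_epsP/(_ _ e0)[del del0 hd].
have [s [s0 ds st]] := left_point t0 del0.
have := hd s ds st; rewrite ltr_distlC => /andP[_ h].
by have := fg s s0 st; move: h; lra.
Qed.

Lemma cadlagv_bounded y t : cadlagv y -> 0 <= t ->
  exists2 B, 0 <= B & forall u k, 0 <= u -> u <= t -> `|y u k| <= B.
Proof.
move=> cy t0.
have /choice[b hb] : forall k, exists b, 0 <= b /\ forall u, 0 <= u -> u <= t -> `|y u k| <= b.
  by move=> k; have [b b0 hb] := cadlag_bounded (cy k) t0; exists b.
exists (\sum_k b k); first by apply: sumr_ge0 => k _; case: (hb k).
move=> u k u0 ut; apply: (le_trans ((hb k).2 u u0 ut)).
by rewrite (bigD1 k)//= lerDl sumr_ge0// => j _; case: (hb j).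
Qed.

End Vectors.

(** * Contraction and Gronwall estimates *)

Section Contraction.
Context {R : realType} {C : finType} {M : nat}.
Local Notation mR := (measurableTypeR R).
Variable A : C -> R -> R.
Hypotheses (ndA : forall c, nondec (A c)) (cA : forall c, cadlag (A c)).
Implicit Types (y : R -> 'I_M -> R) (h : C -> mR -> 'I_M -> R).

Definition sintv h := forall m, sint A (fun c s => h c s m).
Definition SIv h (t : R) (m : 'I_M) : R := SI A (fun c s => h c s m) t.

(** The integrands see only left limits, so a bound strictly before [T] yields the halved bound at
    [T] itself, whatever the jump there. The factor [M.+1] in the weight pays for the sum over the
    coordinates and is positive even for [M = 0]. *)
Lemma contraction y y' h h' K T e : 0 <= K -> 0 <= T -> 0 <= e ->
  cadlagv y -> cadlagv y' -> sintv h -> sintv h' ->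
  (forall c m s, 0 < s -> s <= T ->
     `|h c s m - h' c s m| <= K * vnorm (lmv y s \- lmv y' s)) ->
  (forall u, 0 <= u -> u < T -> vnorm (y u \- y' u) <= e * weight A (K * M.+1%:R) u) ->
  vnorm (SIv h T \- SIv h' T) <= e / 2 * weight A (K * M.+1%:R) T.
Proof.
move=> K0 T0 e0 cy cy' ih ih' hh yy; set K' := K * _ in yy *.
have K'0 : 0 <= K' by rewrite mulr_ge0.
have iw := sint_weightl ndA cA K'0.
have lw s : 0 < s -> s <= T -> vnorm (lmv y s \- lmv y' s) <= e * weightl A K' s.
  move=> s0 sT; apply: (le_cvg_left s0 (cvg_vnorm_left cy cy' s0)).
    apply: cvgMr; exact: (weight_lm cA).
  by move=> u u0 us; apply: yy => //; exact: lt_le_trans sT.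
have hm m : `|SIv h T m - SIv h' T m| <= e / 2 * weight A K' T / M.+1%:R.
  rewrite /SIv -SIB//.
  apply: (@le_trans _ _ (SI A (fun _ s => K * e * weightl A K' s) T)).
    apply: abs_SI_le => //; [exact: sintB|exact: sintZ|move=> c s s0 sT].
    by apply: (le_trans (hh c m s s0 sT)); rewrite -mulrA ler_wpM2l// lw.
  rewrite SIZ//; have := weight_integral ndA cA K'0 T0.
  rewrite -/(SI A (fun _ => weightl A K') T) => h1.
  rewrite ler_pdivlMr//.
  have -> : K * e * SI A (fun=> weightl A K') T * M.+1%:R =
    e * (K' * SI A (fun=> weightl A K') T) by rewrite /K'; ring.
  by rewrite -mulrA ler_wpM2l// [2^-1 * _]mulrC.
apply: (le_trans (vnorm_le hm)).
have w0 : 0 <= weight A K' T by exact: expR_ge0.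
rewrite mulrCA -[leRHS]mulr1 ler_wpM2l ?mulr_ge0//.
by rewrite ler_pdivrMr// mul1r ler_nat.
Qed.

(** The difference is bounded up to [t], and each application of [contraction] halves its weighted
    bound; so it vanishes. *)
Lemma gronwall y y' h h' K T : 0 <= K ->
  cadlagv y -> cadlagv y' -> sintv h -> sintv h' ->
  (forall t, 0 <= t -> t < T -> forall m, y t m - y' t m = SIv h t m - SIv h' t m) ->
  (forall c m s, 0 < s -> s < T ->
     `|h c s m - h' c s m| <= K * vnorm (lmv y s \- lmv y' s)) ->
  forall t, 0 <= t -> t < T -> y t = y' t.
Proof.
move=> K0 cy cy' ih ih' yE hh t t0 tT.
have [B B0 hB] := cadlagv_bounded (fun k => cadlagB (cy k) (cy' k)) t0.
set K' := K * M.+1%:R.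
have K'0 : 0 <= K' by rewrite mulr_ge0.
pose b := M%:R * B.
have b0 : 0 <= b by rewrite mulr_ge0.
have main n : forall u, 0 <= u -> u <= t ->
    vnorm (y u \- y' u) <= b / 2 ^+ n * weight A K' u.
  elim: n => [|n ihn] u u0 ut.
    rewrite expr0 divr1; apply: (@le_trans _ _ b).
      by apply: vnorm_le => k; exact: hB.
    by rewrite ler_peMr// (weight_ge1 ndA K'0).
  have -> : y u \- y' u = SIv h u \- SIv h' u.
    by apply/funext => m /=; rewrite yE// (le_lt_trans ut).
  rewrite exprSr invfM mulrA.
  apply: (@contraction y y' h h' K u (b / 2 ^+ n)) => //.
  - by rewrite divr_ge0// exprn_ge0.
  - by move=> c m s s0 su; apply: hh => //; apply: (le_lt_trans su); exact: le_lt_trans tT.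
  - by move=> v v0 vu; apply: ihn => //; apply: (le_trans (ltW vu)).
apply: vnorm0; rewrite leNgt; apply/negP => e0.
set e := vnorm _ in e0.
pose W := b * weight A K' t.
have W0 : 0 <= W by rewrite mulr_ge0// expR_ge0.
have [n hn] : exists n, W / 2 ^+ n < e.
  exists (Num.bound (W / e)); rewrite ltr_pdivrMr ?exprn_gt0// mulrC -ltr_pdivrMr//.
  apply: (lt_le_trans (archi_boundP (divr_ge0 W0 (ltW e0)))).
  by rewrite -natrX ler_nat ltnW// ltn_expl.
have := main n t t0 (lexx _); rewrite leNgt -/e => /negP; apply.
by rewrite mulrAC.
Qed.

End Contraction.

Section Geometric.
Context {R : realType}.

Lemma geometric_cauchy (a : nat -> R) (c : R) : (forall n, `|a n.+1 - a n| <= c / 2 ^+ n) ->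
  cvg (a n @[n --> \oo]) /\
  forall n, `|lim (a n @[n --> \oo]) - a n| <= 2 * c / 2 ^+ n.
Proof.
move=> ha; have c0 : 0 <= c.
  by have := le_trans (normr_ge0 _) (ha 0%N); rewrite expr0 divr1.
have p2 n : (0 : R) < 2 ^+ n by rewrite exprn_gt0.
have d2 n k : `|a (n + k)%N - a n| <= 2 * c / 2 ^+ n - 2 * c / 2 ^+ (n + k).
  elim: k => [|k ih]; first by rewrite addn0 !subrr normr0.
  rewrite addnS; have -> : a (n + k).+1 - a n = (a (n + k).+1 - a (n + k)%N) + (a (n + k)%N - a n) by ring.
  apply: (le_trans (ler_normD _ _)); apply: (le_trans (lerD (ha _) ih)).
  rewrite exprSr invfM.
  have -> : 2 * c * ((2 ^+ (n + k))^-1 * 2^-1) = c / 2 ^+ (n + k).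
    by field; rewrite gt_eqF.
  have -> : 2 * c / 2 ^+ (n + k) = c / 2 ^+ (n + k) + c / 2 ^+ (n + k) by ring.
  lra.
have d3 n m : (n <= m)%N -> `|a m - a n| <= 2 * c / 2 ^+ n.
  move=> nm; rewrite -(subnKC nm); apply: (le_trans (d2 _ _)).
  by rewrite gerBl divr_ge0 ?mulr_ge0// ltW.
have e2 (e : R) : 0 < e -> exists n, 2 * c / 2 ^+ n < e.
  move=> e0; exists (Num.bound (2 * c / e)).
  rewrite ltr_pdivrMr// [e * _]mulrC -ltr_pdivrMr//.
  have h : 0 <= 2 * c / e by rewrite divr_ge0 ?mulr_ge0// ltW.
  apply: (lt_le_trans (archi_boundP h)).
  by rewrite -natrX ler_nat ltnW// ltn_expl.
have ca : cvg (a n @[n --> \oo]).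
  apply/cauchy_cvgP/cauchy_exP => e e0.
  have [n hn] := e2 e e0; exists (a n).
  exists n => // m nm; rewrite /= /ball/= distrC; apply: le_lt_trans hn.
  exact: d3.
split=> // n; have h : `|a m - a n| @[m --> \oo] --> `|lim (a m @[m --> \oo]) - a n|.
  by apply: cvg_norm; apply: cvgB => //; exact: cvg_cst.
rewrite -(cvg_lim _ h)//; apply: limr_le; first by apply/cvg_ex; eexists; exact: h.
near=> m; apply: d3; near: m; exact: nbhs_infty_ge.
Unshelve. all: by end_near. Qed.
End Geometric.

(** * Picard iteration *)

Section Picard.
Context {R : realType} {C : finType} {M : nat}.
Local Notation mR := (measurableTypeR R).
Variable A : C -> R -> R.
Hypotheses (ndA : forall c, nondec (A c)) (cA : forall c, cadlag (A c)).
Variables (beta : C -> R -> ('I_M -> R) -> 'I_M -> R) (U : R -> 'I_M -> R).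

Fixpoint picard_iter (n : nat) : R -> 'I_M -> R :=
  if n is n'.+1 then
    fun t m => U t m + SI A (fun c s => beta c s (lmv (picard_iter n') s) m) t
  else U.

Definition picard (t : R) (m : 'I_M) : R := lim (picard_iter n t m @[n --> \oo]).

Definition lipschitz_coef := forall T, 0 <= T -> exists2 K, 0 <= K &
  forall c m s, 0 < s -> s <= T ->
    (forall z, `|beta c s z m| <= K) /\
    (forall z z', `|beta c s z m - beta c s z' m| <= K * vnorm (z \- z')).

Definition measurable_coef := forall c m y, cadlagv y ->
  measurable_fun pos0 (fun s : mR => beta c s (lmv y s) m).

Hypotheses (lipb : lipschitz_coef) (mb : measurable_coef) (cU : cadlagv U).

Lemma sintv_coef y : cadlagv y -> sintv A (fun c s => beta c s (lmv y s)).
Proof.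
move=> cy m; apply: bounded_sint => // [c|t t0]; first exact: mb.
by have [K K0 hK] := lipb t0; exists K => c s s0 st; exact: (hK c m s s0 st).1.
Qed.

Lemma picard_iter_cadlag n : cadlagv (picard_iter n).
Proof.
elim: n => [|n ih] //= k; apply: cadlagD; first exact: cU.
by apply: SI_cadlag => //; exact: sintv_coef.
Qed.

Lemma picard_geometric T : 0 <= T -> exists2 b, 0 <= b &
  forall n u m, 0 <= u -> u <= T -> `|picard_iter n.+1 u m - picard_iter n u m| <= b / 2 ^+ n.
Proof.
move=> T0; have [K K0 hK] := lipb T0.
pose K' := K * M.+1%:R.
have K'0 : 0 <= K' by rewrite mulr_ge0.
have [B B0 hB] := cadlagv_bounded
  (fun k => cadlagB (picard_iter_cadlag 1 k) (picard_iter_cadlag 0 k)) T0.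
pose b := M%:R * B.
have b0 : 0 <= b by rewrite mulr_ge0.
have main n : forall u, 0 <= u -> u <= T ->
    vnorm (picard_iter n.+1 u \- picard_iter n u) <= b / 2 ^+ n * weight A K' u.
  elim: n => [|n ihn] u u0 uT.
    rewrite expr0 divr1; apply: (@le_trans _ _ b).
      by apply: vnorm_le => k; exact: hB.
    by rewrite ler_peMr// (weight_ge1 ndA K'0).
  have -> : picard_iter n.+2 u \- picard_iter n.+1 u =
      SIv A (fun c s => beta c s (lmv (picard_iter n.+1) s)) u \-
      SIv A (fun c s => beta c s (lmv (picard_iter n) s)) u.
    by apply/funext => m /=; rewrite /SIv/=; ring.
  rewrite [2 ^+ n.+1]exprSr invfM mulrA.
  apply: (contraction ndA cA (y := picard_iter n.+1) (y' := picard_iter n)) => //.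
  - by rewrite divr_ge0// exprn_ge0.
  - exact: picard_iter_cadlag.
  - exact: picard_iter_cadlag.
  - by apply: sintv_coef; exact: picard_iter_cadlag.
  - by apply: sintv_coef; exact: picard_iter_cadlag.
  - by move=> c m s s0 su; apply: (hK c m s s0 (le_trans su uT)).2.
  - by move=> v v0 vu; apply: ihn => //; apply: (le_trans (ltW vu)).
exists (b * weight A K' T); first by rewrite mulr_ge0// expR_ge0.
move=> n u m u0 uT; apply: (le_trans (vnorm_coord (picard_iter n.+1 u \- picard_iter n u) m)).
apply: (le_trans (main n u u0 uT)); rewrite mulrAC.
rewrite ler_wpM2r ?invr_ge0 ?exprn_ge0// ler_wpM2l//.
exact: weight_le.
Qed.

Lemma picard_cvg t m : 0 <= t -> picard_iter n t m @[n --> \oo] --> picard t m.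
Proof.
move=> t0; have [b b0 hb] := picard_geometric t0.
by have [] := geometric_cauchy (fun n => hb n t m t0 (lexx _)).
Qed.

Lemma picard_unif T : 0 <= T -> exists2 b, 0 <= b &
  forall n u m, 0 <= u -> u <= T -> `|picard u m - picard_iter n u m| <= b / 2 ^+ n.
Proof.
move=> T0; have [b b0 hb] := picard_geometric T0.
exists (2 * b) => [|n u m u0 uT]; first by rewrite mulr_ge0.
by have [_] := geometric_cauchy (fun n => hb n u m u0 uT); exact.
Qed.

Lemma geometric_small (b e : R) : 0 <= b -> 0 < e -> exists n, b / 2 ^+ n < e.
Proof.
move=> b0 e0; exists (Num.bound (b / e)).
have p2 n : (0 : R) < 2 ^+ n by rewrite exprn_gt0.
rewrite ltr_pdivrMr// [e * _]mulrC -ltr_pdivrMr//.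
apply: (lt_le_trans (archi_boundP (divr_ge0 b0 (ltW e0)))).
by rewrite -natrX ler_nat ltnW// ltn_expl.
Qed.

Lemma picard_cadlag : cadlagv picard.
Proof.
move=> k; split=> t t0.
  apply/cvg_right_epsP => e e0.
  have t10 : 0 <= t + 1 by rewrite addr_ge0.
  have [b b0 hb] := picard_unif t10.
  have [|n hn] := @geometric_small b (e / 3) b0; first by rewrite divr_gt0.
  have := (picard_iter_cadlag n k).1 t t0 => /cvg_right_epsP/(_ _ (divr_gt0 e0 (ltr0n _ 3))).
  move=> [del del0 hd]; exists (Num.min del 1); first by rewrite lt_min del0 ltr01.
  move=> x tx; rewrite -ltrBlDl lt_min => /andP[xd x1].
  have t1 : t <= t + 1 by rewrite lerDl.
  have h1 := hb n t k t0 t1.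
  have h2 : `|picard x k - picard_iter n x k| <= b / 2 ^+ n.
    by apply: hb; [exact: le_trans (ltW tx)|rewrite -lerBlDl ltW].
  have h3 : `|picard_iter n t k - picard_iter n x k| < e / 3 by apply: hd => //; rewrite -ltrBlDl.
  have -> : picard t k - picard x k = (picard t k - picard_iter n t k) +
     (picard_iter n t k - picard_iter n x k) - (picard x k - picard_iter n x k) by ring.
  apply: (le_lt_trans (ler_normB _ _)).
  apply: (le_lt_trans (lerD (ler_normD _ _) (lexx _))).
  by move: h1 h2 h3 hn; lra.
have [b b0 hb] := picard_unif (ltW t0).
(* By locally uniform convergence the left limits of the iterates form a geometric Cauchy sequence;
   its limit is the left limit sought. *)
have il : forall n, `|lm (fun u => picard_iter n.+1 u k) t - lm (fun u => picard_iter n u k) t|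
   <= 2 * b / 2 ^+ n.
  move=> n; rewrite -lmB//; [|exact: picard_iter_cadlag..].
  apply: (@cadlag_lm_bounded _ _ t) => //; first by apply: cadlagB; exact: picard_iter_cadlag.
  move=> u u0 ut.
  have h1 := hb n u k u0 ut; have h2 := hb n.+1 u k u0 ut.
  have p2 : (0 : R) < 2 ^+ n by rewrite exprn_gt0.
  have -> : picard_iter n.+1 u k - picard_iter n u k =
    (picard u k - picard_iter n u k) - (picard u k - picard_iter n.+1 u k) by ring.
  apply: (le_trans (ler_normB _ _)).
  have : b / 2 ^+ n.+1 <= b / 2 ^+ n.
    by rewrite ler_wpM2l// lef_pV2 ?posrE ?exprn_gt0// ler_eXn2l ?ltr1n.
  have -> : 2 * b / 2 ^+ n = b / 2 ^+ n + b / 2 ^+ n by ring.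
  by move: h1 h2; lra.
have [cl hl] := geometric_cauchy il.
set l := lim _ in cl hl.
apply/cvg_ex; exists l; apply/cvg_left_epsP => e e0.
have [||n hn] := @geometric_small (2 * (2 * b)) (e / 3).
- by rewrite !mulr_ge0.
- by rewrite divr_gt0.
have := cadlag_lm (picard_iter_cadlag n k) t0 => /cvg_left_epsP/(_ _ (divr_gt0 e0 (ltr0n _ 3))).
move=> [del del0 hd]; exists (Num.min del t); first by rewrite lt_min del0 t0.
move=> x; rewrite ltrBlDl -ltrBlDr lt_min => /andP[xd x1] xt.
have x0 : 0 <= x by move: x1; rewrite ltrBlDr ltrDl => /ltW.
have h1 := hl n.
have h2 := hb n x k x0 (ltW xt).
have h3 : `|lm (fun u => picard_iter n u k) t - picard_iter n x k| < e / 3.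
  by apply: hd => //; rewrite ltrBlDl -ltrBlDr.
have h4 : b / 2 ^+ n <= 2 * (2 * b) / 2 ^+ n.
  by rewrite ler_wpM2r ?invr_ge0 ?exprn_ge0//; lra.
have -> : l - picard x k = (l - lm (fun u => picard_iter n u k) t) +
     (lm (fun u => picard_iter n u k) t - picard_iter n x k) - (picard x k - picard_iter n x k) by ring.
apply: (le_lt_trans (ler_normB _ _)).
apply: (le_lt_trans (lerD (ler_normD _ _) (lexx _))).
by move: h1 h2 h3 h4 hn; lra.
Qed.

(** The limit is close to the next iterate by [picard_unif], and the integral of the limit is close
    to that of the iterate by [contraction]. *)
Lemma picard_eq t m : 0 <= t ->
  picard t m = U t m + SI A (fun c s => beta c s (lmv picard s) m) t.
Proof.
move=> t0; have [K K0 hK] := lipb t0; have [b b0 hb] := picard_unif t0.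
pose K' := K * M.+1%:R.
have K'0 : 0 <= K' by rewrite mulr_ge0.
apply/eqP; rewrite -subr_eq0 -normr_eq0 eq_le normr_ge0 andbT leNgt; apply/negP.
set e := `|_| => e0.
(* [B / 2 ^+ n] dominates the sum of the two errors: the distance to the iterate and the distance
   between the integrals. *)
pose B := b + M%:R * b * weight A K' t.
have B0 : 0 <= B by rewrite addr_ge0// !mulr_ge0// expR_ge0.
have [n] := geometric_small B0 e0; rewrite ltNge => /negP; apply.
have h1 : `|picard t m - picard_iter n.+1 t m| <= b / 2 ^+ n.
  apply: (le_trans (hb n.+1 t m t0 (lexx _))).
  by rewrite ler_wpM2l// lef_pV2 ?posrE ?exprn_gt0// ler_eXn2l ?ltr1n.
have h2 : vnorm (SIv A (fun c s => beta c s (lmv (picard_iter n) s)) t \-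
    SIv A (fun c s => beta c s (lmv picard s)) t) <= M%:R * b / 2 ^+ n / 2 * weight A K' t.
  apply: (contraction ndA cA (y := picard_iter n) (y' := picard)) => //.
  - by rewrite divr_ge0 ?mulr_ge0// exprn_ge0.
  - exact: picard_iter_cadlag.
  - exact: picard_cadlag.
  - by apply: sintv_coef; exact: picard_iter_cadlag.
  - by apply: sintv_coef; exact: picard_cadlag.
  - by move=> c k s s0 st; apply: (hK c k s s0 st).2.
  - move=> u u0 ut; apply: (@le_trans _ _ (M%:R * b / 2 ^+ n)).
      rewrite -mulrA; apply: vnorm_le => k /=; rewrite distrC.
      by apply: hb => //; exact: ltW.
    by rewrite ler_peMr ?(weight_ge1 ndA K'0)// divr_ge0 ?mulr_ge0// exprn_ge0.
have h3 := le_trans (vnorm_coord _ m) h2.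
have -> : e = `|(picard t m - picard_iter n.+1 t m) +
   (SIv A (fun c s => beta c s (lmv (picard_iter n) s)) t m -
    SIv A (fun c s => beta c s (lmv picard s)) t m)|.
  by congr `|_|; rewrite /SIv /=; ring.
apply: (le_trans (ler_normD _ _)); apply: (le_trans (lerD h1 h3)).
rewrite /B mulrDl lerD2l.
have w0 : 0 <= weight A K' t by exact: expR_ge0.
have : 0 <= M%:R * b / 2 ^+ n * weight A K' t by rewrite !mulr_ge0// invr_ge0 exprn_ge0.
have -> : M%:R * b * weight A K' t / 2 ^+ n = M%:R * b / 2 ^+ n * weight A K' t by ring.
have -> : M%:R * b / 2 ^+ n / 2 * weight A K' t = M%:R * b / 2 ^+ n * weight A K' t / 2 by ring.
lra.
Qed.

End Picard.

(** * Survival and death of a coordinate *)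

Section Dead.
Context {R : realType} {C : finType} {M : nat}.
Local Notation mR := (measurableTypeR R).
Implicit Types (y : R -> 'I_M -> R) (f : R -> R).

Definition alivev y (s : R) : 'I_M -> bool := fun k => alive (fun u => y u k) s.
Definition ndead y s : nat := #|[pred k | ~~ alivev y s k]|.
Definition nonnegv y := forall u k, 0 <= u -> 0 <= y u k.

Lemma alive_anti f s t : (forall u, 0 <= u -> 0 <= f u) -> 0 < s -> s <= t ->
  alive f t -> alive f s.
Proof.
move=> f0 s0 st /(aliveP f0 (lt_le_trans s0 st))[e e0 h].
by apply/(aliveP f0 s0); exists e => // u u0 us; apply: h => //; exact: lt_le_trans st.
Qed.

Lemma alive_lm f s : (forall u, 0 <= u -> 0 <= f u) -> cadlag f -> 0 < s ->
  alive f s -> 0 < lm f s.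
Proof.
move=> f0 cf s0 /(aliveP f0 s0)[e e0 h]; apply: (lt_le_trans e0).
exact: (ge_lm_cst cf s0 (lexx 0)).
Qed.

Lemma alive_left f s : (forall u, 0 <= u -> 0 <= f u) -> cadlag f -> 0 < s ->
  (forall u, 0 < u -> u < s -> alive f u) -> 0 < lm f s -> alive f s.
Proof.
move=> f0 cf s0 al l0; have l20 : 0 < lm f s / 2 by rewrite divr_gt0.
have /cvg_left_epsP/(_ _ l20)[del del0 hd] := cadlag_lm cf s0.
have [|u [u0 du us]] := @left_point _ s (s / 2) del _ del0; first by lra.
have up : 0 < u by apply: lt_le_trans u0; lra.
have /(aliveP f0 up)[e e0 h] := al u up us.
apply/(aliveP f0 s0); exists (Num.min e (lm f s / 2)).
  by rewrite lt_min e0.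
move=> v v0 vs; have [vu|uv] := ltP v u; first by rewrite ge_min h.
rewrite ge_min; apply/orP; right; apply/ltW.
by have := hd v (lt_le_trans du uv) vs; rewrite ltr_distlC => /andP[+ _]; lra.
Qed.

(** Survival at [t] is required only for [t > 0], because [alive f 0] is false by convention. *)
Lemma alive_right f t : (forall u, 0 <= u -> 0 <= f u) -> cadlag f -> 0 <= t ->
  (0 < t -> alive f t) -> 0 < f t ->
  exists2 h, 0 < h & forall u, t < u -> u <= t + h -> alive f u.
Proof.
move=> f0 cf t0 al ft; have l20 : 0 < f t / 2 by rewrite divr_gt0.
have /cvg_right_epsP/(_ _ l20)[del del0 hd] := cf.1 t t0.
exists (del / 2) => [|u tu ud]; first by rewrite divr_gt0.
have [e e0 h] : exists2 e, 0 < e & forall u, 0 <= u -> u < t -> e <= f u.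
  have [->|tn0] := eqVneq t 0; last by apply/(aliveP f0); [|apply: al]; rewrite lt_neqAle eq_sym tn0.
  by exists 1 => // v v0 /(le_lt_trans v0); rewrite ltxx.
apply/(aliveP f0 (le_lt_trans t0 tu)); exists (Num.min e (f t / 2)).
  by rewrite lt_min e0.
move=> v v0 vu; rewrite ge_min; have [vt|tv] := ltP v t; first by rewrite h.
apply/orP; right; move: tv; rewrite le_eqVlt => /orP[/eqP <-|tv]; first lra.
have vd : v < t + del by lra.
by have := hd v tv vd; rewrite ltr_distlC => /andP[+ _]; lra.
Qed.

Lemma alivev_anti y s t k : nonnegv y -> 0 < s -> s <= t -> alivev y t k -> alivev y s k.
Proof. by move=> y0 s0 st; apply: alive_anti => // u u0; exact: y0. Qed.

Lemma ndead_mono y s t : nonnegv y -> 0 < s -> s <= t -> (ndead y s <= ndead y t)%N.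
Proof.
move=> y0 s0 st; apply: subset_leq_card; apply/fintype.subsetP => k; rewrite !inE.
by apply: contra; exact: alivev_anti.
Qed.

Lemma ndead_le y s : (ndead y s <= M)%N.
Proof. by rewrite -[X in (_ <= X)%N](card_ord M) max_card. Qed.

Lemma eq_alivev y y' s : 0 < s -> (forall u, 0 <= u -> u < s -> y u = y' u) ->
  alivev y s = alivev y' s.
Proof.
move=> s0 yy; apply/funext => k; rewrite /alivev /alive; congr (0 < inf _).
by apply/seteqP; split => _ [u /= + <-]; rewrite in_itv/= => /andP[u0 us];
  exists u; rewrite /= ?in_itv/= ?u0 ?yy.
Qed.

Variable A : C -> R -> R.
Hypotheses (ndA : forall c, nondec (A c)) (cA : forall c, cadlag (A c)).

Lemma SI_const (h : C -> mR -> R) s t : sint A h -> 0 <= s -> s <= t ->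
  (forall c u, s < u -> u <= t -> h c u = 0) -> SI A h t = SI A h s.
Proof.
move=> ih s0 st h0; apply/eqP; rewrite -subr_eq0 -normr_eq0 eq_le normr_ge0 andbT.
rewrite -(mul0r (totA A t - totA A s)); apply: abs_SIB_le => // c u su ut.
by rewrite h0// normr0.
Qed.

(** Zero is absorbing. If the first death is an approach to 0 from the left at [s], the integrands
    vanish at [s], so there is no jump and [f s = 0]. If it is a jump to 0 at [t], the path is dead
    only after [t]. In both cases it is constant from then on. *)
Lemma dead_zero (f : R -> R) (a : R) (h : C -> mR -> R) : sint A h -> cadlag f ->
  (forall u, 0 <= u -> 0 <= f u) -> (forall t, 0 <= t -> f t = a + SI A h t) ->
  (forall c s, 0 < s -> ~~ alive f s -> h c s = 0) ->
  forall s u, 0 < s -> ~~ alive f s -> s <= u -> f u = 0.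
Proof.
move=> ih cf f0 fE h0.
have const s u : 0 <= s -> s <= u -> (forall v, s < v -> v <= u -> ~~ alive f v) -> f u = f s.
  move=> s0 su al; rewrite !fE//; last exact: le_trans su.
  by congr (_ + _); apply: SI_const => // c v sv vu; apply: h0; [exact: le_lt_trans sv|exact: al].
have main : forall s, 0 <= s -> 0 < s -> ~~ alive f s -> f s = 0.
  apply: real_ind => [s _ ih1 s0 ds|t t0 ih1].
    have [[u [up us du]]|nd] := pselect (exists u, [/\ 0 < u, u < s & ~~ alive f u]).
      rewrite (const u s (ltW up) (ltW us)); first by apply: ih1 => //; exact: ltW.
      by move=> v uv vs; apply: contra du; apply: alive_anti => //; exact: ltW.
    have al u : 0 < u -> u < s -> alive f u.
      by move=> up us; apply: contrapT => /negP du; apply: nd; exists u.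
    have l0 : lm f s <= 0.
      by rewrite leNgt; apply: contra ds => l0; exact: alive_left.
    have fl : f s = lm f s.
      have E : lm f s = a + lm (SI A h) s.
        have cs : cadlag (fun t => a + SI A h t) by apply: cadlagD; [exact: cadlag_cst|exact: SI_cadlag].
        rewrite (@eq_lm _ (fun t => a + SI A h t) f)//; last first.
          by move=> u u0 _; rewrite fE.
        rewrite lmD//; [|exact: cadlag_cst|exact: SI_cadlag].
        by congr (_ + _); apply: lm_unique => //; exact: cvg_cst.
      rewrite fE ?ltW// SI_last// big1 ?addr0//.
      by move=> c _; rewrite h0// mul0r.
    by apply/eqP; rewrite eq_le {1}fl l0 f0 ?ltW.
  have [ft|ft] := ltP 0 (f t).
    have [|hh hh0 hal] := @alive_right f t f0 cf t0 _ ft.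
      move=> tp; apply: contrapT => /negP dt; have := ih1 t t0 (lexx _) tp dt.
      by move=> e; rewrite e ltxx in ft.
    by exists hh => // u tu ut _; rewrite hal.
  have {}ft : f t = 0 by apply/eqP; rewrite eq_le ft f0.
  exists 1 => // u tu _ up _; rewrite (const t u t0 (ltW tu))// => v tv _.
  have vp : 0 < v by exact: le_lt_trans tv.
  apply/negP => /(aliveP f0 vp)[e e0 he].
  by have := he t t0 tv; rewrite ft leNgt e0.
move=> s u s0 ds su; rewrite (const s u (ltW s0) su); first by apply: main => //; exact: ltW.
by move=> v sv _; apply: contra ds; apply: alive_anti => //; exact: ltW.
Qed.

End Dead.

Section Clamp.
Context {R : realType} {M : nat}.
Implicit Types (z : 'I_M -> R) (kap : 'I_M -> bool).

Definition inbox (j : nat) kap z := forall k,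
  if kap k then j.+1%:R^-1 <= z k <= j.+1%:R else z k == 0.

Definition clampv (j : nat) kap z : 'I_M -> R := fun k =>
  if kap k then Num.max (j.+1%:R^-1) (Num.min (j.+1%:R) (z k)) else 0.

Lemma invS_le (j : nat) : j.+1%:R^-1 <= j.+1%:R :> R.
Proof. by rewrite (@le_trans _ _ 1)// ?ler1n// invf_le1// ler1n. Qed.

Lemma subDD (x a c : R) : (x + a) - (x + c) = a - c.
Proof. by rewrite opprD addrACA subrr add0r. Qed.

Lemma oppr_le_add (u x a c : R) : 0 <= u + (x + a) -> a <= c -> - x <= u + c.
Proof. by lra. Qed.

Lemma clampv_inbox j kap z : inbox j kap (clampv j kap z).
Proof.
move=> k; rewrite /clampv; case: (kap k) => //.
by rewrite le_max lexx ge_max invS_le ge_min lexx.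
Qed.

Lemma clampv_id j kap z : inbox j kap z -> clampv j kap z = z.
Proof.
move=> h; apply/funext => k; have := h k; rewrite /clampv; case: (kap k) => [/andP[h1 h2]|/eqP//].
by rewrite min_r// max_r.
Qed.

Lemma lip_max (a x y : R) : `|Num.max a x - Num.max a y| <= `|x - y|.
Proof.
case: (leP a x) => h1; case: (leP a y) => h2 //.
- by rewrite !ger0_norm; lra.
- by rewrite !ler0_norm; lra.
- by rewrite subrr normr0.
Qed.

Lemma lip_min (a x y : R) : `|Num.min a x - Num.min a y| <= `|x - y|.
Proof.
case: (leP a x) => h1; case: (leP a y) => h2 //.
- by rewrite subrr normr0.
- by rewrite !ger0_norm; lra.
- by rewrite !ler0_norm; lra.
Qed.

Lemma clampv_lip j kap z z' : vnorm (clampv j kap z \- clampv j kap z') <= vnorm (z \- z').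
Proof.
apply: ler_sum => k _; rewrite /= /clampv; case: (kap k); last by rewrite subrr normr0.
exact: le_trans (lip_max _ _ _) (lip_min _ _ _).
Qed.

Lemma inbox_mono j j' kap z : (j <= j')%N -> inbox j kap z -> inbox j' kap z.
Proof.
move=> jj h k; have := h k; case: (kap k) => // /andP[h1 h2]; apply/andP; split.
  by apply: le_trans h1; rewrite lef_pV2 ?posrE// ler_nat ltnS.
by apply: (le_trans h2); rewrite ler_nat ltnS.
Qed.

Lemma inbox_ge0 j kap z : inbox j kap z -> nonneg z.
Proof.
move=> h k; have := h k; case: (kap k) => [/andP[h1 _]|/eqP -> //].
by apply: le_trans h1; rewrite invr_ge0.
Qed.
End Clamp.

(** * From one death to the next along a fixed path *)

Section Stage.
Context {R : realType} {M N : nat}.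
Local Notation mR := (measurableTypeR R).
Local Notation C := (option 'I_N).
Implicit Types (y : R -> 'I_M -> R).
Variable A : C -> R -> R.
Hypotheses (ndA : forall c, nondec (A c)) (cA : forall c, cadlag (A c)).
Variable b : C -> R -> ('I_M -> bool) -> ('I_M -> R) -> 'I_M -> R.

Definition box_lipschitz := forall (j : nat) T, 0 <= T -> exists2 K, 0 <= K &
  forall c m s kap z z', 0 < s -> s <= T -> inbox j kap z -> inbox j kap z' ->
    `|b c s kap z m| <= K /\ `|b c s kap z m - b c s kap z' m| <= K * vnorm (z \- z').
Definition dead_coef := forall c s kap z m, 0 < s -> ~~ kap m -> b c s kap z m = 0.
(** [None] stands for investment, [Some n] for the share in the payoff of asset [n]. Unlike the
    Lipschitz constants, these bounds do not depend on a box and survive the passage to the limit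
    over the boxes. *)
Definition signed_coef := forall s kap z m, 0 < s -> nonneg z ->
  b None s kap z m <= 0 /\ forall n, `|b (Some n) s kap z m| <= 1.
(** A simultaneous jump of all drivers takes a living coordinate with left limit [z m] to a
    nonnegative value. *)
Definition budget_coef := forall s (kap : 'I_M -> bool) z m, 0 < s -> nonneg z -> kap m ->
  0 <= z m + \sum_c b c s kap z m * jump (A c) s.

Hypotheses (lipb : box_lipschitz) (deadb : dead_coef) (signb : signed_coef)
  (budb : budget_coef).
Variable y0 : 'I_M -> R.

(** Stage 0 is the constant path [y0]. As at most [M] coordinates die, stage [M.+1] is never
    switched off and is the full equation. *)
Definition stage_coef (i : nat) y (c : C) (s : R) (m : 'I_M) : R :=
  if (ndead y s < i)%N then b c s (alivev y s) (lmv y s) m else 0.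

Definition solves i y := [/\ cadlagv y, nonnegv y, sintv A (stage_coef i y) &
  forall t m, 0 <= t -> y t m = y0 m + SIv A (stage_coef i y) t m].

Section Frozen.
Variables (i : nat) (U : R -> 'I_M -> R).
Hypothesis solU : solves i U.

Let cU : cadlagv U. Proof. by case: solU. Qed.
Let U0 : nonnegv U. Proof. by case: solU. Qed.
Let iU : sintv A (stage_coef i U). Proof. by case: solU. Qed.
Let UE t m : 0 <= t -> U t m = y0 m + SIv A (stage_coef i U) t m.
Proof. by case: solU => _ _ _; exact. Qed.

Lemma stage_dead s u k : 0 < s -> ~~ alivev U s k -> s <= u -> U u k = 0.
Proof.
apply: (@dead_zero _ _ _ ndA cA (fun u => U u k) (y0 k) (fun c s => stage_coef i U c s k)) => //.
- by move=> v v0; exact: U0.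
- by move=> t t0; rewrite UE.
- move=> c v v0 dv; rewrite /stage_coef; case: ifP => // _.
  exact: deadb.
Qed.

Lemma frozen s u : 0 < s -> (i <= ndead U s)%N -> s <= u -> U u = U s.
Proof.
move=> s0 si su; apply/funext => k; rewrite !UE ?ltW//; last exact: lt_le_trans su.
congr (_ + _); apply: SI_const => //; first exact: ltW.
move=> c v sv vu; rewrite /stage_coef ltnNge (leq_trans si)//.
by apply: ndead_mono => //; exact: ltW.
Qed.

Lemma frozen_lm s : 0 < s -> (i <= ndead U s)%N -> lmv U s = U s.
Proof.
move=> s0 si; apply/funext => k; rewrite [RHS]UE ?ltW// /SIv SI_last//.
rewrite [X in _ + (_ + X)]big1 ?addr0; last first.
  by move=> c _; rewrite /stage_coef ltnNge si/= mul0r.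
have cs : cadlag (fun t => y0 k + SIv A (stage_coef i U) t k).
  by apply: cadlagD; [exact: cadlag_cst|exact: SI_cadlag].
rewrite /lmv (@eq_lm _ (fun t => y0 k + SIv A (stage_coef i U) t k) (fun u => U u k))//; last first.
  by move=> u u0 _; rewrite UE.
rewrite lmD//; [|exact: cadlag_cst|exact: SI_cadlag].
by congr (_ + _); apply: lm_unique => //; exact: cvg_cst.
Qed.

Lemma frozen_alive s u : 0 < s -> (i <= ndead U s)%N -> s <= u -> alivev U u = alivev U s.
Proof.
move=> s0 si su; apply/funext => k; apply/idP/idP; first exact: alivev_anti.
have u0 : 0 < u by exact: lt_le_trans su.
move=> ks; have ls := alive_lm (fun v => @U0 v k) (cU k) s0 ks.
have Us : 0 < U s k by rewrite -frozen_lm.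
move: ks => /(aliveP (fun v => @U0 v k) s0)[e e0 h].
apply/(aliveP (fun v => @U0 v k) u0); exists (Num.min e (U s k)); first by rewrite lt_min e0.
move=> v v0 vu; rewrite ge_min; have [vs|sv] := ltP v s; first by rewrite h.
by rewrite (frozen s0 si sv) lexx orbT.
Qed.

Lemma frozen_ndead s u : 0 < s -> (i <= ndead U s)%N -> s <= u -> ndead U u = ndead U s.
Proof. by move=> s0 si su; rewrite /ndead (frozen_alive s0 si su). Qed.

(** The living set is that of the known path [U], not that of the unknown [z]: this, together with
    the clamp, makes the coefficient bounded and Lipschitz on all of space. It acts only while [U]
    is frozen with exactly [i] deaths. *)
Definition beta (j : nat) (c : C) (s : R) (z : 'I_M -> R) (m : 'I_M) : R :=
  if ndead U s == i then b c s (alivev U s) (clampv j (alivev U s) z) m else 0.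

Lemma beta_lipschitz j : lipschitz_coef (beta j).
Proof.
move=> T T0; have [K K0 hK] := lipb j T0; exists K => // c m s s0 sT.
split=> [z|z z']; rewrite /beta; case: ifP => _; rewrite ?subrr ?normr0 ?mulr_ge0 ?vnorm_ge0//.
  by have [] := hK c m s _ _ _ s0 sT (clampv_inbox j (alivev U s) z) (clampv_inbox j (alivev U s) z).
have [_ h] := hK c m s _ _ _ s0 sT (clampv_inbox j (alivev U s) z) (clampv_inbox j (alivev U s) z').
by apply: (le_trans h); rewrite ler_wpM2l// clampv_lip.
Qed.

Hypothesis mbeta : forall j, measurable_coef (beta j).

Variable Zj : nat -> R -> 'I_M -> R.
Hypothesis Zj_cadlag : forall j, cadlagv (Zj j).

Definition zcoef j (c : C) (s : R) : 'I_M -> R := beta j c s (lmv (Zj j) s).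

Lemma zcoef_sint j : sintv A (zcoef j).
Proof.
exact: (sintv_coef ndA cA (@beta_lipschitz j) (mbeta j) (Zj_cadlag j)).
Qed.

Hypothesis Zj_eq : forall j t m, 0 <= t -> Zj j t m = U t m + SIv A (zcoef j) t m.

(** The bounds concern the strict past of [s], which makes the flag predictable, and they start at
    time 0, which makes it hereditary towards the past as long as [ndead U] is [i]. While it is up
    the clamp is inactive. *)
Definition chi (j : nat) (s : R) : bool := `[< ndead U s = i /\
  forall u k, 0 <= u -> u < s -> alivev U s k -> j.+1%:R^-1 <= Zj j u k <= j.+1%:R >].

Lemma chi_down j s u : chi j s -> 0 < u -> u <= s -> ndead U u = i -> chi j u.
Proof.
move=> /asboolP[si h] u0 us ui; apply/asboolP; split=> // v k v0 vu ka.
by apply: h => //; [exact: lt_le_trans us|rewrite (frozen_alive u0)// ui].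
Qed.

Lemma beta_dead j c v s z k : 0 < v -> v <= s -> ndead U s = i -> ~~ alivev U s k ->
  beta j c v z k = 0.
Proof.
move=> v0 vs si ks; rewrite /beta; case: eqP => // vi.
by apply: deadb => //; rewrite -(frozen_alive v0 _ vs)// vi.
Qed.

Lemma Zj_dead j s t k : 0 <= t -> t <= s -> ndead U s = i -> ~~ alivev U s k ->
  Zj j t k = U t k.
Proof.
move=> t0 ts si ks; rewrite Zj_eq// /SIv (@eq_SI _ _ A _ (fun _ _ => 0)).
  rewrite /SI big1 ?addr0// => c _; rewrite Rintegral_cst// mul0r//.
by move=> c v v0 vt; apply: (@beta_dead _ _ _ s) => //; exact: le_trans ts.
Qed.

Lemma Zj_lm_dead j s k : 0 < s -> ndead U s = i -> ~~ alivev U s k -> lmv (Zj j) s k = 0.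
Proof.
move=> s0 si ks; rewrite /lmv (@eq_lm _ (fun u => U u k))//.
  by rewrite -/(lmv U s k) frozen_lm ?si// (stage_dead s0 ks (lexx _)).
by move=> u u0 us; rewrite (@Zj_dead j s u k)// ltW.
Qed.

Lemma inbox_lm j y s : cadlagv y -> 0 < s ->
  (forall u k, 0 <= u -> u < s -> alivev U s k -> j.+1%:R^-1 <= y u k <= j.+1%:R) ->
  (forall k, ~~ alivev U s k -> lmv y s k = 0) -> inbox j (alivev U s) (lmv y s).
Proof.
move=> cy s0 h h0 k; case: ifPn => ks; last by rewrite h0.
apply/andP; split.
  by apply: (ge_lm_cst (cy k) s0 (lexx 0)) => u u0 us; case/andP: (h u k u0 us ks).
by apply: (le_lm_cst (cy k) s0 (lexx 0)) => u u0 us; case/andP: (h u k u0 us ks).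
Qed.

Lemma chi_inbox j s : 0 < s -> chi j s -> inbox j (alivev U s) (lmv (Zj j) s).
Proof.
move=> s0 /asboolP[si h]; apply: inbox_lm => //.
by move=> k ks; exact: Zj_lm_dead.
Qed.

(** While the flag [j] is up, [Zj j] stays in the smaller box, where both clamps are the identity;
    so it also solves the equation of level [j'], and Gronwall identifies the two. *)
Lemma chi_mono j j' s : (j <= j')%N -> 0 < s -> chi j s ->
  (forall u, 0 <= u -> u < s -> Zj j' u = Zj j u) /\ chi j' s.
Proof.
move=> jj s0 cs; have [K K0 hK] := @beta_lipschitz j' s (ltW s0).
have ZZ : forall u, 0 <= u -> u < s -> Zj j' u = Zj j u.
  apply: (gronwall ndA cA K0 (Zj_cadlag j') (Zj_cadlag j) (@zcoef_sint j') (@zcoef_sint j)).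
    by move=> t t0 ts m; rewrite (Zj_eq j')// (Zj_eq j)// subDD.
  move=> c m u u0 us.
  have -> : zcoef j c u m = beta j' c u (lmv (Zj j) u) m.
    rewrite /zcoef /beta; case: eqP => // ui.
    have cu := chi_down cs u0 (ltW us) ui; have bu := chi_inbox u0 cu.
    by rewrite (clampv_id bu) (clampv_id (inbox_mono jj bu)).
  exact: (hK c m u u0 (ltW us)).2.
split=> //; move: cs => /asboolP[si h]; apply/asboolP; split=> // u k u0 us ks.
rewrite ZZ//; case/andP: (h u k u0 us ks) => h1 h2; apply/andP; split.
  by apply: le_trans h1; rewrite lef_pV2 ?posrE// ler_nat ltnS.
by apply: (le_trans h2); rewrite ler_nat ltnS.
Qed.

Definition hj j (c : C) (s : R) (m : 'I_M) : R := if chi j s then zcoef j c s m else 0.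
(** At each positive time the sequence is eventually constant: it settles at the value given by any
    raised flag, or at 0 if there is none. As a pointwise limit it inherits measurability. *)
Definition hlim (c : C) (s : R) (m : 'I_M) : R := lim (hj j c s m @[j --> \oo]).

Lemma hj_chi j j' c s m : 0 < s -> chi j s -> (j <= j')%N -> hj j' c s m = zcoef j c s m.
Proof.
move=> s0 cs jj; have [ZZ cs'] := chi_mono jj s0 cs; rewrite /hj cs' /zcoef.
have -> : lmv (Zj j') s = lmv (Zj j) s.
  by apply: eq_lmv => // u u0 us; rewrite ZZ.
have bs := chi_inbox s0 cs; rewrite /beta; case: eqP => // _.
by rewrite (clampv_id bs) (clampv_id (inbox_mono jj bs)).
Qed.

Lemma hj_cvg_chi j c s m : 0 < s -> chi j s -> hj j' c s m @[j' --> \oo] --> zcoef j c s m.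
Proof.
move=> s0 cs; apply: cvg_near_cst; near=> j'.
by apply: hj_chi => //; near: j'; exact: nbhs_infty_ge.
Unshelve. all: by end_near. Qed.

Lemma hlim_chi j c s m : 0 < s -> chi j s -> hlim c s m = zcoef j c s m.
Proof. by move=> s0 cs; apply/cvg_lim => //; exact: hj_cvg_chi. Qed.

Lemma hlim_nchi c s m : (forall j, ~~ chi j s) -> hlim c s m = 0.
Proof.
move=> nc; apply/cvg_lim => //; apply: cvg_near_cst; near=> j.
by rewrite /hj (negbTE (nc j)).
Unshelve. all: by end_near. Qed.

Lemma hj_cvg c s m : 0 < s -> hj j c s m @[j --> \oo] --> hlim c s m.
Proof.
move=> s0; have [[j cj]|nc] := pselect (exists j, chi j s).
  by rewrite (hlim_chi _ _ s0 cj); exact: hj_cvg_chi.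
have {}nc j : ~~ chi j s by apply/negP => cj; apply: nc; exists j.
rewrite hlim_nchi//; apply: cvg_near_cst; near=> j.
by rewrite /hj (negbTE (nc j)).
Unshelve. all: by end_near. Qed.

Hypothesis mhj : forall j c m, measurable_fun pos0 (fun s : mR => hj j c s m).

Lemma hj_sint j : sintv A (hj j).
Proof.
move=> m; apply: bounded_sint => // t t0.
have [K K0 hK] := @beta_lipschitz j t t0; exists K => c s s0 st.
rewrite /hj; case: ifP => _; last by rewrite normr0.
exact: (hK c m s s0 st).1.
Qed.

Lemma mhlim c m : measurable_fun pos0 (fun s : mR => hlim c s m).
Proof.
apply: (@measurable_fun_cvg _ mR R pos0 (fun j s => hj j c s m)) => [j|s].
  exact: mhj.
by rewrite /pos0/= in_itv/= andbT => s0; exact: hj_cvg.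
Qed.

(* Up to the last time at which the flag X is up, U + SI g coincides with one of the Z^j,
   which is nonnegative there by the budget constraint. *)
Lemma flag_nonneg (X : R -> bool) (g : C -> mR -> 'I_M -> R) : sintv A g ->
  (forall c s m, 0 < s -> ~~ X s -> g c s m = 0) ->
  (forall s, 0 < s -> X s -> exists2 j, chi j s &
     forall c u m, 0 < u -> u <= s -> g c u m = zcoef j c u m) ->
  forall t, 0 <= t -> forall m, 0 <= U t m + SIv A g t m.
Proof.
move=> ig gX Xg.
have XU s : 0 < s -> X s -> ndead U s = i.
  by move=> s0 /(Xg s s0)[j /asboolP[]].
have Xpos s : 0 < s -> X s -> forall u m, 0 <= u -> u <= s -> 0 <= U u m + SIv A g u m.
  move=> s0 Xs u m u0 us; have [j cj gz] := Xg s s0 Xs; have si := XU s s0 Xs.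
  have -> : U u m + SIv A g u m = Zj j u m.
    rewrite Zj_eq//; congr (_ + _); apply: eq_SI => c v v0 vu.
    by apply: gz => //; exact: le_trans us.
  have [ks|ks] := boolP (alivev U s m); last by rewrite (@Zj_dead j s u m)// U0.
  (* Before [s] the box keeps the coordinate positive. At [s] itself a jump may leave the box, and
     only the budget constraint controls it. *)
  move: us; rewrite le_eqVlt => /orP[/eqP us|us]; last first.
    by move: cj => /asboolP[_ /(_ u m u0 us ks)/andP[h _]]; apply: le_trans h; rewrite invr_ge0.
  rewrite us Zj_eq; last exact: ltW.
  rewrite /SIv SI_last//; last exact: (@zcoef_sint j m).
  have cs : cadlag (fun t => U t m + SIv A (zcoef j) t m).
    by apply: cadlagD => //; apply: SI_cadlag => //; exact: (@zcoef_sint j m).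
  have E : lmv (Zj j) s m = U s m + lm (SI A (fun c s => zcoef j c s m)) s.
    rewrite /lmv (@eq_lm _ (fun t => U t m + SIv A (zcoef j) t m) (fun u => Zj j u m))//; last first.
      by move=> v v0 _; rewrite Zj_eq.
    rewrite lmD//; last by apply: SI_cadlag => //; exact: (@zcoef_sint j m).
    by rewrite -[lm _ s]/(lmv U s m) frozen_lm// si.
  rewrite addrA -E; have bs := chi_inbox s0 cj.
  have -> : \sum_c zcoef j c s m * jump (A c) s =
      \sum_c b c s (alivev U s) (lmv (Zj j) s) m * jump (A c) s.
    by apply: eq_bigr => c _; rewrite /zcoef /beta si eqxx (clampv_id bs).
  by apply: budb => //; exact: inbox_ge0 bs.
(* The count of deaths of [U] stays at [i] once it is there. If it differs from [i] at [t], it was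
   never [i] before, and nothing has been added to [U]; this includes the case of several
   simultaneous deaths. *)
have nth t : 0 < t -> ndead U t != i -> forall u m, 0 <= u -> u <= t -> U u m + SIv A g u m = U u m.
  move=> t0 ti u m u0 ut; rewrite /SIv (@eq_SI _ _ A _ (fun _ _ => 0)).
    by rewrite /SI big1 ?addr0// => c _; rewrite Rintegral_cst// mul0r.
  move=> c v v0 vu; apply: gX => //; apply: contra ti => /(XU v v0) vi.
  by rewrite (@frozen_ndead v t) ?vi//; exact: le_trans ut.
apply: real_ind => t.
  rewrite le_eqVlt => /orP[/eqP <- _ m|t0 ih m]; first by rewrite /SIv SI0 addr0 U0.
  have [ti|ti] := eqVneq (ndead U t) i; last by rewrite (nth t)// ?U0 ?ltW.
  have [Xt|Xt] := boolP (X t); first by apply: (Xpos t) => //; exact: ltW.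
  rewrite /SIv SI_last// big1 ?addr0; last by move=> c _; rewrite gX// mul0r.
  have cs : cadlag (fun t => U t m + SIv A g t m) by apply: cadlagD => //; exact: SI_cadlag.
  have := ge_lm_cst cs t0 (lexx 0) (fun u u0 ut => ih u u0 ut m).
  rewrite lmD//; last exact: SI_cadlag.
  by rewrite -[lm _ t]/(lmv U t m) frozen_lm// ti.
(* Either the flag is up at some later [v], which settles all times up to [v], or it is down for
   good and the added integral stays constant. *)
move=> t0 ih; have [[v tv Xv]|nX] := pselect (exists2 v, t < v & X v).
  exists (v - t) => [|u tu]; first by rewrite subr_gt0.
  rewrite addrC subrK => uv m; apply: (Xpos v) => //; first exact: le_lt_trans tv.
  by apply: (le_trans t0); exact: ltW.
exists 1 => // u tu _ m.
have E : SIv A g u m = SIv A g t m.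
  apply: SI_const => //; first exact: ltW.
  move=> c v tv _; apply: gX; first exact: le_lt_trans tv.
  by apply/negP => Xv; apply: nX; exists v.
have [[tp ti]|nt] := pselect (0 < t /\ ndead U t = i).
  by rewrite E (@frozen t u) ?ti//; [exact: ih|exact: ltW].
have -> : SIv A g u m = 0; last by rewrite addr0 U0// (le_trans t0)// ltW.
rewrite E; have [t00|tp] := eqVneq t 0; first by rewrite t00 /SIv SI0.
have {}tp : 0 < t by rewrite lt_neqAle eq_sym tp.
have ti : ndead U t != i by apply/eqP => ti; apply: nt.
by have := nth t tp ti t m t0 (lexx _); lra.
Qed.

Lemma hj_nonneg j t m : 0 <= t -> 0 <= U t m + SIv A (hj j) t m.
Proof.
move=> t0; apply: (@flag_nonneg (chi j)) => // [|c s k s0 cs|s s0 cs].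
- exact: hj_sint.
- by rewrite /hj (negbTE cs).
- exists j => // c u k u0 us; rewrite /hj; case: ifPn => // cu.
  rewrite /zcoef /beta; case: eqP => // ui.
  by rewrite (chi_down cs) in cu.
Qed.

Lemma zcoef_signed j s m : 0 < s -> zcoef j None s m <= 0 /\ forall n, `|zcoef j (Some n) s m| <= 1.
Proof.
move=> s0; rewrite /zcoef /beta; case: eqP => _; last by split=> // n; rewrite normr0.
by apply: signb => //; exact: inbox_ge0 (clampv_inbox _ _ _).
Qed.

Lemma hlim_signed s m : 0 < s -> hlim None s m <= 0 /\ forall n, `|hlim (Some n) s m| <= 1.
Proof.
move=> s0; have [[j cj]|nc] := pselect (exists j, chi j s).
  rewrite (hlim_chi _ _ s0 cj); split; first exact: (zcoef_signed j m s0).1.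
  by move=> n; rewrite (hlim_chi _ _ s0 cj); exact: (zcoef_signed j m s0).2.
have {}nc j : ~~ chi j s by apply/negP => cj; apply: nc; exists j.
by rewrite hlim_nchi//; split=> // n; rewrite hlim_nchi// normr0.
Qed.

(** Rearranged nonnegativity, with the shares bounded by 1. The right-hand side does not depend on
    [j]. *)
Lemma hj_bound j t m : 0 <= t ->
  - (\int[LSm (A None)]_(s in oc0 t) hj j None s m) <=
    U t m + \sum_(n < N) (A (Some n) t - A (Some n) 0).
Proof.
move=> t0; have := @hj_nonneg j t m t0; rewrite /SIv /SI.
rewrite (bigD1 None)//= => h; apply: (oppr_le_add h).
rewrite (reindex_omap Some id) => [|[n|]//]; rewrite (eq_bigl predT); last first.
  by move=> n; rewrite /= eqxx.
apply: ler_sum => n _.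
have ih := @hj_sint j m (Some n).
have -> : A (Some n) t - A (Some n) 0 = 1 * fine (LSm (A (Some n)) (oc0 t)).
  by rewrite mul1r LSm_oc0.
rewrite -Rintegral_cst//; have ih1 : (LSm (A (Some n))).-integrable (oc0 t) (EFin \o (fun=> 1 : R)).
  exact: (@sint_cst _ _ A ndA cA 1 (Some n) t).
apply: (le_Rintegral (measurable_oc0 t) (ih t) ih1) => s st.
have s0 : 0 < s by have := oc0_pos0 st; rewrite /pos0/= in_itv/= andbT.
rewrite /hj; case: ifP => _ //.
by apply: le_trans (ler_norm _) _; exact: (zcoef_signed j m s0).2.
Qed.

(** The shares are bounded by 1. The investment has no bound that is uniform over the boxes, but
    [- hj j None] increases with [j], so monotone convergence and [hj_bound] apply. *)
Lemma hlim_sint : sintv A hlim.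
Proof.
move=> m [n|].
  apply: le_locint (@sint_cst _ _ A ndA cA 1 (Some n)) _; first exact: mhlim.
  by move=> s s0; exact: (hlim_signed m s0).2.
move=> t; have [t0|t0] := leP 0 t; last first.
  by rewrite /oc0 set_itv_ge ?bnd_simp -?leNgt ?ltW//; exact: integrable_set0.
have mo f : measurable_fun pos0 f -> measurable_fun (oc0 t) (fun s : mR => (f s : R)%:E).
  by move=> mf; apply/measurable_EFinP; apply: measurable_funS mf => //; exact: oc0_pos0.
have oE s : oc0 t s -> 0 < s by move=> /oc0_pos0; rewrite /pos0/= in_itv/= andbT.
apply/integrableP; split; first exact: mo (mhlim None m).
pose B := U t m + \sum_(n < N) (A (Some n) t - A (Some n) 0).
apply: (@le_lt_trans _ _ B%:E); last by rewrite ltry.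
have ih j : (LSm (A None)).-integrable (oc0 t) (EFin \o (fun s => hj j None s m)).
  exact: (@hj_sint j m None t).
have hjn j s : 0 < s -> hj j None s m <= 0.
  by move=> s0; rewrite /hj; case: ifP => _ //; exact: (zcoef_signed j m s0).1.
have -> : (\int[LSm (A None)]_(x in oc0 t) `|(EFin \o hlim None ^~ m) x| =
    limn (fun j => \int[LSm (A None)]_(x in oc0 t) (- hj j None x m)%:E))%E.
  rewrite -monotone_convergence//.
  - apply: eq_integral => s /set_mem/oE s0; apply/esym/cvg_lim => //.
    apply: cvg_EFin; first exact: nearW.
    rewrite ler0_norm; last exact: (hlim_signed m s0).1.
    by apply: cvgN; exact: hj_cvg.
  - by move=> j; apply: mo; apply: measurableT_comp => //; exact: mhj.
  - by move=> j s /oE s0; rewrite lee_fin oppr_ge0 hjn.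
  - move=> s /oE s0 j j' jj; rewrite lee_fin lerN2.
    have [cj|cj] := boolP (chi j s); first by rewrite (hj_chi _ _ s0 cj jj) (hj_chi _ _ s0 cj (leqnn _)).
    by rewrite [leRHS]/hj (negbTE cj) hjn.
apply: lime_le.
  apply: ereal_nondecreasing_is_cvgn => j j' jj; apply: ge0_le_integral => //.
  - by move=> s /oE s0; rewrite lee_fin oppr_ge0 hjn.
  - by apply: mo; apply: measurableT_comp => //; exact: mhj.
  - by apply: mo; apply: measurableT_comp => //; exact: mhj.
  - move=> s /oE s0; rewrite lee_fin lerN2.
    have [cj|cj] := boolP (chi j s); first by rewrite (hj_chi _ _ s0 cj jj) (hj_chi _ _ s0 cj (leqnn _)).
    by rewrite [leRHS]/hj (negbTE cj) hjn.
near=> j.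
have fi : (\int[LSm (A None)]_(x in oc0 t) (- hj j None x m)%:E)%E \is a fin_num.
  have i2 : (LSm (A None)).-integrable (oc0 t) (fun x => (- hj j None x m)%:E).
    exact: (@locintN _ _ (fun x => hj j None x m) (@hj_sint j m None) t).
  exact: integrable_fin_num.
rewrite -(fineK fi) lee_fin.
rewrite -[X in X <= _]/(\int[LSm (A None)]_(x in oc0 t) (- hj j None x m)).
under eq_Rintegral do rewrite -mulN1r.
by rewrite RintegralZl// mulN1r; exact: hj_bound.
Unshelve. all: by end_near. Qed.

Definition Ynext (t : R) (m : 'I_M) : R := U t m + SIv A hlim t m.

Lemma Ynext_cadlag : cadlagv Ynext.
Proof. by move=> k; apply: cadlagD => //; apply: SI_cadlag => //; exact: hlim_sint. Qed.

Lemma hlim_zcoef j s c u m : chi j s -> 0 < u -> u <= s -> hlim c u m = zcoef j c u m.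
Proof.
move=> cj u0 us; have [ui|ui] := eqVneq (ndead U u) i.
  by rewrite (@hlim_chi j)//; exact: chi_down cj u0 us ui.
rewrite hlim_nchi => [|j']; first by rewrite /zcoef /beta (negbTE ui).
by apply/negP => /asboolP[h _]; rewrite h eqxx in ui.
Qed.

Lemma Ynext_nonneg : nonnegv Ynext.
Proof.
move=> t m t0; apply: (@flag_nonneg (fun s => `[< exists j, chi j s >])) => //.
- exact: hlim_sint.
- move=> c s k s0 /asboolP nc; apply: hlim_nchi => j.
  by apply/negP => cj; apply: nc; exists j.
- move=> s s0 /asboolP[j cj]; exists j => // c u k u0 us.
  exact: hlim_zcoef us.
Qed.

Lemma hlim_nth t c s m : 0 < t -> ndead U t != i -> 0 < s -> s <= t -> hlim c s m = 0.
Proof.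
move=> t0 ti s0 st; apply: hlim_nchi => j; apply: contra ti => /asboolP[si _].
by rewrite (@frozen_ndead s t) ?si.
Qed.

Lemma Ynext_nth t u : 0 < t -> ndead U t != i -> 0 <= u -> u <= t -> Ynext u = U u.
Proof.
move=> t0 ti u0 ut; apply/funext => m; rewrite /Ynext /SIv (@eq_SI _ _ A _ (fun _ _ => 0)).
  by rewrite /SI big1 ?addr0// => c _; rewrite Rintegral_cst// mul0r.
by move=> c v v0 vu; apply: (@hlim_nth t) => //; exact: le_trans ut.
Qed.

Lemma Ynext_Zj j s u : chi j s -> 0 <= u -> u <= s -> Ynext u = Zj j u.
Proof.
move=> cj u0 us; apply/funext => m; rewrite Zj_eq//; congr (_ + _).
by apply: eq_SI => c v v0 vu; apply: (@hlim_zcoef j s) => //; exact: le_trans us.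
Qed.

Lemma Ynext_dead s u k : ndead U s = i -> ~~ alivev U s k -> 0 <= u -> u <= s ->
  Ynext u k = U u k.
Proof.
move=> si ks u0 us; rewrite /Ynext /SIv (@eq_SI _ _ A _ (fun _ _ => 0)).
  by rewrite /SI big1 ?addr0// => c _; rewrite Rintegral_cst// mul0r.
move=> c v v0 vu; have vs := le_trans vu us.
have [[j cj]|nc] := pselect (exists j, chi j v).
  by rewrite (@hlim_chi j)// /zcoef (@beta_dead j c v s).
by rewrite hlim_nchi// => j; apply/negP => cj; apply: nc; exists j.
Qed.

Lemma Ynext_alive_dead s k : 0 < s -> ndead U s = i -> ~~ alivev U s k -> ~~ alivev Ynext s k.
Proof.
move=> s0 si ks; rewrite /alivev /alive; suff -> :
  [set Ynext u k | u in `[0, s[] = [set U u k | u in `[0, s[] by [].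
by apply/seteqP; split => _ [u /= + <-]; rewrite in_itv/= => /andP[u0 us];
  exists u; rewrite /= ?in_itv/= ?u0 ?(@Ynext_dead s)// ltW.
Qed.

(* While Y stays in the j-th box, so does Z^j: the flags chi cannot all drop before a
   coordinate of Y dies. *)
Lemma chi_exists s j : 0 < s -> ndead U s = i ->
  (forall u k, 0 <= u -> u < s -> alivev U s k -> j.+1%:R^-1 <= Ynext u k <= j.+1%:R) ->
  exists j', chi j' s.
Proof.
move=> s0 si box.
(* If flags exist at all relevant times before [t], then [Ynext] solves there the equation of every
   level [j1 >= j], because its own values lie in box [j]. *)
have agree j1 t : (j <= j1)%N -> t <= s ->
    (forall u, 0 < u -> u < t -> ndead U u = i -> exists j', chi j' u) ->
    (forall c u m, 0 < u -> u < t -> hlim c u m = beta j1 c u (lmv Ynext u) m) /\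
    (forall u, 0 <= u -> u < t -> Ynext u = Zj j1 u).
  move=> jj ts E.
  have h1 c u m : 0 < u -> u < t -> hlim c u m = beta j1 c u (lmv Ynext u) m.
    move=> u0 ut; have [ui|ui] := eqVneq (ndead U u) i; last first.
      rewrite /beta (negbTE ui) hlim_nchi// => j'.
      by apply/negP => /asboolP[h _]; rewrite h eqxx in ui.
    have [j' cj] := E u u0 ut ui; rewrite (hlim_chi _ _ u0 cj) /zcoef.
    have -> : lmv (Zj j') u = lmv Ynext u.
      apply: eq_lmv => //; first exact: Ynext_cadlag.
      by move=> v v0 vu; rewrite (@Ynext_Zj j' u)// ltW.
    have bY : inbox j (alivev U u) (lmv Ynext u).
      apply: inbox_lm => //; first exact: Ynext_cadlag.
        move=> v k v0 vu kv; apply: box => //.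
          by apply: lt_le_trans vu _; apply: le_trans (ltW ut) ts.
        by rewrite (frozen_alive u0) ?ui//; apply: le_trans (ltW ut) ts.
      move=> k ku; rewrite -(@Zj_lm_dead j' u k)//; congr (_ k); apply/esym/eq_lmv => //.
        exact: Ynext_cadlag.
      by move=> v v0 vu; rewrite (@Ynext_Zj j' u)// ltW.
    have bZ := chi_inbox u0 cj; have e1 : lmv (Zj j') u = lmv Ynext u.
      apply: eq_lmv => //; first exact: Ynext_cadlag.
      by move=> v v0 vu; rewrite (@Ynext_Zj j' u)// ltW.
    rewrite e1 in bZ; rewrite /beta ui eqxx (clampv_id bZ).
    by rewrite (clampv_id (inbox_mono jj bY)).
  split=> //.
  have [t0|t0] := leP 0 t; last first.
    by move=> u u0 /lt_trans/(_ t0); rewrite ltNge u0.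
  have [K K0 hK] := @beta_lipschitz j1 t t0.
  apply: (gronwall ndA cA K0 Ynext_cadlag (Zj_cadlag j1) hlim_sint (@zcoef_sint j1)).
    by move=> u u0 ut m; rewrite Zj_eq// /Ynext subDD.
  by move=> c m u u0 ut; rewrite h1//; exact: (hK c m u u0 (ltW ut)).2.
suff main : forall u, 0 <= u -> 0 < u -> u <= s -> ndead U u = i -> exists j', chi j' u.
  by apply: main => //; exact: ltW.
apply: real_ind => [u _ ih u0 us ui|t t0 ih].
  have [|_ YZ] := @agree j u (leqnn _) us.
    by move=> v v0 vu; apply: ih => //; [exact: ltW|apply: le_trans (ltW vu) us].
  exists j; apply/asboolP; split=> // v k v0 vu kv; rewrite -YZ//.
  apply: box => //; first exact: lt_le_trans us.
  by rewrite (frozen_alive u0) ?ui.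
have [st|ts] := leP s t.
  by exists 1 => // u tu _ u0 us; have := lt_le_trans tu us; rewrite ltNge st.
have E u : 0 < u -> u < t -> ndead U u = i -> exists j', chi j' u.
  by move=> u0 ut; apply: ih => //; [exact: ltW|exact: ltW|apply: le_trans (ltW ut) (ltW ts)].
(* Box [j.+1] instead of [j] leaves room: at [t] the path is in the closed box [j], and
   right-continuity keeps it in the larger one for a while. *)
have [h1 YZ] := @agree j.+1 t (leqnSn _) (ltW ts) E.
have YZt : Ynext t = Zj j.+1 t.
  have [t00|tn0] := eqVneq t 0.
    by apply/funext => m; rewrite t00 Zj_eq// /Ynext /SIv !SI0.
  have tp : 0 < t by rewrite lt_neqAle eq_sym tn0.
  have lE : lmv (Zj j.+1) t = lmv Ynext t.
    by apply: eq_lmv => //; exact: Ynext_cadlag.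
  have [ti|ti] := eqVneq (ndead U t) i; last first.
    rewrite (Ynext_nth tp ti)//; apply/funext => m; rewrite Zj_eq// /SIv.
    rewrite (@eq_SI _ _ A _ (fun _ _ => 0)).
      by rewrite /SI big1 ?addr0// => c _; rewrite Rintegral_cst// mul0r.
    move=> c v v0 vt; rewrite /zcoef /beta; case: eqP => // vi.
    by rewrite (@frozen_ndead v t) ?vi ?eqxx// in ti.
  have [j' cj] := ih t t0 (lexx _) tp (ltW ts) ti.
  apply/funext => m; rewrite Zj_eq// /Ynext; congr (_ + _); apply: eq_SI => c v v0.
  rewrite le_eqVlt => /orP[/eqP ->|vt]; last first.
    rewrite h1// /zcoef; congr (beta _ _ _ _ _); apply/esym; apply: eq_lmv => //.
      exact: Ynext_cadlag.
    by move=> w w0 wv; rewrite YZ//; exact: lt_trans vt.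
  rewrite (hlim_chi _ _ tp cj) /zcoef lE.
  have e1 : lmv (Zj j') t = lmv Ynext t.
    apply: eq_lmv => //; first exact: Ynext_cadlag.
    by move=> v' v0' vt; rewrite (@Ynext_Zj j' t)// ltW.
  have bZ := chi_inbox tp cj; rewrite e1 in bZ.
  have bY : inbox j.+1 (alivev U t) (lmv Ynext t).
    apply: (@inbox_mono _ _ j) => //; apply: inbox_lm => //; first exact: Ynext_cadlag.
      move=> w k w0 wt kw; apply: box => //; first exact: lt_trans ts.
      by rewrite (frozen_alive tp) ?ti// ltW.
    by move=> k kt; rewrite -e1; exact: Zj_lm_dead.
  by rewrite e1 /beta ti eqxx (clampv_id bZ) (clampv_id bY).
have /choice[h hP] : forall k, exists h, 0 < h /\ (alivev U s k -> forall u, t < u -> u < t + h ->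
    j.+2%:R^-1 <= Zj j.+1 u k <= j.+2%:R).
  move=> k; have [ks|ks] := boolP (alivev U s k); last by exists 1.
  have /andP[b1 b2] := box t k t0 ts ks.
  (* The gap between the two boxes: [1/(j+1) - 1/(j+2)] at the lower end and 1 at the upper end. *)
  have e0 : 0 < Num.min (j.+1%:R^-1 - j.+2%:R^-1) 1 :> R.
    by rewrite lt_min ltr01 andbT subr_gt0 ltf_pV2 ?posrE// ltr_nat.
  have /cvg_right_epsP/(_ _ e0)[del del0 hd] := (Zj_cadlag j.+1 k).1 t t0.
  exists del; split=> // _ u tu ud; have := hd u tu ud.
  rewrite -YZt ltr_distlC => /andP[h2 h3].
  have m1 : Num.min (j.+1%:R^-1 - j.+2%:R^-1) 1 <= j.+1%:R^-1 - j.+2%:R^-1 :> R by rewrite ge_min lexx.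
  have m2 : Num.min (j.+1%:R^-1 - j.+2%:R^-1) 1 <= 1 :> R by rewrite ge_min lexx orbT.
  have e2 : j.+2%:R = j.+1%:R + 1 :> R by rewrite natr1.
  apply/andP; split.
    by move: (le_lt_trans (lerB b1 m1) h2); rewrite opprB addrC subrK => /ltW.
  by rewrite e2; apply: ltW; apply: (lt_le_trans h3); exact: lerD.
have [hmin hmin0 hle] : exists2 hm, 0 < hm & forall k, hm <= h k.
  exists (\big[Num.min/1]_k h k).
    by elim/big_ind : _ => // [x y x0 y0'|k _]; [rewrite lt_min x0|case: (hP k)].
  by move=> k; exact: bigmin_le_cond.
exists (hmin / 2) => [|u tu uh u0 us ui]; first by rewrite divr_gt0.
exists j.+1; apply/asboolP; split=> // v k v0 vu kv.
have ks : alivev U s k by rewrite (frozen_alive u0) ?ui.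
have [tv|vt] := ltP t v.
  by apply: (hP k).2 => //; apply: (lt_trans vu); have := hle k; lra.
have -> : Zj j.+1 v = Ynext v.
  by move: vt; rewrite le_eqVlt => /orP[/eqP ->//|vt]; rewrite YZ.
have /andP[b1 b2] := box v k v0 (le_lt_trans vt ts) ks; apply/andP; split.
  by apply: le_trans b1; rewrite lef_pV2 ?posrE// ler_nat.
by apply: (le_trans b2); rewrite ler_nat.
Qed.

(** If [U] does not have [i] deaths at [s], then [Ynext] is still [U]. If a flag is up, [U] is
    frozen and [hlim] is the true coefficient. If no flag is up, both sides are 0: with only [i]
    deaths in [Ynext] its living coordinates would be bounded above and away from 0, and
    [chi_exists] would raise a flag. *)
Lemma Ynext_coef c s m : 0 < s ->
  stage_coef i.+1 Ynext c s m = stage_coef i U c s m + hlim c s m.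
Proof.
move=> s0; have cY := Ynext_cadlag; have Y0 := Ynext_nonneg.
have [si|si] := eqVneq (ndead U s) i; last first.
  have YU u : 0 <= u -> u < s -> U u = Ynext u.
    by move=> u0 us; rewrite (Ynext_nth s0 si)// ltW.
  have aE := eq_alivev s0 YU.
  have lE : lmv Ynext s = lmv U s by apply: eq_lmv.
  rewrite (@hlim_nth s)// addr0 /stage_coef /ndead -aE lE -/(ndead U s) ltnS leq_eqVlt.
  by rewrite (negbTE si).
rewrite [stage_coef i U c s m]/stage_coef si ltnn add0r.
have deadE k : ~~ alivev U s k -> ~~ alivev Ynext s k by exact: Ynext_alive_dead.
have [[j cj]|nc] := pselect (exists j, chi j s).
  have YZ u : 0 <= u -> u < s -> Zj j u = Ynext u.
    by move=> u0 us; rewrite (@Ynext_Zj j s)// ltW.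
  have lE : lmv Ynext s = lmv (Zj j) s by exact: eq_lmv.
  have aE : alivev Ynext s = alivev U s.
    apply/funext => k; apply/idP/idP => [|ks]; first by apply: contraTT; exact: deadE.
    apply/(aliveP (fun v => @Y0 v k) s0); exists (j.+1%:R^-1); first by rewrite invr_gt0.
    move=> u u0 us; rewrite -YZ//; move: cj => /asboolP[_ h].
    by case/andP: (h u k u0 us ks).
  rewrite (hlim_chi _ _ s0 cj) /stage_coef /ndead aE -/(ndead U s) si ltnS leqnn lE.
  by rewrite /zcoef /beta si eqxx clampv_id//; exact: chi_inbox.
have {}nc j : ~~ chi j s by apply/negP => cj; apply: nc; exists j.
rewrite hlim_nchi// /stage_coef; case: ifP => //; rewrite ltnS => Yi; exfalso.
have aE k : alivev U s k -> alivev Ynext s k.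
  move=> kU; apply: contraT => kY; have : (ndead U s < ndead Ynext s)%N.
    apply: proper_card; apply/properP; split.
      by apply/fintype.subsetP => k'; rewrite !inE; exact: deadE.
    by exists k; rewrite !inE ?negbK.
  by rewrite si ltnNge Yi.
have [B B0 hB] := cadlagv_bounded cY (ltW s0).
have /choice[e he] : forall k, exists e, 0 < e /\ (alivev U s k ->
    forall u, 0 <= u -> u < s -> e <= Ynext u k).
  move=> k; have [ks|ks] := boolP (alivev U s k); last by exists 1.
  have /(aliveP (fun v => @Y0 v k) s0)[e e0 h] := aE k ks.
  by exists e.
have [emin emin0 hle] : exists2 em, 0 < em & forall k, em <= e k.
  exists (\big[Num.min/1]_k e k).
    by elim/big_ind : _ => // [x y x0 y0'|k _]; [rewrite lt_min x0|case: (he k)].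
  by move=> k; exact: bigmin_le_cond.
(* A box large enough for the bound [B] on the path and for the lower bound [emin] of the living
   coordinates. *)
pose j := maxn (Num.bound B) (Num.bound emin^-1).
have [j' cj] : exists j', chi j' s.
  apply: (@chi_exists s j) => // u k u0 us ks; apply/andP; split.
    apply: (le_trans _ ((he k).2 ks u u0 us)); apply: (le_trans _ (hle k)).
    rewrite -[leRHS]invrK lef_pV2 ?posrE ?invr_gt0//.
    apply: ltW; apply: (lt_le_trans (archi_boundP _)); first by rewrite invr_ge0 ltW.
    by rewrite ler_nat leqW// leq_maxr.
  apply: (le_trans (ler_norm _)); apply: (le_trans (hB u k u0 (ltW us))).
  apply: ltW; apply: (lt_le_trans (archi_boundP _)) => //.
  by rewrite ler_nat leqW// leq_maxl.
by have := nc j'; rewrite cj.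
Qed.

Lemma Ynext_solves : solves i.+1 Ynext.
Proof.
have iY : sintv A (stage_coef i.+1 Ynext).
  move=> m c; apply: (@eq_locint _ _ _ (fun s => stage_coef i U c s m + hlim c s m)).
    by move=> s s0; exact: Ynext_coef.
  by apply: locintD; [exact: (iU m c)|exact: (hlim_sint m c)].
split => //; [exact: Ynext_cadlag|exact: Ynext_nonneg|move=> t m t0].
rewrite /Ynext UE// -addrA; congr (_ + _); rewrite /SIv -SID//; last exact: hlim_sint.
by apply: eq_SI => c s s0 _; rewrite Ynext_coef.
Qed.

End Frozen.
End Stage.

(** * Adapted solutions and uniqueness *)

Section Existence.
Context {R : realType} {d : measure_display} {Omega : measurableType d}.
Variable F : R -> set (set Omega).
Hypothesis filtF : filtration F.
Context {M N : nat}.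
Local Notation mR := (measurableTypeR R).
Local Notation PT := (g_sigma_algebraType (pred_gen F)).
Local Notation FT t := (g_sigma_algebraType (F t)).
Local Notation C := (option 'I_N).
Local Notation pmeas f := (@measurable_fun _ _ PT R Dpos f).

Definition adaptedv (V : Omega -> R -> 'I_M -> R) := forall k, adapted F (fun w t => V w t k).

Lemma measurable_Dpos_section (f : PT -> R) w : pmeas f ->
  measurable_fun pos0 (fun s : mR => f (w, s)).
Proof.
move=> mf _ B mB; have mS := mf (measurable_Dpos filtF) B mB.
rewrite (_ : _ `&` _ = [set s | ((Dpos : set PT) `&` f @^-1` B) (w, s)]).
  exact: measurable_xsec.
by apply/seteqP; split => s /=; rewrite /Dpos/=; [move=> []|move=> [[]]].
Qed.

Lemma adapted_cst (a : R) : adapted F (fun _ _ => a).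
Proof.
move=> t t0 B mB; have [Ba|Ba] := pselect (B a).
  rewrite (_ : _ @^-1` _ = setT); first exact: FsetT.
  by apply/seteqP; split.
rewrite (_ : _ @^-1` _ = set0); first exact: Fset0.
by apply/seteqP; split.
Qed.

Lemma adapted_det (f : R -> R) : adapted F (fun _ => f).
Proof.
move=> t t0 B mB; have [Ba|Ba] := pselect (B (f t)).
  rewrite (_ : _ @^-1` _ = setT); first exact: FsetT.
  by apply/seteqP; split.
rewrite (_ : _ @^-1` _ = set0); first exact: Fset0.
by apply/seteqP; split.
Qed.

Lemma adapted_add (X Y : Omega -> R -> R) : adapted F X -> adapted F Y ->
  adapted F (fun w t => X w t + Y w t).
Proof.
move=> /(adaptedP filtF) aX /(adaptedP filtF) aY; apply/(adaptedP filtF) => t t0.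
by apply: measurable_funD; [exact: aX|exact: aY].
Qed.

Lemma adapted_opp (X : Omega -> R -> R) : adapted F X -> adapted F (fun w t => - X w t).
Proof.
move=> /(adaptedP filtF) aX; apply/(adaptedP filtF) => t t0.
by apply: measurableT_comp => //; exact: aX.
Qed.

Lemma adapted_sum (I : finType) (X : I -> Omega -> R -> R) : (forall i, adapted F (X i)) ->
  adapted F (fun w t => \sum_i X i w t).
Proof.
move=> aX; apply/(adaptedP filtF) => t t0; apply: measurable_sum => i.
by have /(adaptedP filtF) := aX i; exact.
Qed.

Lemma adapted_lim (X : nat -> Omega -> R -> R) (Y : Omega -> R -> R) :
  (forall n, adapted F (X n)) -> (forall w t, 0 <= t -> X n w t @[n --> \oo] --> Y w t) ->
  adapted F Y.
Proof.
move=> aX XY; apply/(adaptedP filtF) => t t0.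
apply: (@measurable_fun_cvg _ (FT t) R setT (fun n w => X n w t)) => [n|w _].
  by have /(adaptedP filtF) := aX n; exact.
exact: XY.
Qed.

Lemma pmeas_lm (Z : Omega -> R -> R) : (forall w, cadlag (Z w)) -> adapted F Z ->
  pmeas (fun p => lm (Z p.1) p.2).
Proof. by move=> cZ aZ; exact: (pred_fun_pos filtF (adapted_lm filtF cZ aZ)). Qed.

Lemma pmeas_set (E : set PT) (f : PT -> R) : measurable E ->
  (forall p, Dpos p -> f p = (`[< E p >])%:R) -> pmeas f.
Proof.
move=> mE fE; apply: (@eq_measurable_fun _ _ PT R Dpos (\1_E)).
  by move=> p /set_mem pD; rewrite fE// indicE.
exact: measurable_indic.
Qed.

Lemma pmeas_ifM (c : PT -> bool) (f : PT -> R) : pmeas (fun p => (c p)%:R) -> pmeas f ->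
  pmeas (fun p => if c p then f p else 0).
Proof.
move=> mc mf; apply: (@eq_measurable_fun _ _ PT R Dpos (fun p => (c p)%:R * f p)).
  by move=> p _; case: (c p); rewrite ?mul1r ?mul0r.
exact: measurable_funM.
Qed.

Variable A : Omega -> C -> R -> R.
Hypotheses (ndA : forall w c, nondec (A w c)) (cA : forall w c, cadlag (A w c))
  (aA : forall c, adapted F (fun w => A w c)).

Lemma adapted_SI (h : C -> PT -> R) : (forall c, pmeas (h c)) ->
  (forall w, sint (A w) (fun c s => h c (w, s))) ->
  adapted F (fun w t => SI (A w) (fun c s => h c (w, s)) t).
Proof.
move=> mh ih; apply: adapted_sum => c.
apply: (@adapted_Rintegral _ _ _ F filtF (fun w => A w c) (fun w s => h c (w, s))) => //.
  apply: (@eq_measurable_fun _ _ PT R Dpos (h c)) => [[w s] _ //|].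
  exact: mh.
by move=> w; exact: ih.
Qed.

Variable b : Omega -> C -> R -> ('I_M -> bool) -> ('I_M -> R) -> 'I_M -> R.
Hypotheses (lipb : forall w, box_lipschitz (b w)) (deadb : forall w, dead_coef (b w))
  (signb : forall w, signed_coef (b w)) (budb : forall w, budget_coef (A w) (b w)).

(** Predictability is asked for compositions with predictable arguments, the form in which the
    coefficients are integrated. *)
Definition pred_coef := forall c m (kap : PT -> 'I_M -> bool) (z : PT -> 'I_M -> R),
  (forall k, pmeas (fun p => (kap p k)%:R)) -> (forall k, pmeas (fun p => z p k)) ->
  (forall p, Dpos p -> nonneg (z p)) ->
  pmeas (fun p => b p.1 c p.2 (kap p) (z p) m).

Hypothesis mb : pred_coef.
Variable y0 : 'I_M -> R.

Section OneStage.
Variables (i : nat) (U : Omega -> R -> 'I_M -> R).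
Hypotheses (solU : forall w, solves (A w) (b w) y0 i (U w)) (aU : adaptedv U).

Let cU w : cadlagv (U w). Proof. by case: (solU w). Qed.
Let U0 w : nonnegv (U w). Proof. by case: (solU w). Qed.

Lemma pmeas_alive k : pmeas (fun p => (alivev (U p.1) p.2 k)%:R).
Proof.
apply: (pmeas_set (pred_alive filtF (fun w => cU w k) (aU k) (fun w u => @U0 w u k))).
by move=> p _; congr (nat_of_bool _)%:R; apply/idP/asboolP.
Qed.

Lemma pmeas_ndead : pmeas (fun p => (ndead (U p.1) p.2 == i)%:R).
Proof.
have mn : pmeas (fun p => (ndead (U p.1) p.2)%:R).
  apply: (@eq_measurable_fun _ _ PT R Dpos (fun p => \sum_k (1 - (alivev (U p.1) p.2 k)%:R))).
    move=> p _; rewrite /ndead -sum1_card natr_sum [RHS]big_mkcond/=.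
    by apply: eq_bigr => k _; rewrite inE; case: (alivev _ _ _); rewrite ?subrr ?subr0.
  apply: measurable_sum => k; apply: measurable_funB; first exact: measurable_cst.
  exact: pmeas_alive.
pose E : set PT := Dpos `&` (fun p => (ndead (U p.1) p.2)%:R : R) @^-1` [set i%:R].
apply: (@pmeas_set E) => [|p pD]; first by apply: mn => //; exact: measurable_Dpos.
congr (nat_of_bool _)%:R; apply/eqP/asboolP => [h|[_ /= h]]; first by split=> //=; rewrite h.
by apply/eqP; rewrite -(eqr_nat R) h.
Qed.

Lemma pmeas_beta j c m (V : Omega -> R -> 'I_M -> R) : (forall w, cadlagv (V w)) -> adaptedv V ->
  pmeas (fun p => beta (b p.1) i (U p.1) j c p.2 (lmv (V p.1) p.2) m).
Proof.
move=> cV aV; apply: pmeas_ifM; first exact: pmeas_ndead.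
apply: (@mb c m (fun p => alivev (U p.1) p.2)
   (fun p => clampv j (alivev (U p.1) p.2) (lmv (V p.1) p.2))).
- exact: pmeas_alive.
- move=> k; apply: pmeas_ifM; first exact: pmeas_alive.
  apply: measurable_maxr; first exact: measurable_cst.
  apply: measurable_minr; first exact: measurable_cst.
  by apply: (@pmeas_lm (fun w t => V w t k)) => [w|]; [exact: cV|exact: aV].
- by move=> p _; exact: (inbox_ge0 (clampv_inbox _ _ _)).
Qed.

(** The deterministic path [y] counts as an adapted process; the claim is then about a section of a
    predictable process. *)
Lemma beta_measurable w j : measurable_coef (beta (b w) i (U w) j).
Proof.
move=> c m y cy.
apply: (@measurable_Dpos_section
  (fun p => beta (b p.1) i (U p.1) j c p.2 (lmv y p.2) m) w).
by apply: (@pmeas_beta j c m (fun _ => y)) => // k; exact: adapted_det.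
Qed.

Let iter j n w := picard_iter (A w) (beta (b w) i (U w) j) (U w) n.

Lemma iter_adapted j n : adaptedv (iter j n).
Proof.
elim: n => [|n ih] k; first exact: aU.
apply: adapted_add; first exact: aU.
apply: (@adapted_SI (fun c p => beta (b p.1) i (U p.1) j c p.2 (lmv (iter j n p.1) p.2) k)).
  move=> c; apply: pmeas_beta => // w.
  exact: (picard_iter_cadlag (ndA w) (cA w) (beta_lipschitz (lipb w) i (U w) j)
    (@beta_measurable w j) (cU w)).
move=> w; apply: (sintv_coef (ndA w) (cA w) (beta_lipschitz (lipb w) i (U w) j)
    (@beta_measurable w j)).
exact: (picard_iter_cadlag (ndA w) (cA w) (beta_lipschitz (lipb w) i (U w) j)
    (@beta_measurable w j) (cU w)).
Qed.

Lemma stage_picard : exists Z : Omega -> nat -> R -> 'I_M -> R,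
  [/\ forall w j, cadlagv (Z w j), forall j, adaptedv (fun w => Z w j) &
    forall w j t m, 0 <= t -> Z w j t m = U w t m + SIv (A w) (zcoef (b w) i (U w) (Z w) j) t m].
Proof.
exists (fun w j => picard (A w) (beta (b w) i (U w) j) (U w)); split.
- move=> w j; exact: (picard_cadlag (ndA w) (cA w) (beta_lipschitz (lipb w) i (U w) j)
    (@beta_measurable w j) (cU w)).
- move=> j k; apply: (@adapted_lim (fun n w t => iter j n w t k)).
    by move=> n; exact: iter_adapted.
  move=> w t t0; exact: (picard_cvg (ndA w) (cA w) (beta_lipschitz (lipb w) i (U w) j)
    (@beta_measurable w j) (cU w)).
- move=> w j t m t0; exact: (picard_eq (ndA w) (cA w) (beta_lipschitz (lipb w) i (U w) j)
    (@beta_measurable w j) (cU w)).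
Qed.

Section WithZ.
Variable Z : Omega -> nat -> R -> 'I_M -> R.
Hypotheses (cZ : forall w j, cadlagv (Z w j)) (aZ : forall j, adaptedv (fun w => Z w j))
  (ZE : forall w j t m, 0 <= t ->
    Z w j t m = U w t m + SIv (A w) (zcoef (b w) i (U w) (Z w) j) t m).

Lemma pmeas_chi j : pmeas (fun p => (chi i (U p.1) (Z p.1) j p.2)%:R).
Proof.
(* [pred_lower] treats lower bounds; an upper bound on [Z] is a lower bound on [- Z]. *)
have cN w k : cadlag (fun t => - Z w j t k).
  have -> : (fun t => - Z w j t k) = (fun t => 0 - Z w j t k) by apply/funext => t; rewrite sub0r.
  by apply: cadlagB; [exact: cadlag_cst|exact: cZ].
pose S1 k : set PT := [set p | 0 < p.2 /\ forall u, 0 <= u -> u < p.2 -> j.+1%:R^-1 <= Z p.1 j u k].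
pose S2 k : set PT := [set p | 0 < p.2 /\ forall u, 0 <= u -> u < p.2 -> - j.+1%:R <= - Z p.1 j u k].
have mS1 k : measurable (S1 k).
  by apply: (@pred_lower _ _ _ F filtF (fun w t => Z w j t k)) => [w|]; [exact: cZ|exact: aZ].
have mS2 k : measurable (S2 k).
  apply: (@pred_lower _ _ _ F filtF (fun w t => - Z w j t k)) => [w|]; first exact: cN.
  by apply: adapted_opp; exact: aZ.
pose Al k : set PT := [set p | alivev (U p.1) p.2 k].
have mAl k : measurable (Al k).
  exact: (pred_alive filtF (fun w => cU w k) (aU k) (fun w u => @U0 w u k)).
pose E0 : set PT := Dpos `&` (fun p => (ndead (U p.1) p.2 == i)%:R : R) @^-1` [set 1].
have mE0 : measurable E0 by apply: pmeas_ndead => //; exact: measurable_Dpos.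
apply: (@pmeas_set (E0 `&` \bigcap_(k in [set: 'I_M]) (~` Al k `|` (S1 k `&` S2 k)))).
  apply: measurableI => //; apply: fin_bigcap_measurable => // k _.
  by apply: measurableU; [exact: measurableC|exact: measurableI].
move=> p pD; have p0 : 0 < p.2 by apply/DposE.
congr (nat_of_bool _)%:R; apply/asboolP/asboolP => [[si h]|[[_ si] h]].
  split; first by split=> //=; rewrite si eqxx.
  move=> k _; have [ks|ks] := boolP (alivev (U p.1) p.2 k); last by left; apply/negP.
  by right; split; split=> // u u0 up; have /andP[] := h u k u0 up ks; rewrite ?lerN2.
split.
  by move: si => /=; case: eqP => // _ /esym/eqP; rewrite oner_eq0.
move=> u k u0 up ks; have := h k I; case => [//|[[_ h1] [_ h2]]].
by rewrite h1// -lerN2 h2.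
Qed.

Lemma pmeas_hj j c m : pmeas (fun p => hj (b p.1) i (U p.1) (Z p.1) j c p.2 m).
Proof.
apply: pmeas_ifM; first exact: pmeas_chi.
by apply: (@pmeas_beta j c m (fun w => Z w j)) => //; exact: aZ.
Qed.

Lemma stage_next : exists Y : Omega -> R -> 'I_M -> R,
  (forall w, solves (A w) (b w) y0 i.+1 (Y w)) /\ adaptedv Y.
Proof.
exists (fun w => Ynext (A w) (b w) i (U w) (Z w)).
have mh w j c m : measurable_fun pos0 (fun s : mR => hj (b w) i (U w) (Z w) j c s m).
  exact: (@measurable_Dpos_section (fun p => hj (b p.1) i (U p.1) (Z p.1) j c p.2 m) w
    (@pmeas_hj j c m)).
split=> [w|k].
  exact: (Ynext_solves (ndA w) (cA w) (lipb w) (deadb w) (signb w) (budb w) (solU w)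
    (@beta_measurable w) (cZ w) (ZE w) (mh w)).
apply: adapted_add; first exact: aU.
apply: (@adapted_SI (fun c p => hlim (b p.1) i (U p.1) (Z p.1) c p.2 k)).
  move=> c; apply: (@measurable_fun_cvg _ PT R Dpos
      (fun j p => hj (b p.1) i (U p.1) (Z p.1) j c p.2 k)) => [j|[w s] /DposE/= s0].
    exact: pmeas_hj.
  exact: (hj_cvg (ndA w) (cA w) (lipb w) (deadb w) (solU w) (@beta_measurable w) (cZ w) (ZE w) s0).
move=> w; exact: (hlim_sint (ndA w) (cA w) (lipb w) (deadb w) (signb w) (budb w) (solU w)
    (@beta_measurable w) (cZ w) (ZE w) (mh w)).
Qed.

End WithZ.
End OneStage.

Hypothesis y0_ge0 : forall m, 0 <= y0 m.

Theorem sde_existence i : exists Y : Omega -> R -> 'I_M -> R,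
  (forall w, solves (A w) (b w) y0 i (Y w)) /\ adaptedv Y.
Proof.
elim: i => [|i [U [solU aU]]].
  exists (fun _ _ => y0); split=> [w|k]; last exact: adapted_cst.
  split.
  - by move=> k; exact: cadlag_cst.
  - by move=> u k _.
  - by move=> m c t; exact: (@sint_cst _ _ (A w) (ndA w) (cA w) 0 c t).
  - move=> t m t0; rewrite /SIv /SI big1 ?addr0// => c _.
    by rewrite Rintegral_cst// mul0r.
have [Z [cZ aZ ZE]] := stage_picard solU aU.
exact: (stage_next solU aU cZ aZ ZE).
Qed.

End Existence.

(** * Pathwise uniqueness *)

Section Uniqueness.
Context {R : realType} {M N : nat}.
Local Notation mR := (measurableTypeR R).
Local Notation C := (option 'I_N).
Implicit Types (y : R -> 'I_M -> R).

Lemma exists_lower_bound (P : 'I_M -> R -> Prop) :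
  (forall k, exists2 h, 0 < h & P k h) ->
  (forall k h h', 0 < h' -> h' <= h -> P k h -> P k h') ->
  exists2 h, 0 < h & forall k, P k h.
Proof.
move=> hP Pmono; have /choice[h {}hP] : forall k, exists h, 0 < h /\ P k h.
  by move=> k; have [h h0 Ph] := hP k; exists h.
exists (\big[Num.min/1]_k h k).
  by elim/big_ind : _ => // [x y x0 y0'|k _]; [rewrite lt_min x0|case: (hP k)].
move=> k; apply: (Pmono k (h k)); last by case: (hP k).
  by elim/big_ind : _ => // [x y x0 y0'|k' _]; [rewrite lt_min x0|case: (hP k')].
exact: bigmin_le_cond.
Qed.

Lemma box_index (B e : R) : 0 <= B -> 0 < e ->
  exists j : nat, j.+1%:R^-1 <= e /\ B <= j.+1%:R.
Proof.
move=> B0 e0; exists (maxn (Num.bound B) (Num.bound e^-1)); split.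
  rewrite -[leRHS]invrK lef_pV2 ?posrE ?invr_gt0//.
  apply: ltW; apply: (lt_le_trans (archi_boundP _)); first by rewrite invr_ge0 ltW.
  by rewrite ler_nat leqW// leq_maxr.
apply: ltW; apply: (lt_le_trans (archi_boundP _)) => //.
by rewrite ler_nat leqW// leq_maxl.
Qed.

Variable A : C -> R -> R.
Hypotheses (ndA : forall c, nondec (A c)) (cA : forall c, cadlag (A c)).
Variable b : C -> R -> ('I_M -> bool) -> ('I_M -> R) -> 'I_M -> R.
Hypotheses (lipb : box_lipschitz b) (deadb : dead_coef b).
Variable y0 : 'I_M -> R.

Lemma stage_coef_full y c s m :
  stage_coef b M.+1 y c s m = b c s (alivev y s) (lmv y s) m.
Proof. by rewrite /stage_coef ltnS ndead_le. Qed.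

(* Just after t the set of alive coordinates is the set of positive ones, and these stay
   away from 0: the solution remains in a box. *)
Lemma local_box y t : solves A b y0 M.+1 y -> 0 <= t ->
  exists h, 0 < h /\ exists j, forall s, t < s -> s <= t + h ->
    alivev y s = (fun k => 0 < y t k) /\ inbox j (fun k => 0 < y t k) (lmv y s).
Proof.
move=> sol t0; have [cy yn iy yE] := sol.
have dead s u k : 0 < s -> ~~ alivev y s k -> s <= u -> y u k = 0.
  exact: (stage_dead ndA cA deadb sol).
have dead_after s k : t < s -> ~~ (0 < y t k) -> ~~ alivev y s k.
  move=> ts yt; have s0 := le_lt_trans t0 ts.
  apply/negP => /(aliveP (fun v => @yn v k) s0)[e e0 h].
  by move: yt => /negP; apply; apply: lt_le_trans (h t t0 ts).
have [h h0 hP] : exists2 h, 0 < h & forall k, 0 < y t k ->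
    forall u, t < u -> u <= t + h -> alivev y u k.
  apply: exists_lower_bound => [k|k h h' h'0 hh Ph yt u tu uh].
    have [yt|yt] := boolP (0 < y t k); last by exists 1.
    have [|h h0 hal] := @alive_right _ (fun u => y u k) t (fun v => @yn v k) (cy k) t0 _ yt.
      move=> tp; apply: contraT => /(dead t t k tp)/(_ (lexx _)) e.
      by rewrite e ltxx in yt.
    by exists h => // _ u tu uh; exact: hal.
  by apply: Ph => //; apply: (le_trans uh); rewrite lerD2l.
have th : 0 < t + h by rewrite ltr_wpDl.
have tth : t < t + h by rewrite ltrDl.
(* Being alive at the end [t + h] gives one lower bound for the whole past of that time. *)
have [e e0 eP] : exists2 e, 0 < e & forall k, 0 < y t k ->
    forall u, 0 <= u -> u < t + h -> e <= y u k.
  apply: exists_lower_bound => [k|k e e' e'0 ee Pe yt u u0 uh]; last first.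
    by apply: (le_trans ee); exact: Pe.
  have [yt|yt] := boolP (0 < y t k); last by exists 1.
  have /(aliveP (fun v => @yn v k) th)[e e0 he] := hP k yt (t + h) tth (lexx _).
  by exists e.
have [B B0 hB] := cadlagv_bounded cy (ltW th).
have [j [je jB]] := box_index B0 e0.
exists h; split=> //; exists j => s ts sh; have s0 := le_lt_trans t0 ts.
split.
  apply/funext => k; apply/idP/idP => [|yt]; last exact: hP.
  by apply: contraTT; exact: dead_after.
move=> k; case: ifPn => yt; last first.
  apply/eqP/lm_unique => //; apply: cvg_near_cst; near=> u.
  have tu : t < u by near: u; exact: nbhs_left_gt.
  exact: (dead u u k (le_lt_trans t0 tu) (dead_after u k tu yt) (lexx u)).
apply/andP; split.
  apply: (ge_lm_cst (cy k) s0 (lexx 0)) => u u0 us; apply: (le_trans je).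
  by apply: eP => //; exact: lt_le_trans sh.
apply: (le_lm_cst (cy k) s0 (lexx 0)) => u u0 us; apply: le_trans jB.
apply: (le_trans (ler_norm _)); apply: hB => //.
by apply: ltW; exact: lt_le_trans sh.
Unshelve. all: by end_near. Qed.

Theorem solves_unique y y' : solves A b y0 M.+1 y -> solves A b y0 M.+1 y' ->
  forall t, 0 <= t -> y t = y' t.
Proof.
move=> sol sol'; have [cy yn iy yE] := sol; have [cy' yn' iy' yE'] := sol'.
have coefE t : (forall u, 0 <= u -> u < t -> y u = y' u) -> forall c s m, 0 < s -> s <= t ->
    stage_coef b M.+1 y c s m = stage_coef b M.+1 y' c s m.
  move=> yy c s m s0 st; rewrite !stage_coef_full.
  have yy' u : 0 <= u -> u < s -> y u = y' u.
    by move=> u0 us; apply: yy => //; exact: lt_le_trans st.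
  by rewrite (eq_alivev s0 yy') (eq_lmv cy s0 yy').
apply: real_ind => [t t0 ih|t t0 ih].
  apply/funext => m; rewrite yE// yE'//; congr (_ + _).
  by apply: eq_SI => c s s0 st; apply: coefE st.
have [h [h0 [j jP]]] := local_box sol t0.
have [h' [h'0 [j' jP']]] := local_box sol' t0.
pose hm := Num.min h h'; have hm0 : 0 < hm by rewrite lt_min h0.
have T0 : 0 <= t + hm by rewrite addr_ge0// ltW.
have [K K0 hK] := lipb (maxn j j') T0.
exists (hm / 2) => [|u tu uh]; first by rewrite divr_gt0.
apply: (gronwall ndA cA K0 cy cy' iy iy' (T := t + hm)) => //.
- by move=> s s0 sT m; rewrite yE// yE'// subDD.
- move=> c m s s0 sT; have [st|ts] := leP s t.
    rewrite (coefE t)//; last by move=> v v0 vt; apply: ih => //; exact: ltW.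
    by rewrite subrr normr0 mulr_ge0 ?vnorm_ge0.
  have st : s <= t + h by apply: ltW; apply: (lt_le_trans sT); rewrite lerD2l ge_min lexx.
  have st' : s <= t + h' by apply: ltW; apply: (lt_le_trans sT); rewrite lerD2l ge_min lexx orbT.
  (* Equal values at [t] mean equal living sets just after [t], hence boxes on the same face. *)
  have yt : y t = y' t by exact: ih.
  have [e1 b1] := jP s ts st; have [e2 b2] := jP' s ts st'.
  rewrite !stage_coef_full e1 e2 -yt; rewrite -yt in b2.
  apply: (hK c m s _ _ _ s0 (ltW sT) _ _).2.
    exact: inbox_mono (leq_maxl _ _) b1.
  exact: inbox_mono (leq_maxr _ _) b2.
- by apply: (le_trans t0); exact: ltW.
- by apply: (le_lt_trans uh); rewrite ltrD2l; lra.
Qed.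

End Uniqueness.

(** * The coefficients of the wealth equation *)

Section Coefficients.
Context {R : realType} {M N : nat}.
Local Notation C := (option 'I_N).
Implicit Types (z : 'I_M -> R) (kap : 'I_M -> bool).

Definition active_rate (v : 'I_M -> R -> ('I_M -> R) -> 'I_N -> R) kap s z (m : 'I_M) n : R :=
  if kap m then v m s z n else 0.

(** Division by 0 yields 0, which is the convention of the wealth equation for
    [l^{m,n} / |l^{.,n}|]. *)
Definition wealth_coef (v : 'I_M -> R -> ('I_M -> R) -> 'I_N -> R) (c : C) s kap z m : R :=
  if c is Some n then active_rate v kap s z m n / \sum_k active_rate v kap s z k n
  else - \sum_n active_rate v kap s z m n.

(* The cells [a/2, 2a] centred at the points a of a finite grid cover the box with overlap. *)
Lemma grid_cell j : exists (n : nat) (h : R), 0 < h /\ forall kap z, inbox j kap z ->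
  exists p : {ffun 'I_M -> 'I_n.+1}, forall z', inbox j kap z' ->
    (forall k, `|z k - z' k| <= h) -> forall k,
    (p k)%:R * (2 * h) / 2 <= z k <= 2 * ((p k)%:R * (2 * h)) /\
    (p k)%:R * (2 * h) / 2 <= z' k <= 2 * ((p k)%:R * (2 * h)).
Proof.
(* The grid has mesh [2 h], half the smallest living value [4 h] of the box. *)
have [h h0 hE] : exists2 h : R, 0 < h & 4 * h = j.+1%:R^-1.
  by exists (j.+1%:R^-1 / 4); [rewrite divr_gt0// invr_gt0|rewrite mulrC divfK// pnatr_eq0].
exists (Num.truncn (j.+1%:R / (2 * h) : R)), h; split=> // kap z bz.
have zj k : 0 <= z k <= j.+1%:R.
  have := bz k; case: (kap k) => [/andP[h1 ->]|/eqP ->]; last by rewrite lexx ler0n.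
  by rewrite andbT (le_trans _ h1)// invr_ge0.
have h20 : 0 < 2 * h by rewrite mulr_gt0.
have pk k : (Num.truncn (z k / (2 * h)) < (Num.truncn (j.+1%:R / (2 * h) : R)).+1)%N.
  rewrite ltnS; apply: le_truncn; rewrite ler_pM2r ?invr_gt0//.
  by case/andP: (zj k).
exists [ffun k => Ordinal (pk k)] => z' bz' zz k; rewrite ffunE/=.
have := bz k; have := bz' k; have := zz k; case: (kap k) => [hk b' bk|_ /eqP -> /eqP ->]; last first.
  by rewrite mul0r truncn0 !mul0r mulr0 !lexx.
have zk0 : 0 <= z k / (2 * h) by apply: divr_ge0; [case/andP: (zj k)|exact: ltW].
have /andP[t1 t2] := truncn_itv zk0; set q := Num.truncn _ in t1 t2 *.
have q1 : q%:R * (2 * h) <= z k by rewrite -ler_pdivlMr.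
have q2 : z k < q%:R * (2 * h) + 2 * h.
  by rewrite -[X in _ + X]mul1r -mulrDl natr1 -ltr_pdivrMr.
have q3 : 2 * (2 * h) <= z k.
  by case/andP: bk => bk _; apply: le_trans bk; rewrite -hE; lra.
have q4 : 1 < q%:R :> R.
  rewrite ltNge; apply/negP => q1'; have : q%:R * (2 * h) <= 2 * h by rewrite ler_piMl// ltW.
  lra.
(* The grid point [a] below [z k] is thus at least [4 h]. As [z k] and [z' k] lie in
   [[a - h, a + 3 h]], they are in [[a/2, 2 a]]. *)
have : 2 * (2 * h) <= q%:R * (2 * h) by rewrite ler_pM2r// ler_nat; rewrite ltr1n in q4.
move: q1 q2; set a := q%:R * (2 * h) => q1 q2 q5.
move: hk; rewrite ler_distl => /andP[d1 d2].
by split; apply/andP; split; lra.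
Qed.

(** A single [K] bounds the rate, its Lipschitz constant and its inverse. In the last clause the
    same alternative holds at [z] and [z'], because the sets [Pi] in (C2) do not depend on the
    wealth. *)
Definition boxed_rate (u : R -> ('I_M -> R) -> 'I_N -> R) (m : 'I_M) j T K :=
  forall s kap z z' n, 0 < s -> s <= T -> inbox j kap z -> inbox j kap z' ->
  [/\ u s z n <= K, `|u s z n - u s z' n| <= K * vnorm (z \- z') &
    kap m -> (K^-1 <= u s z n /\ K^-1 <= u s z' n) \/ (u s z n = 0 /\ u s z' n = 0)].

Lemma boxed_rate_le u m j T K K' : 0 < K -> K <= K' ->
  boxed_rate u m j T K -> boxed_rate u m j T K'.
Proof.
move=> K0 KK h s kap z z' n s0 sT bz bz'; have [h1 h2 h3] := h s kap z z' n s0 sT bz bz'.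
split; first exact: le_trans KK.
  by apply: (le_trans h2); rewrite ler_wpM2r// vnorm_ge0.
have KV : K'^-1 <= K^-1 by rewrite lef_pV2// posrE//; exact: lt_le_trans KK.
by move=> /h3[[a b]|ab]; [left; split; exact: le_trans KV _|right].
Qed.

(** There are finitely many grid cells and [delta] is bounded on [[0, T]], whence a common [K].
    Points at distance at most [h] share a cell; for others the difference is at most
    [K <= K * |z - z'| / h]. This is the origin of the factor [1 + h^-1]. *)
Lemma boxed_rateP (u : R -> ('I_M -> R) -> 'I_N -> R) (m : 'I_M) (Pi : 'I_N -> R -> Prop)
    (Ca : ('I_M -> R) -> R) (delta : R -> R) :
  (forall a, 0 < Ca a) -> cadlag delta -> (forall t, 0 <= t -> 0 < delta t) ->
  (forall t z n, 0 <= t -> nonneg z -> 0 <= u t z n) ->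
  (forall n t z, 0 <= t -> Pi n t -> nonneg z -> u t z n = 0) ->
  (forall n t z zt a, 0 <= t -> ~ Pi n t -> nonneg z -> nonneg zt -> nonneg a ->
    (forall k, a k / 2 <= z k <= 2 * a k /\ a k / 2 <= zt k <= 2 * a k) ->
    [/\ 0 < z m -> (Ca a * delta t)^-1 <= u t z n, u t z n <= Ca a * delta t &
      `|u t z n - u t zt n| <= Ca a * delta t * vnorm (z \- zt)]) ->
  forall j T, 0 <= T -> exists2 K, 0 < K & boxed_rate u m j T K.
Proof.
move=> C0 cd d0 u0 uPi uC j T T0.
have [n [h [h0 cell]]] := grid_cell j.
have [D D0 hD] := cadlag_bounded cd T0.
pose a (p : {ffun 'I_M -> 'I_n.+1}) : 'I_M -> R := fun k => (p k)%:R * (2 * h).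
pose Cs := \sum_p Ca (a p).
have Cle p : Ca (a p) <= Cs.
  by rewrite /Cs (bigD1 p)//= lerDl; apply: sumr_ge0 => q _; exact: ltW.
have Cs0 : 0 < Cs by apply: (lt_le_trans (C0 (a [ffun=> ord0]))); exact: Cle.
pose K := Cs * (D + 1); have K0 : 0 < K by rewrite mulr_gt0// ltr_wpDl.
have KC p s : 0 < s -> s <= T -> Ca (a p) * delta s <= K.
  move=> s0 sT; apply: ler_pM => //; first exact: ltW.
    by apply: ltW; apply: d0; exact: ltW.
  apply: (le_trans (ler_norm _)); apply: (le_trans (hD s (ltW s0) sT)); lra.
have apos p : nonneg (a p) by move=> k; rewrite mulr_ge0// ltW// mulr_gt0.
have val s kap z n0 : 0 < s -> s <= T -> inbox j kap z ->
    [/\ u s z n0 <= K, 0 <= u s z n0 & ~ Pi n0 s -> kap m -> K^-1 <= u s z n0].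
  move=> s0 sT bz; have zn := inbox_ge0 bz; have un := u0 s z n0 (ltW s0) zn.
  have [Pis|Pis] := pselect (Pi n0 s).
    by split=> //; rewrite uPi// ltW.
  have [p hp] := cell kap z bz.
  have [] := uC n0 s z z (a p) (ltW s0) Pis zn zn (apos p).
    by apply: hp => // k; rewrite subrr normr0 ltW.
  move=> h1 h2 _; split=> //; first by apply: (le_trans h2); exact: KC.
  move=> _ km; apply: le_trans (h1 _).
    rewrite lef_pV2 ?posrE//; first exact: KC.
    by rewrite mulr_gt0//; apply: d0; exact: ltW.
  by have := bz m; rewrite km => /andP[b1 _]; apply: lt_le_trans b1; rewrite invr_gt0.
have h10 : 0 < 1 + h^-1 by rewrite ltr_wpDr ?invr_ge0 ?ltW// ltr01.
have KK : K <= K * (1 + h^-1) by apply: ler_peMr; [exact: ltW|rewrite lerDl invr_ge0 ltW].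
exists (K * (1 + h^-1)); first by rewrite mulr_gt0.
move=> s kap z z' n0 s0 sT bz bz'.
have [z1 z2 z3] := val s kap z n0 s0 sT bz; have [z1' z2' z3'] := val s kap z' n0 s0 sT bz'.
split; first exact: le_trans KK.
- have [Pis|Pis] := pselect (Pi n0 s).
    rewrite !(uPi n0 s)//; [|exact: ltW|exact: inbox_ge0 bz'|exact: ltW|exact: inbox_ge0 bz].
    by rewrite subrr normr0 mulr_ge0 ?vnorm_ge0// ltW// mulr_gt0.
  have [p hp] := cell kap z bz.
  have [zz|] := leP (vnorm (z \- z')) h.
    have [] := uC n0 s z z' (a p) (ltW s0) Pis (inbox_ge0 bz) (inbox_ge0 bz') (apos p).
      by apply: hp => // k; apply: le_trans zz; exact: (vnorm_coord (z \- z')).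
    move=> _ _ h3; apply: (le_trans h3); rewrite ler_wpM2r ?vnorm_ge0//.
    by apply: le_trans KK; exact: KC.
  move=> hz; have e : 1 <= h^-1 * vnorm (z \- z').
    by rewrite mulrC -ler_pdivrMr ?invr_gt0// invrK mul1r ltW.
  apply: (@le_trans _ _ K).
    by rewrite ler_norml; lra.
  rewrite -mulrA ler_peMr//; first exact: ltW.
  apply: (le_trans e); rewrite mulrDl mul1r lerDr vnorm_ge0//.
- move=> km; have [Pis|Pis] := pselect (Pi n0 s).
    by right; rewrite !(uPi n0 s)//; [exact: ltW|exact: inbox_ge0 bz'|exact: ltW|exact: inbox_ge0 bz].
  by left; split; [apply: le_trans (z3 _ _)|apply: le_trans (z3' _ _)] => //;
    rewrite lef_pV2 ?posrE// mulr_gt0.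
Qed.

Lemma ratio_lipschitz (x y : 'I_M -> R) K e m : 0 < K ->
  (forall k, 0 <= y k) -> (forall k, `|x k - y k| <= K * e) ->
  K^-1 <= \sum_k x k -> K^-1 <= \sum_k y k ->
  `|x m / \sum_k x k - y m / \sum_k y k| <= K ^+ 2 * (1 + M%:R) * e.
Proof.
move=> K0 y0 xy; set D := \sum_k x k; set D' := \sum_k y k => hD hD'.
have KV : 0 < K^-1 by rewrite invr_gt0.
have D0 : 0 < D by exact: lt_le_trans hD. have D'0 : 0 < D' by exact: lt_le_trans hD'.
have e0 : 0 <= K * e by apply: le_trans (xy m).
have DD : `|D' - D| <= M%:R * (K * e).
  rewrite /D /D' -sumrB; apply: (le_trans (ler_norm_sum _ _ _)).
  apply: (@le_trans _ _ (\sum_(k < M) K * e)); last by rewrite sumr_const card_ord mulr_natl.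
  by apply: ler_sum => k _; rewrite distrC.
(* In this form the second quotient [y m / D'] is at most 1 and only one denominator has to be
   estimated. *)
have -> : x m / D - y m / D' = D^-1 * ((x m - y m) + (y m / D') * (D' - D)).
  by field; rewrite !gt_eqF.
rewrite normrM gtr0_norm ?invr_gt0//.
have -> : K ^+ 2 * (1 + M%:R) * e = K * (K * e + 1 * (M%:R * (K * e))) by ring.
apply: ler_pM => //; first by rewrite invr_ge0 ltW.
  by rewrite -[leRHS]invrK lef_pV2 ?posrE.
apply: (le_trans (ler_normD _ _)); apply: lerD => //; rewrite normrM.
have yD : 0 <= y m / D' by rewrite divr_ge0// ltW.
apply: ler_pM => //; rewrite (ger0_norm yD) ler_pdivrMr// mul1r /D' (bigD1 m)//= lerDl; exact: sumr_ge0.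
Qed.

Variables (v : 'I_M -> R -> ('I_M -> R) -> 'I_N -> R).
Hypothesis v_ge0 : forall m t z n, 0 <= t -> nonneg z -> 0 <= v m t z n.

Lemma active_rate_ge0 kap s z m n : 0 <= s -> nonneg z -> 0 <= active_rate v kap s z m n.
Proof. by move=> s0 zn; rewrite /active_rate; case: ifP => // _; exact: v_ge0. Qed.

Lemma wealth_coef_dead : dead_coef (wealth_coef v).
Proof.
move=> [n|] s kap z m s0 km; rewrite /= /active_rate (negbTE km) ?mul0r//.
by rewrite big1 ?oppr0.
Qed.

Lemma wealth_coef_ge0 n kap s z m : 0 <= s -> nonneg z -> 0 <= wealth_coef v (Some n) s kap z m.
Proof.
by move=> s0 zn; rewrite /= divr_ge0 ?sumr_ge0// => *; rewrite active_rate_ge0.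
Qed.

Lemma wealth_coef_le1 n kap s z m : 0 <= s -> nonneg z -> wealth_coef v (Some n) s kap z m <= 1.
Proof.
move=> s0 zn; rewrite /=; set D := \sum_k _.
have D0 : 0 <= D by apply: sumr_ge0 => k _; rewrite active_rate_ge0.
have [->|Dn] := eqVneq D 0; first by rewrite invr0 mulr0.
rewrite ler_pdivrMr ?lt_neqAle 1?eq_sym ?Dn// mul1r /D (bigD1 m)//= lerDl.
by apply: sumr_ge0 => k _; rewrite active_rate_ge0.
Qed.

Lemma wealth_coef_signed : signed_coef (wealth_coef v).
Proof.
move=> s kap z m s0 zn; split=> [|n].
  by rewrite /= oppr_le0; apply: sumr_ge0 => n _; rewrite active_rate_ge0// ltW.
by rewrite ger0_norm ?wealth_coef_ge0 ?wealth_coef_le1// ltW.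
Qed.

(** The last part of (C1) bounds the investment at a jump of operational time by [z m]; jumps of the
    payoffs only add. *)
Lemma wealth_coef_budget (A : C -> R -> R) :
  (forall n t, 0 < t -> 0 <= jump (A (Some n)) t) ->
  (forall m z t, 0 <= t -> nonneg z -> vnorm (v m t z) * jump (A None) t <= z m) ->
  budget_coef A (wealth_coef v).
Proof.
move=> jA bud s kap z m s0 zn km.
rewrite (bigD1 None)//= addrA addr_ge0//.
  rewrite mulNr subr_ge0; apply: le_trans (bud m z s (ltW s0) zn).
  rewrite (_ : \sum_n _ = vnorm (v m s z))// /vnorm; apply: eq_bigr => n _.
  by rewrite /active_rate km ger0_norm// v_ge0// ltW.
apply: sumr_ge0 => -[n|//] _; rewrite mulr_ge0//; last exact: jA.
by apply: wealth_coef_ge0 => //; exact: ltW.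
Qed.

Lemma wealth_coef_lipschitz :
  (forall m j T, 0 <= T -> exists2 K, 0 < K & boxed_rate (v m) m j T K) ->
  box_lipschitz (wealth_coef v).
Proof.
move=> vK j T T0.
have [K K0 hK] : exists2 K, 0 < K & forall m, boxed_rate (v m) m j T K.
  have /choice[k hk] : forall m, exists K, 0 < K /\ boxed_rate (v m) m j T K.
    by move=> m; have [K K0 h] := vK m j T T0; exists K.
  exists (1 + \sum_m k m) => [|m].
    by rewrite ltr_wpDr// sumr_ge0// => m _; case: (hk m) => /ltW.
  have [k0 h] := hk m; apply: (boxed_rate_le k0 _ h).
  have kS : k m <= \sum_i k i.
    by rewrite (bigD1 m)//= lerDl sumr_ge0// => i _; case: (hk i) => /ltW.
  by apply: (le_trans kS); rewrite lerDr.
have rate s kap z z' m n : 0 < s -> s <= T -> inbox j kap z -> inbox j kap z' ->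
    active_rate v kap s z m n <= K /\
    `|active_rate v kap s z m n - active_rate v kap s z' m n| <= K * vnorm (z \- z').
  move=> s0 sT bz bz'; rewrite /active_rate; case: ifP => _.
    by have [] := hK m s kap z z' n s0 sT bz bz'.
  by rewrite subrr normr0 mulr_ge0 ?vnorm_ge0// ltW.
(* [N * K] serves the investment, summed over the assets; [K ^+ 2 * (1 + M)] is the Lipschitz
   constant of a share and 1 its bound. *)
pose K' := N%:R * K + (K ^+ 2 * (1 + M%:R) + 1).
have K2 : 0 <= K ^+ 2 * (1 + M%:R) by rewrite mulr_ge0 ?sqr_ge0// addr_ge0.
have NK : 0 <= N%:R * K by rewrite mulr_ge0// ltW.
exists K' => [|c m s kap z z' s0 sT bz bz']; first by rewrite !addr_ge0.
have zn := inbox_ge0 bz; have zn' := inbox_ge0 bz'; have s0' := ltW s0.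
have ge0 y k n : nonneg y -> 0 <= active_rate v kap s y k n by exact: active_rate_ge0.
case: c => [n|]; last first.
  split.
    rewrite /= normrN ger0_norm ?sumr_ge0//; last by move=> n _; exact: ge0.
    apply: (@le_trans _ _ (\sum_(n < N) K)); last by rewrite sumr_const card_ord -mulr_natl lerDl addr_ge0.
    by apply: ler_sum => n _; have [] := rate s kap z z' m n s0 sT bz bz'.
  rewrite /= opprK addrC -sumrB; apply: (le_trans (ler_norm_sum _ _ _)).
  apply: (@le_trans _ _ (\sum_(n < N) K * vnorm (z \- z'))).
    by apply: ler_sum => n _; rewrite distrC; have [] := rate s kap z z' m n s0 sT bz bz'.
  rewrite sumr_const card_ord -mulr_natl mulrA ler_wpM2r ?vnorm_ge0// lerDl addr_ge0//.
split.
  rewrite ger0_norm; last exact: wealth_coef_ge0.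
  by apply: (le_trans (wealth_coef_le1 n kap m s0' zn)); rewrite /K' addrA lerDr addr_ge0.
(* If one living investor has a rate bounded below, so are both denominators. Otherwise all living
   rates vanish at both points, and the shares are 0. *)
have [[k kk low]|nolow] := pselect (exists2 k, kap k &
    K^-1 <= v k s z n /\ K^-1 <= v k s z' n).
  have sumK y : nonneg y -> K^-1 <= v k s y n -> K^-1 <= \sum_i active_rate v kap s y i n.
    move=> yn h; rewrite (bigD1 k)//= {1}/active_rate kk (le_trans h)// lerDl.
    by apply: sumr_ge0 => i _; exact: ge0.
  apply: (le_trans (@ratio_lipschitz (fun i => active_rate v kap s z i n)
    (fun i => active_rate v kap s z' i n) K (vnorm (z \- z')) m K0 _ _ (sumK _ zn low.1)
    (sumK _ zn' low.2))).
  - by move=> i; exact: ge0.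
  - by move=> i; have [] := rate s kap z z' i n s0 sT bz bz'.
  - by rewrite ler_wpM2r ?vnorm_ge0// /K'; lra.
have z0 i : active_rate v kap s z i n = 0 /\ active_rate v kap s z' i n = 0.
  rewrite /active_rate; case: ifP => // ki.
  by have [_ _ /(_ ki)[h|//]] := hK i s kap z z' n s0 sT bz bz'; exfalso; apply: nolow; exists i.
rewrite /= (z0 m).1 (z0 m).2 !mul0r subrr normr0 mulr_ge0 ?vnorm_ge0// !addr_ge0//.
Qed.

End Coefficients.

Section PredictableCoefficients.
Context {R : realType} {d : measure_display} {Omega : measurableType d}.
Variable F : R -> set (set Omega).
Hypothesis filtF : filtration F.
Context {M N : nat}.
Local Notation mR := (measurableTypeR R).
Local Notation PT := (g_sigma_algebraType (pred_gen F)).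
Local Notation pmeas f := (@measurable_fun _ _ PT R Dpos f).

Lemma measurable_invr : measurable_fun setT (fun x : mR => x^-1 : mR).
Proof.
rewrite -(setvU [set 0 : R]) setUC; apply/measurable_funU.
- exact: measurable_set1.
- by apply: measurableC; exact: measurable_set1.
split; first exact: measurable_fun_set1.
apply: open_continuous_measurable_fun => [|x /set_mem /= /eqP x0]; last exact: inv_continuous.
rewrite openC; apply: accessible_closed_set1; apply: hausdorff_accessible; exact: Rhausdorff.
Qed.

Lemma pmeas_div (f g : PT -> R) : pmeas f -> pmeas g -> pmeas (fun p => f p / g p).
Proof.
move=> mf mg; apply: measurable_funM => //.
by apply: (measurableT_comp measurable_invr).
Qed.

(** The sets whose preimage under [p |-> (p, z p)] is predictable on [Dpos] form a sigma-algebra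
    relative to [PBdom], and it contains the generators. *)
Lemma pmeas_PB (v : Omega -> R -> ('I_M -> R) -> 'I_N -> R) (z : PT -> 'I_M -> R) n :
  PB_fun F v -> (forall k, pmeas (fun p => z p k)) -> (forall p, Dpos p -> nonneg (z p)) ->
  pmeas (fun p => v p.1 p.2 (z p) n).
Proof.
move=> mv mz z0 _ B mB; have mD := measurable_Dpos filtF.
pose S : set (set ((Omega * R) * ('I_M -> R))) :=
  [set C | measurable ((Dpos : set PT) `&` [set p | C (p, z p)])].
have SP : PB F (PBdom `&` [set p | B (v p.1.1 p.1.2 p.2 n)]) by exact: mv.
have /(_ _ SP) : PB F `<=` S.
  apply: smallest_sub; first split.
  - by rewrite /S/= (_ : _ `&` _ = set0) ?measure0// -subset0 => p [].
  - move=> C SC; rewrite /S/= (_ : _ `&` _ = Dpos `\` (Dpos `&` [set p | C (p, z p)])).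
      exact: measurableD.
    apply/seteqP; split => p /=.
      by move=> [pD [_ nC]]; split=> // -[].
    move=> [pD nC]; split=> //; split; last by move=> Cp; apply: nC.
    by split=> /=; [rewrite Dom0U; right|exact: z0].
  - move=> C SC; rewrite /S/= (_ : _ `&` _ = \bigcup_i (Dpos `&` [set p | C i (p, z p)])).
      exact: bigcupT_measurable.
    by apply/seteqP; split => p /=; [move=> [pD [i _ Ci]]; exists i|move=> [i _ [pD Ci]]; split=> //; exists i].
  - move=> _ [A [k [B' [/(predictableP filtF)[mA _] mB' ->]]]]; rewrite /S/=.
    rewrite (_ : _ `&` _ = A `&` (Dpos `&` (fun p => z p k) @^-1` B')).
      by apply: measurableI => //; exact: mz.
    apply/seteqP; split => p /=; first by move=> [pD [Ap [_ Bz]]].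
    by move=> [Ap [pD Bz]]; split=> //; split=> //; split=> //; exact: z0.
rewrite /S/=; congr measurable; apply/seteqP; split => p /= [pD]; last first.
  by move=> Bp; do 2 split=> //; split=> /=; [rewrite Dom0U; right|exact: z0].
by move=> [].
Qed.

Lemma pmeas_active_rate (v : 'I_M -> Omega -> R -> ('I_M -> R) -> 'I_N -> R)
    (kap : PT -> 'I_M -> bool) (z : PT -> 'I_M -> R) m n :
  (forall m, PB_fun F (v m)) ->
  (forall k, pmeas (fun p => (kap p k)%:R)) -> (forall k, pmeas (fun p => z p k)) ->
  (forall p, Dpos p -> nonneg (z p)) ->
  pmeas (fun p => active_rate (fun m => v m p.1) (kap p) p.2 (z p) m n).
Proof.
move=> mv mk mz z0; apply: pmeas_ifM => //; exact: pmeas_PB.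
Qed.

Lemma wealth_pred_coef (v : 'I_M -> Omega -> R -> ('I_M -> R) -> 'I_N -> R) :
  (forall m, PB_fun F (v m)) -> pred_coef F (fun w => wealth_coef (fun m => v m w)).
Proof.
move=> mv c m kap z mk mz z0; case: c => [n|] /=.
  apply: pmeas_div; first exact: pmeas_active_rate.
  by apply: measurable_sum => k; exact: pmeas_active_rate.
apply: measurableT_comp => //; apply: measurable_sum => n; exact: pmeas_active_rate.
Qed.

End PredictableCoefficients.

(** * Measures on the predictable sigma-algebra *)

Section Disintegration.
Import HBNNSimple.
Context {d1 d2} {T1 : measurableType d1} {T2 : measurableType d2} {R : realType}.
Variables (P : {measure set T1 -> \bar R}) (k : T1 -> {measure set T2 -> \bar R}).
Hypothesis mk : forall U, measurable U -> measurable_fun setT (k ^~ U).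

Lemma mixture_ex : exists nu : {measure set T2 -> \bar R},
  forall U, measurable U -> nu U = (\int[P]_w k w U)%E.
Proof.
pose nu U : \bar R := (\int[P]_w k w U)%E.
have nu0 : nu set0 = 0%E by apply: integral0_eq => w _; rewrite measure0.
have nu_ge0 U : (0 <= nu U)%E by apply: integral_ge0 => w _; exact: measure_ge0.
have nus : semi_sigma_additive nu.
  move=> U mU tU mUU; have ser : (\sum_(0 <= i < n) nu (U i))%E @[n --> \oo] -->
      (\sum_(i <oo) nu (U i))%E by apply: is_cvg_nneseries => n _ _; exact: nu_ge0.
  rewrite (_ : nu (\bigcup_n U n) = \sum_(i <oo) nu (U i))%E// /nu.
  rewrite -integral_nneseries//; last by move=> n; exact: mk.
  apply: eq_integral => w _; rewrite measure_semi_bigcup//.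
pose m : {measure set T2 -> \bar R} :=
  HB.pack nu (isMeasure.Build _ _ _ nu nu0 nu_ge0 nus).
by exists m.
Qed.

(** Tonelli's theorem for a mixture of measures, through increasing simple functions. *)
Lemma integral_mixture (nu : {measure set T2 -> \bar R}) (f : T2 -> \bar R) :
  (forall U, measurable U -> nu U = (\int[P]_w k w U)%E) ->
  measurable_fun setT f -> (forall x, (0 <= f x)%E) ->
  (\int[nu]_x f x = \int[P]_w \int[k w]_x f x)%E.
Proof.
move=> nuE mf f0; pose f_ := nnsfun_approx measurableT mf.
have f_f x : (f_ n x)%:E @[n --> \oo] --> f x by exact: cvg_nnsfun_approx.
have ndf x m n : (m <= n)%N -> f_ m x <= f_ n x.
  by move=> mn; exact/lefP/nd_nnsfun_approx.
have MCT (mu : {measure set T2 -> \bar R}) :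
    (\int[mu]_x f x = limn (fun n => \int[mu]_x (f_ n x)%:E))%E.
  rewrite -monotone_convergence//.
  - by apply: eq_integral => x _; apply/esym/cvg_lim => //; exact: f_f.
  - by move=> n; apply/measurable_EFinP.
  - by move=> n x _; rewrite lee_fin.
  - by move=> x _ m n mn; rewrite lee_fin ndf.
have mint n : measurable_fun setT (fun w => \int[k w]_x (f_ n x)%:E)%E.
  apply: measurable_fun_integral_kernel => // [x|]; first by rewrite lee_fin.
  exact/measurable_EFinP.
transitivity (limn (fun n => \int[P]_w \int[k w]_x (f_ n x)%:E)%E); last first.
  rewrite -monotone_convergence//.
  - by apply: eq_integral => w _; rewrite MCT.
  - by move=> n w _; apply: integral_ge0 => x _; rewrite lee_fin.
  - move=> w _ m n mn; apply: ge0_le_integral => //.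
    + by move=> x _; rewrite lee_fin.
    + exact/measurable_EFinP.
    + exact/measurable_EFinP.
    + by move=> x _; rewrite lee_fin ndf.
rewrite MCT; congr (limn _); apply/funext => n.
rewrite integral_nnsfun// patch_setT sintegralE.
transitivity (\int[P]_w \sum_(r \in range (f_ n)) (r%:E * k w (f_ n @^-1` [set r])))%E; last first.
  by apply: eq_integral => w _; rewrite integral_nnsfun// patch_setT sintegralE.
have mpre r : measurable (f_ n @^-1` [set r]) by exact: measurable_sfunP.
have r0 r w : (0 <= r%:E * k w (f_ n @^-1` [set r]))%E.
  have [r_ge0|r_lt0] := leP 0 r; first by rewrite mule_ge0.
  by rewrite preimage_nnfun0 ?measure0 ?mule0.
rewrite ge0_integral_fsum//; last by move=> r; apply: measurable_funeM; exact: mk.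
apply: eq_fsbigr => r /set_mem[x _ <-]; rewrite nuE// ge0_integralZl//; first exact: mk.
by rewrite lee_fin.
Qed.

End Disintegration.

(** * Existence and uniqueness of densities *)

Section RadonNikodym.
Context {d} {T : measurableType d} {R : realType}.
Variable mu : {measure set T -> \bar R}.
Hypothesis mus : sigma_finite setT mu.

(** On disjoint pieces of finite [nu]-mass there are finite densities; they are glued along the
    index [idx] of the piece. *)
Lemma density_sigma_finite (nu : {measure set T -> \bar R}) : sigma_finite setT nu ->
  (forall A, measurable A -> mu A = 0%E -> nu A = 0%E) ->
  exists g : T -> R, [/\ measurable_fun setT g, forall x, 0 <= g x &
    forall A, measurable A -> nu A = (\int[mu]_(x in A) (g x)%:E)%E].
Proof.
move=> [S ST /all_and2[mS nuS]] numu; pose E := seqDU S.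
have mE j : measurable (E j) by apply: measurableD => //; exact: bigsetU_measurable.
have nuE j : (nu (E j) < +oo)%E.
  by apply: (le_lt_trans _ (nuS j)); rewrite le_measure ?inE//; exact: subDsetl.
have ET : \bigcup_j E j = setT by rewrite ST [RHS]seqDU_bigcup_eq.
have tE : trivIset setT E by exact: trivIset_seqDU.
pose S1 := isSFinite.Build _ _ _ _ (sfinite_measure_sigma_finite mus).
pose S2 := isSigmaFinite.Build _ _ _ _ mus.
pose mu' := HB.pack_for (SigmaFiniteMeasure.type T R) (Measure.sort mu) S1 S2.
have /choice[g hg] : forall j, exists g : T -> R, [/\ measurable_fun setT g,
    (forall x, 0 <= g x) & forall A, measurable A -> nu (A `&` E j) = (\int[mu]_(x in A) (g x)%:E)%E].
  move=> j; pose n0 := mrestr nu (mE j).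
  have fin : fin_num_fun n0.
    move=> A mA; rewrite ge0_fin_numE ?measure_ge0//; apply: (le_lt_trans _ (nuE j)).
    by rewrite /n0 /mrestr le_measure ?inE//; exact: measurableI.
  pose n1 : {finite_measure set T -> \bar R} :=
    HB.pack n0 (Measure_isFinite.Build _ _ _ n0 fin).
  have dom : n1 `<< mu'.
    apply/null_content_dominatesP => A mA A0; apply/eqP; rewrite eq_le measure_ge0 andbT.
    apply: (@le_trans _ _ (nu A)); last by rewrite (numu A mA A0).
    have : (nu (A `&` E j) <= nu A)%E; last by [].
    by rewrite le_measure ?inE//; exact: measurableI.
  have [f [f0 ffin fint fE]] := radon_nikodym_sigma_finite dom.
  exists (fine \o f); split.
  - by apply: measurableT_comp => //; exact: measurable_int fint.
  - by move=> x; exact: fine_ge0.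
  - move=> A mA; rewrite -[LHS]/(n1 A) fE//; apply: eq_integral => x _ /=.
    by rewrite fineK.
have kP x : exists j, `[< E j x >].
  have [j _ Ej] : (\bigcup_j E j) x by rewrite ET.
  by exists j; apply/asboolP.
pose idx x := ex_minn (kP x).
have idxE j x : E j x -> idx x = j.
  rewrite /idx; case: ex_minnP => i /asboolP Ei _ Ej.
  by have := tE i j I I; apply; exists x.
have mgi : measurable_fun setT (fun x => g (idx x) x).
  rewrite -ET; apply/measurable_fun_bigcup => // j.
  apply: (@eq_measurable_fun _ _ _ _ _ (g j)).
    by move=> x /set_mem/idxE ->.
  by apply: measurable_funTS; case: (hg j).
exists (fun x => g (idx x) x); split => //.
- by move=> x; case: (hg (idx x)).
- move=> A mA; rewrite -[A]setIT -ET setI_bigcupr measure_semi_bigcup//; last 3 first.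
  + by move=> j; exact: measurableI.
  + exact: trivIset_setIl.
  + by apply: bigcupT_measurable => j; exact: measurableI.
  rewrite ge0_integral_bigcup//.
  + apply: eq_eseriesr => j _; case: (hg j) => mg g0 gE.
    transitivity (\int[mu]_(x in A `&` E j) (g j x)%:E)%E.
      by rewrite -gE; [rewrite -setIA setIid|exact: measurableI].
    by apply: eq_integral => x /set_mem[_ /idxE ->].
  + by move=> j; exact: measurableI.
  + rewrite -setI_bigcupr ET setIT; apply: measurable_funTS; apply/measurable_EFinP.
    exact: mgi.
  + by move=> x _; rewrite lee_fin; case: (hg (idx x)).
  + exact: trivIset_setIl.
Qed.

(** Equal integrals determine the function only where they are finite, hence the localization to
    pieces of finite mass on which [f] is bounded. *)
Lemma density_unique (f g : T -> R) : measurable_fun setT f -> measurable_fun setT g ->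
  (forall x, 0 <= f x) -> (forall x, 0 <= g x) ->
  (forall A, measurable A -> (\int[mu]_(x in A) (f x)%:E = \int[mu]_(x in A) (g x)%:E)%E) ->
  mu [set x | f x != g x] = 0%E.
Proof.
move=> mf mg f0 g0 fg; have [S ST /all_and2[mS muS]] := mus.
pose E n := S n `&` [set x | f x <= n%:R].
have SU x : exists n, S n x.
  by have [n _ Sn] : (\bigcup_i S i) x by [rewrite -ST]; exists n.
pose D i j := S i `&` [set x | f x <= j%:R].
have mD i j : measurable (D i j).
  apply: measurableI => //; rewrite -[X in measurable X]setTI.
  rewrite (_ : [set x | f x <= j%:R] = f @^-1` `]-oo, j%:R]%classic); first exact: mf.
  by apply/seteqP; split => x /=; rewrite in_itv.
have ae i j : ae_eq mu (D i j) (EFin \o f) (EFin \o g).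
  apply: integral_ae_eq => //; last 2 first.
  - by apply: measurable_funTS; exact/measurable_EFinP.
  - by move=> A _ mA; exact: fg.
  apply: measurable_bounded_integrable => //.
  - by apply: (le_lt_trans _ (muS i)); rewrite le_measure ?inE//; exact: subIsetl.
  - exact: measurable_funTS.
  - exists j%:R; split; rewrite ?num_real// => y jy x [_ /= fx].
    by rewrite ger0_norm// (le_trans fx)// ltW.
have mfg : measurable [set x | f x != g x].
  rewrite (_ : [set x | _] = ~` ((fun x => f x - g x) @^-1` [set 0])).
    apply: measurableC; rewrite -[X in measurable X]setTI.
    by apply: measurable_funB.
  apply/seteqP; split => x /=.
    by move=> /eqP fgx h; apply: fgx; apply/eqP; rewrite -subr_eq0 h.
  by move=> h; apply/eqP => fgx; apply: h; rewrite fgx subrr.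
apply/negligibleP => //.
apply: (@negligibleS _ _ _ _ (\bigcup_i \bigcup_j ~` [set x | D i j x -> (EFin \o f) x = (EFin \o g) x])).
  move=> x /= fgx; have [i Si] := SU x; exists i => //.
  exists (Num.bound (f x)) => //= h; case/eqP: fgx; apply: EFin_inj; apply: h.
  by split=> //=; apply: ltW; exact: archi_boundP.
by apply: negligible_bigcup => i; apply: negligible_bigcup => j; exact: ae.
Qed.

End RadonNikodym.

(** * The measures P x H on the predictable sigma-algebra *)

Section ProcessMeasure.
Context {R : realType} {d : measure_display} {Omega : measurableType d}.
Variables (P : probability Omega R) (F : R -> set (set Omega)).
Hypotheses (filtF : filtration F) (FM : forall t A, 0 <= t -> F t A -> measurable A).
Local Notation mR := (measurableTypeR R).
Local Notation PT := (g_sigma_algebraType (pred_gen F)).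
Local Notation FT t := (g_sigma_algebraType (F t)).
Local Notation pmeas f := (@measurable_fun _ _ PT R Dpos f).

Lemma measurable_section_time t : 0 <= t ->
  @measurable_fun _ _ (FT t) PT setT (fun w => (w, t)).
Proof.
move=> t0; apply: (@measurability _ _ (FT t) PT setT _ (pred_gen F)) => // _ [B GB <-].
rewrite setTI; apply/(measurable_FT filtF _ t0).
case: GB => [[C [s [u [s0 FC ->]]]]|[C [FC ->]]].
  have [/andP[st tu]|h] := boolP ((s < t) && (t <= u)).
    rewrite (_ : _ @^-1` _ = C); first by apply: (filtF.2 s) => //; exact: ltW.
    by apply/seteqP; split => w /=; rewrite in_itv/= st tu; [move=> []|].
  rewrite (_ : _ @^-1` _ = set0); first exact: Fset0.
  by apply/seteqP; split => w //=; rewrite in_itv/= => -[_]; rewrite (negbTE h).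
have [->|tn0] := eqVneq t 0.
  by rewrite (_ : _ @^-1` _ = C)//; apply/seteqP; split => w //= [].
rewrite (_ : _ @^-1` _ = set0); first exact: Fset0.
by apply/seteqP; split => w //= [_ /eqP]; rewrite (negbTE tn0).
Qed.

Lemma pred_fun_adapted Z : pred_fun F Z -> adapted F Z.
Proof.
move=> pZ t t0 B mB; have [mS _] := (predictableP filtF _).1 (pZ B mB).
have := measurable_section_time t0 measurableT mS.
rewrite setTI => /(measurable_FT filtF _ t0); congr (F t _).
by apply/seteqP; split => w /=; [move=> []|split=> //; split=> //=; rewrite in_itv/= t0].
Qed.

Section Fix.
Variable a : Omega -> R -> R.
Hypotheses (nda : forall w, nondec (a w)) (ca : forall w, cadlag (a w)) (aa : adapted F a).

Lemma measurable_LSm_pos0 (U : set PT) : measurable U ->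
  measurable_fun setT (fun w => LSm (a w) ([set s | U (w, s)] `&` pos0)).
Proof.
move=> mU; have mx w : measurable ([set s | U (w, s)] : set mR) by exact: measurable_xsec.
apply: (@emeasurable_fun_cvg _ _ _ _
  (fun n w => LSm (a w) ([set s | U (w, s)] `&` oc0 n%:R))) => [n|w _].
  have n0 : 0 <= n%:R :> R by [].
  move=> _ B mB; rewrite setTI; apply: (FM n0); apply/(measurable_FT filtF _ n0).
  by rewrite -[X in measurable X]setTI; exact: (measurable_LSm_section filtF nda ca aa n0 mU).
rewrite pos0_bigcup setI_bigcupr; apply: nondecreasing_cvg_mu.
- by move=> n; apply: measurableI => //; exact: measurable_oc0.
- by apply: bigcupT_measurable => n; apply: measurableI => //; exact: measurable_oc0.
- move=> m n mn; apply/subsetPset; apply: setIS; apply: oc0_nd; by rewrite ler_nat.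
Qed.

(** The measure behind [PxH], as a measure on all of [PT], so that general measure theory applies to
    it; [PxH_process_measure] makes the link. *)
Definition process_measure (nu : {measure set PT -> \bar R}) :=
  forall U : set PT, measurable U ->
    nu U = (\int[P]_w LSm (a w) ([set s | U (w, s)] `&` pos0))%E.

Let k w : {measure set PT -> \bar R} := @secmeas _ _ _ F (LSm (a w)) w _ (measurable_pos0).

Let mk (U : set PT) : measurable U -> measurable_fun setT (k ^~ U).
Proof. exact: measurable_LSm_pos0. Qed.

Lemma process_measure_ex : exists nu, process_measure nu.
Proof. by have [nu nuE] := mixture_ex P mk; exists nu. Qed.

Variable nu : {measure set PT -> \bar R}.
Hypothesis nuE : process_measure nu.

Lemma integral_process_measure (f : PT -> \bar R) :
  measurable_fun setT f -> (forall x, (0 <= f x)%E) ->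
  (\int[nu]_p f p = \int[P]_w \int[LSm (a w)]_(s in pos0) f (w, s))%E.
Proof.
move=> mf f0; rewrite (integral_mixture mk nuE)//.
by apply: eq_integral => w _; rewrite integral_secmeas.
Qed.

Lemma process_measure_null (U : set PT) : measurable U ->
  nu U = 0%E <-> P.-negligible [set w | LSm (a w) ([set s | U (w, s)] `&` pos0) != 0%E].
Proof.
move=> mU; rewrite nuE//; have mL := measurable_LSm_pos0 mU.
have := ae_eq_integral_abs P measurableT mL.
under eq_integral do rewrite gee0_abs//.
move=> ->; split=> -[N [mN N0 h]]; exists N; split=> // w /=.
  by move=> /eqP nz; apply: h => /= /(_ I).
by move=> nz; apply: h => /=; apply/eqP => z; apply: nz.
Qed.

End Fix.

(** The mass of [E] up to time [T] is at most the increment of [h] up to the last point of [E]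
    there, or up to its left limit at the supremum if there is no last point. *)
Lemma LSm_le_level (h : R -> R) (c : R) (E : set mR) : nondec h -> cadlag h -> measurable E ->
  E `<=` [set s | 0 < s /\ h s - h 0 <= c] -> 0 <= c -> (LSm h E <= c%:E)%E.
Proof.
move=> ndh ch mE Ec c0.
suff fin (T : R) : 0 <= T -> (LSm h (E `&` oc0 T) <= c%:E)%E.
  have -> : E = \bigcup_(n : nat) (E `&` oc0 n%:R).
    by rewrite -setI_bigcupr -pos0_bigcup setIidl// => s /Ec[s0 _]; rewrite /pos0/= in_itv/= s0.
  have cv : LSm h (E `&` oc0 n%:R) @[n --> \oo] --> LSm h (\bigcup_(n : nat) (E `&` oc0 n%:R)).
    apply: nondecreasing_cvg_mu.
    - by move=> n; apply: measurableI => //; exact: measurable_oc0.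
    - by apply: bigcupT_measurable => n; apply: measurableI => //; exact: measurable_oc0.
    - by move=> m n mn; apply/subsetPset; apply: setIS; apply: oc0_nd; rewrite ler_nat.
  rewrite -(cvg_lim _ cv)//; apply: lime_le; first by apply/cvg_ex; eexists; exact: cv.
  by apply: nearW => n; exact: fin.
move=> T0; set S := E `&` oc0 T.
have mS : measurable S by apply: measurableI => //; exact: measurable_oc0.
have [->|/set0P S0] := eqVneq S set0; first by rewrite measure0 lee_fin.
have ubT : ubound S T by move=> s [_]; rewrite /oc0/= in_itv/= => /andP[].
have hs : has_sup S by split=> //; exists T.
have Spos s : S s -> 0 < s by move=> [/Ec[]].
have tau0 : 0 < sup S by have [s Ss] := S0; apply: (lt_le_trans (Spos s Ss)); exact: ub_le_sup hs.2 _ _.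
have [Stau|Stau] := pselect (S (sup S)).
  apply: (@le_trans _ _ (LSm h (oc0 (sup S)))).
    apply: le_measure; rewrite ?inE//.
    by move=> s Ss; rewrite /oc0/= in_itv/= Spos//=; exact: ub_le_sup hs.2 _ _.
  rewrite LSm_oc0//; last exact: ltW.
  by rewrite lee_fin; case: Stau => /Ec[].
apply: (@le_trans _ _ (LSm h `]0, sup S[%classic)).
  apply: le_measure; rewrite ?inE//.
  move=> s Ss; rewrite /= in_itv/= Spos//= lt_neqAle; apply/andP; split.
    by apply: contra_notN Stau => /eqP <-.
  exact: ub_le_sup hs.2 _ _.
rewrite LSm_oo// lee_fin lerBlDr; apply: (le_lm_cst ch tau0 (lexx 0)) => u u0 us.
have [s Ss us'] : exists2 s, S s & u < s by exact: sup_gt.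
rewrite -lerBlDr; case: (Ss) => /Ec[_ hsc] _; apply: le_trans hsc; rewrite lerD2r.
by apply: ndh => //; exact: ltW.
Qed.

(** Since [a] is predictable, so are the level sets of [a - a 0], and every path gives the level [n]
    a mass of at most [n]. Conditioning on the value at the time itself excludes a jump that
    overshoots the level. *)
Lemma process_measure_sigma_finite (a : Omega -> R -> R) (nu : {measure set PT -> \bar R}) :
  pred_fun F a -> (forall w, nondec (a w)) -> (forall w, cadlag (a w)) ->
  process_measure a nu -> sigma_finite setT nu.
Proof.
move=> pa nda ca nuE.
have aa := pred_fun_adapted pa.
have ma : pmeas (fun p => a p.1 p.2 - a p.1 0).
  apply: measurable_funB; first exact: (pred_fun_pos filtF pa).
  have : adapted F (fun w _ => a w 0).
    move=> t t0 B mB; apply: (filtF.2 0) => //; exact: aa.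
  move=> a0; apply: (@eq_measurable_fun _ _ PT R Dpos (fun p => lm (fun _ => a p.1 0) p.2)).
    move=> p /set_mem/DposE p0; apply: lm_unique => //; exact: cvg_cst.
  by apply: (@pmeas_lm _ _ _ F filtF (fun w _ => a w 0)) => // w; exact: cadlag_cst.
pose Q n : set PT := ~` Dpos `|` (Dpos `&` (fun p => a p.1 p.2 - a p.1 0) @^-1` `]-oo, n%:R]).
have mQ n : measurable (Q n).
  apply: measurableU; first by apply: measurableC; exact: measurable_Dpos.
  by apply: ma => //; exact: measurable_Dpos.
exists Q.
  apply/esym; rewrite -subTset => p _; have [pD|pD] := pselect (Dpos p); last by exists 0%N => //; left.
  exists (Num.bound (a p.1 p.2 - a p.1 0)) => //; right; split=> //=.
  rewrite in_itv/= ltW//; apply: archi_boundP; rewrite subr_ge0.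
  by apply: nda => //; apply: ltW; apply/DposE.
move=> n; split=> //; rewrite nuE//; apply: (@le_lt_trans _ _ (\int[P]_w n%:R%:E)%E).
  apply: ge0_le_integral => //; first exact: measurable_LSm_pos0.
  move=> w _; apply: LSm_le_level => //.
    by apply: measurableI; [exact: measurable_xsec|exact: measurable_pos0].
  move=> s [[nD|[_ /=]]]; first by rewrite /pos0/= in_itv/= andbT => s0; case: nD; apply/DposE.
  by rewrite /pos0/= !in_itv/= andbT.
by rewrite integral_cst// [X in (_ * X)%E]probability_setT mule1 ltry.
Qed.

Lemma PxH_process_measure (a Z : Omega -> R -> R) (nu : {measure set PT -> \bar R}) (A : set PT) :
  (forall w, nondec (a w)) -> (forall w, cadlag (a w)) -> adapted F a -> process_measure a nu ->
  pmeas (fun p => Z p.1 p.2) -> (forall w t, 0 < t -> 0 <= Z w t) -> measurable A ->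
  PxH P a Z A = (\int[nu]_(p in A) (((fun p => Z p.1 p.2) \_ Dpos) p)%:E)%E.
Proof.
move=> nda ca aa nuE mZ Z0 mA; set f := _ \_ _.
have mD := measurable_Dpos filtF.
have mf : @measurable_fun _ _ PT R setT f.
  exact/(measurable_restrictT _ mD).
have f0 p : 0 <= f p.
  by rewrite /f patchE; case: ifPn => // /set_mem/DposE p0; exact: Z0.
have mfE : @measurable_fun _ _ PT _ setT ((EFin \o f) \_ A).
  by apply/(measurable_restrictT _ mA); apply: measurable_funTS; exact/measurable_EFinP.
rewrite [RHS]integral_mkcond (integral_process_measure nda ca aa nuE)//; last first.
  by move=> p; rewrite patchE; case: ifP => // _; rewrite lee_fin.
apply: eq_integral => w _; apply: eq_integral => s /set_mem s0.
have sD : Dpos (w, s) by split.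
rewrite !patchE /=; case: ifPn => As.
  by rewrite /f patchE mem_set// asboolT ?mule1//; exact: set_mem.
by rewrite asboolF ?mule0// => /mem_set; rewrite (negbTE As).
Qed.

End ProcessMeasure.

(** * Operational time and null sets of the payoffs *)

Section OperationalTime.
Context {R : realType} {d : measure_display} {Omega : measurableType d}.
Variables (P : probability Omega R) (F : R -> set (set Omega)).
Hypotheses (filtF : filtration F) (FM : forall t A, 0 <= t -> F t A -> measurable A).
Context {N : nat}.
Variables (X : Omega -> R -> 'I_N -> R) (B : Omega -> R -> R).
Hypotheses (payX : payoff F X) (compB : compensator P F (Ajump X) B).
Local Notation mR := (measurableTypeR R).
Local Notation PT := (g_sigma_algebraType (pred_gen F)).
Local Notation pmeas f := (@measurable_fun _ _ PT R Dpos f).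
Local Notation Xn n w := (fun t => X w t n).

Lemma payoff_nondec w n : nondec (Xn n w). Proof. by case: payX => _ /(_ w n)[]. Qed.
Lemma payoff_cadlag w n : cadlag (Xn n w). Proof. by case: payX => _ /(_ w n)[]. Qed.
Lemma payoff_adapted n : adapted F (fun w => Xn n w). Proof. by case: payX. Qed.
Lemma compensator_nondec w : nondec (B w). Proof. by case: compB => _ /(_ w)[]. Qed.
Lemma compensator_cadlag w : cadlag (B w). Proof. by case: compB => _ /(_ w)[]. Qed.

Lemma XcE w t n : Xc X w t n = cpart (Xn n w) t. Proof. by []. Qed.

(** As [X] starts at 0, its jumps up to [t] sum to at most [X_t]. The norm in [opG] is therefore a
    sum of nondecreasing paths. *)
Lemma Xc_ge0 w t n : 0 <= t -> 0 <= Xc X w t n.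
Proof.
move=> t0; have := jsum_le (payoff_nondec w n) (payoff_cadlag w n) t0.
by case: payX => _ _ _ ->; rewrite subr0 XcE /cpart subr_ge0.
Qed.

Lemma cadlag_norm (f : R -> R) : cadlag f -> cadlag (fun t => `|f t|).
Proof.
move=> cf; split=> [t t0|t t0]; first by apply: cvg_norm; exact: cf.1.
by apply: is_cvg_norm; exact: cf.2.
Qed.

Let ndXc w n : nondec (fun t => `|Xc X w t n|).
Proof.
move=> s t s0 st; rewrite !ger0_norm ?Xc_ge0//; last exact: le_trans st.
by rewrite !XcE; apply: (cpart_nondec (payoff_nondec w n) (payoff_cadlag w n)).
Qed.

Let cXc w n : cadlag (fun t => `|Xc X w t n|).
Proof. by apply: cadlag_norm; apply: (cpart_cadlag (payoff_nondec w n) (payoff_cadlag w n)). Qed.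

Lemma opG_nondec w : nondec (opG X B w).
Proof.
move=> s t s0 st; rewrite /opG lerD//; last exact: compensator_nondec.
by apply: ler_sum => n _; exact: ndXc.
Qed.

Lemma opG_cadlag w : cadlag (opG X B w).
Proof.
apply: cadlagD; last exact: compensator_cadlag.
by apply: cadlag_sum => n; exact: cXc.
Qed.

Lemma opG_pred : pred_fun F (opG X B).
Proof.
apply/(pred_funP filtF); apply: measurable_funD.
  apply: measurable_sum => n; apply: measurableT_comp => //.
  apply/(pred_funP filtF (fun w t => Xc X w t n)); apply: (@pred_cpart _ _ _ F filtF (fun w => Xn n w)).
  - by move=> w; exact: payoff_nondec.
  - by move=> w; exact: payoff_cadlag.
  - exact: payoff_adapted.
by apply/(pred_funP filtF); case: compB.
Qed.

Lemma opG_adapted : adapted F (opG X B).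
Proof. exact: pred_fun_adapted opG_pred. Qed.

Lemma LSm_le (f g : R -> R) (A : set mR) : nondec f -> cadlag f -> cadlag g ->
  nondec (fun t => g t - f t) -> measurable A -> (LSm f A <= LSm g A)%E.
Proof.
move=> ndf cf cg ndgf mA.
have -> : LSm g A = (LSm f A + LSm (fun t => (g t - f t)%R) A)%E.
  by rewrite -LSmD//; [congr (LSm _ _); apply/funext => t; rewrite addrC subrK|exact: cadlagB].
by rewrite leeDl.
Qed.

Lemma LSm_compensator_le w (A : set mR) : measurable A -> (LSm (B w) A <= LSm (opG X B w) A)%E.
Proof.
move=> mA; apply: LSm_le => //; [exact: compensator_nondec|exact: compensator_cadlag|exact: opG_cadlag|].
move=> s t s0 st; rewrite /opG !addrK; by apply: ler_sum => n _; exact: ndXc.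
Qed.

Lemma LSm_Xc_le w n (A : set mR) : measurable A ->
  (LSm (cpart (Xn n w)) A <= LSm (opG X B w) A)%E.
Proof.
move=> mA; apply: LSm_le => //.
- exact: (cpart_nondec (payoff_nondec w n) (payoff_cadlag w n)).
- exact: (cpart_cadlag (payoff_nondec w n) (payoff_cadlag w n)).
- exact: opG_cadlag.
move=> s t s0 st; have t0 := le_trans s0 st.
have E u : 0 <= u -> opG X B w u - cpart (Xn n w) u = \sum_(k | k != n) `|Xc X w u k| + B w u.
  by move=> u0; rewrite /opG /vnorm (bigD1 n)//= ger0_norm ?Xc_ge0// XcE; ring.
rewrite !E// lerD//; last exact: compensator_nondec.
by apply: ler_sum => k _; exact: ndXc.
Qed.

Let jmin w s := Num.min (vnorm (fun n => jump (Xn n w) s)) 1.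

Let jmin_ge0 w s : 0 <= jmin w s.
Proof. by rewrite /jmin le_min ler01 vnorm_ge0. Qed.

Let jmin_fin w t : (\esum_(s in oc0 t) (jmin w s)%:E < +oo)%E.
Proof.
pose S t := \sum_n X w t n.
have ndS : nondec S by move=> s u s0 su; apply: ler_sum => n _; exact: payoff_nondec.
have cS : cadlag S by apply: cadlag_sum => n; exact: payoff_cadlag.
apply: (le_lt_trans _ (jump_esum_fin ndS cS t)).
apply: le_esum => s; rewrite /oc0/= in_itv/= => /andP[s0 _]; rewrite lee_fin.
apply: (@le_trans _ _ (vnorm (fun n => jump (Xn n w) s))); first by rewrite /jmin ge_min lexx.
rewrite /jump /S lm_sum//; last by move=> n; exact: payoff_cadlag.
rewrite -sumrB; apply: ler_sum => n _; rewrite ger0_norm//.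
exact: (jump_ge0T (payoff_nondec w n) (payoff_cadlag w n)).
Qed.

Let le_jmin_esum w (A : set R) s : A s ->
  ((jmin w s)%:E <= \esum_(u in A) (jmin w u)%:E)%E.
Proof.
move=> As; rewrite [leLHS](_ : _ = \esum_(u in [set s]) (jmin w u)%:E)%E; last first.
  by rewrite esum_set1// lee_fin.
rewrite [leLHS]esum_mkcond [leRHS]esum_mkcond; apply: le_esum => u _.
case: ifPn => [/set_mem ->|_]; first by rewrite mem_set.
by case: ifP => // _; rewrite lee_fin.
Qed.

(** The integral of a nonnegative function is a supremum over simple functions below it, hence
    monotone. It is used for the mass that [Ajump] gives to a set, without discussing its
    measurability in [w]. *)
Lemma le_integral_nonmeasurable (f g : Omega -> \bar R) : (forall w, (0 <= f w)%E) ->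
  (forall w, (f w <= g w)%E) -> (\int[P]_w f w <= \int[P]_w g w)%E.
Proof.
move=> f0 fg; rewrite !ge0_integralE => [|w _|w _]; [|exact: le_trans (fg w)|by []].
rewrite !patch_setT; apply: le_ereal_sup => _ [h hf <-]; exists h => // w.
exact: le_trans (fg w).
Qed.

Lemma Ajump_jump_le w n (A : set mR) s : measurable A -> A s -> 0 < s ->
  ((Num.min (jump (Xn n w) s) 1)%:E <= LSm (Ajump X w) A)%E.
Proof.
move=> mA As s0; have sA : (A `&` pos0) s by split=> //; rewrite /pos0/= in_itv/= s0.
rewrite (LSm_jsum (jmin_ge0 w) (jmin_fin w))//; apply: (@le_trans _ _ (jmin w s)%:E).
  rewrite lee_fin /jmin le_min !ge_min lexx !orbT andbT; apply/orP; left.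
  apply: le_trans (vnorm_coord (fun n => jump (Xn n w) s) n); exact: ler_norm.
exact: le_jmin_esum.
Qed.

(* A predictable set U that the compensator does not charge meets no jump of X, almost
   surely. The set of the jumps of size at least 1/k need not be predictable, but it is
   measurable, which is all that is used. *)
Lemma jump_null n (U : set PT) : measurable U ->
  P.-negligible [set w | LSm (B w) ([set s | U (w, s)] `&` pos0) != 0%E] ->
  P.-negligible [set w | exists s, [/\ U (w, s), 0 < s & 0 < jump (Xn n w) s]].
Proof.
move=> mU nullB.
(* For the constant filtration of all measurable sets the jumps of [X] are predictable, so the sets
   [D k] below have measurable masses. *)
pose G : set (set Omega) := measurable; pose F' := fun _ : R => G.
have sG : sigma_algebra setT G by exact: sigma_algebra_measurable.
have filtF' : filtration F' := const_filtration sG.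
pose PT' := g_sigma_algebraType (pred_gen F').
have mU' : measurable (U : set PT').
  move: mU; apply: smallest_sub; first exact: smallest_sigma_algebra.
  move=> _ [[A [s [t [s0 FA ->]]]]|[A [FA ->]]]; apply: sub_gen_smallest.
    by left; exists A, s, t; split=> //; exact: FM FA.
  by right; exists A; split=> //; exact: FM FA.
have aX' : adapted F' (fun w => Xn n w).
  by move=> t t0 C mC; apply: (FM t0); exact: payoff_adapted.
have mj := measurable_jump_const sG (fun w => payoff_cadlag w n) aX'.
pose D k : set PT' := U `&` (Dpos `&` (fun p => jump (Xn n p.1) p.2) @^-1` `[k.+1%:R^-1, +oo[).
have mD k : measurable (D k).
  by apply: measurableI => //; apply: mj => //; exact: measurable_Dpos.
pose g k w := LSm (Xn n w) ([set s | D k (w, s)] `&` pos0).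
have mg k : measurable_fun setT (g k).
  apply: (@measurable_LSm_pos0 _ _ _ F' filtF' (fun t A _ mA => mA) (fun w => Xn n w)) => //.
  - by move=> w; exact: payoff_nondec.
  - by move=> w; exact: payoff_cadlag.
pose E k := [set w | g k w != 0%E].
have mE k : measurable (E k).
  rewrite -[X in measurable X]setTI; apply: emeasurable_neq => //.
have gD k w s : D k (w, s) -> g k w != 0%E.
  move=> Dws; have [Us [/DposE/= s0]] := Dws; rewrite /= in_itv/= andbT => js.
  apply: contraTneq js => g0; rewrite -ltNge; apply: (@le_lt_trans _ _ 0) => //.
  rewrite -lee_fin -(LSm_set1 (payoff_nondec w n) (payoff_cadlag w n) s0).
  apply: (@le_trans _ _ (g k w)); last by rewrite g0.
  apply: le_measure; rewrite ?inE//.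
    by apply: measurableI; [exact: measurable_xsec|exact: measurable_pos0].
  by move=> _ ->; split=> //; rewrite /pos0/= in_itv/= s0.
(* The indicator of [U] at positive times, used as integrand in the defining identity of the
   compensator. *)
pose W w s : R := (`[< U (w, s) /\ 0 < s >])%:R.
have mW : pred_fun F W.
  apply/(pred_funP filtF); apply: measurable_funTS.
  apply: (@eq_measurable_fun _ _ PT R setT (\1_(U `&` Dpos))).
    move=> p _; rewrite indicE /W; congr (nat_of_bool _)%:R.
    apply/idP/asboolP => [/set_mem[Up /DposE p0]|[Up p0]]; first by split=> //; case: p Up p0.
    by apply/mem_set; split; [case: p Up p0|apply/DposE].
  by apply: measurable_indic; apply: measurableI => //; exact: measurable_Dpos.
have WE (f : Omega -> R -> R) w : (\int[LSm (f w)]_(s in pos0) (W w s)%:E)%E =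
    LSm (f w) ([set s | U (w, s)] `&` pos0).
  have mx : measurable ([set s | U (w, s)] : set mR) by exact: measurable_xsec.
  rewrite -[RHS](integral_indic _ measurable_pos0 mx); apply: eq_integral => s /set_mem.
  rewrite /pos0/= in_itv/= andbT => s0; rewrite indicE /W; congr ((nat_of_bool _)%:R%:E).
  by apply/asboolP/idP => [[Us _]|/set_mem //]; exact: mem_set.
have PA : (\int[P]_w LSm (Ajump X w) ([set s | U (w, s)] `&` pos0) = 0)%E.
  have := (@eq_integral _ _ _ P setT _ _ (fun w _ => WE (Ajump X) w)); move=> <-.
  case: compB => _ _ _ ->//.
  apply: (@eq_trans _ _ (\int[P]_w LSm (B w) ([set s | U (w, s)] `&` pos0))%E).
    by apply: eq_integral => w _; exact: WE.
  have aB : adapted F B by apply: pred_fun_adapted => //; case: compB.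
  have [nuB nuBE] := process_measure_ex P filtF FM compensator_nondec compensator_cadlag aB.
  rewrite -nuBE//.
  exact/(process_measure_null filtF FM compensator_nondec compensator_cadlag aB nuBE mU).
have PE k : P (E k) = 0%E.
  have k0 : 0 < k.+1%:R^-1 :> R by rewrite invr_gt0.
  (* Markov's inequality: on [E k] some jump in [U] has size at least [1/(k+1)], and since this is
     at most 1 the truncation in [Ajump] does not reduce it. *)
  have : (\int[P]_w (k.+1%:R^-1 * \1_(E k) w)%:E <= 0)%E.
    rewrite -PA; apply: le_integral_nonmeasurable => w; first by rewrite lee_fin mulr_ge0// ltW.
    rewrite indicE; have [Ew|] := boolP (w \in E k); last by rewrite mulr0 measure_ge0.
    rewrite mulr1; have : [set s | D k (w, s)] !=set0.
      apply/set0P/negP => /eqP D0; have := set_mem Ew.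
      by rewrite /E/= /g D0 set0I measure0 eqxx.
    move=> [s [Us [/DposE/= s0]]]; rewrite /= in_itv/= andbT => js.
    apply: le_trans (@Ajump_jump_le w n _ s _ _ s0); last 2 first.
    - by apply: measurableI; [exact: measurable_xsec|exact: measurable_pos0].
    - by split=> //; rewrite /pos0/= in_itv/= s0.
    by rewrite lee_fin le_min js/= invf_le1// ler1n.
  under eq_integral do rewrite EFinM.
  have mEk : measurable_fun setT (EFin \o (\1_(E k) : Omega -> R)).
    by apply/measurable_EFinP; exact: measurable_indic.
  rewrite ge0_integralZl//.
  rewrite integral_indic// setIT => h.
  apply/eqP; rewrite -measure_le0 leNgt; apply/negP => PE0; move: h; rewrite leNgt.
  by rewrite mule_gt0.
apply: (@negligibleS _ _ _ _ (\bigcup_k E k)); last first.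
  by apply: negligible_bigcup => k; apply/negligibleP => //; exact: PE.
move=> w /= [s [Us s0 js]].
have [k hk] := ltr_add_invr js; exists k => //; apply: (gD k w s); split=> //.
split; first exact/DposE.
by rewrite /= in_itv/= andbT; rewrite add0r in hk; exact: ltW.
Qed.

Lemma payoff_dominated n (nuG : {measure set PT -> \bar R}) (U : set PT) :
  process_measure P (opG X B) nuG -> measurable U -> nuG U = 0%E ->
  P.-negligible [set w | LSm (Xn n w) ([set s | U (w, s)] `&` pos0) != 0%E].
Proof.
move=> nuE mU.
move=> /(process_measure_null filtF FM opG_nondec opG_cadlag opG_adapted nuE mU) nullG.
have mS w : measurable ([set s | U (w, s)] `&` pos0 : set mR).
  by apply: measurableI; [exact: measurable_xsec|exact: measurable_pos0].
have nullB : P.-negligible [set w | LSm (B w) ([set s | U (w, s)] `&` pos0) != 0%E].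
  apply: negligibleS nullG => w /=; apply: contra_neq => h.
  apply/eqP; rewrite -measure_le0; apply: le_trans (LSm_compensator_le w (mS w)) _.
  by rewrite h.
apply: negligibleS (negligibleU nullG (jump_null n mU nullB)) => w /=.
apply: contraPP => /not_orP[/negP]; rewrite negbK => /eqP G0 nj; apply/negP.
rewrite negbK (LSm_cpart (payoff_nondec w n) (payoff_cadlag w n))//.
rewrite [X in (X + _)%E](_ : _ = 0%E); last first.
  apply/eqP; rewrite -measure_le0; apply: le_trans (LSm_Xc_le w n (mS w)) _.
  by rewrite G0.
rewrite add0e; apply/eqP/esum1 => s [[Us sp] _]; congr (_%:E).
have s0 : 0 < s by move: sp; rewrite /pos0/= in_itv/= andbT.
apply/eqP; rewrite eq_le (jump_ge0T (payoff_nondec w n) (payoff_cadlag w n)) andbT leNgt.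
by apply/negP => js; apply: nj; exists s.
Qed.

End OperationalTime.

(** * Lebesgue derivatives with respect to H *)

Section ProcessDerivative.
Context {R : realType} {d : measure_display} {Omega : measurableType d}.
Variables (P : probability Omega R) (F : R -> set (set Omega)).
Hypotheses (filtF : filtration F) (FM : forall t A, 0 <= t -> F t A -> measurable A).
Local Notation mR := (measurableTypeR R).
Local Notation PT := (g_sigma_algebraType (pred_gen F)).
Local Notation pmeas f := (@measurable_fun _ _ PT R Dpos f).

Lemma process_measure_Dpos (a : Omega -> R -> R) (nu : {measure set PT -> \bar R}) (A : set PT) :
  process_measure P a nu -> measurable A -> nu (A `&` Dpos) = nu A.
Proof.
move=> nuE mA; have mD := measurable_Dpos filtF.
rewrite !nuE//; last exact: measurableI.
apply: eq_integral => w _; congr (LSm _ _); apply/seteqP; split => s /=.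
  by move=> [[]].
by move=> [As s0]; do 2 split=> //.
Qed.

Lemma PxH1 (a : Omega -> R -> R) (nu : {measure set PT -> \bar R}) (A : set PT) :
  (forall w, nondec (a w)) -> (forall w, cadlag (a w)) -> adapted F a -> process_measure P a nu ->
  measurable A -> PxH P a (fun _ _ => 1) A = nu A.
Proof.
move=> nda ca aa nuE mA; have mD := measurable_Dpos filtF.
rewrite (PxH_process_measure filtF FM nda ca aa nuE)//.
rewrite (_ : (fun p : Omega * R => 1 : R) \_ Dpos = \1_(Dpos : set PT)).
  by rewrite integral_indic// setIC (process_measure_Dpos nuE).
by apply/funext => p; rewrite patchE indicE; case: ifP.
Qed.

Variables (G H : Omega -> R -> R).
Hypotheses (pG : pred_fun F G) (ndG : forall w, nondec (G w)) (cG : forall w, cadlag (G w)).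
Hypotheses (pH : pred_fun F H) (ndH : forall w, nondec (H w)) (cH : forall w, cadlag (H w)).
Hypothesis GH : abs_cont P G H.

Variables (nuG nuH : {measure set PT -> \bar R}).
Hypotheses (nuGE : process_measure P G nuG) (nuHE : process_measure P H nuH).

Let aG := pred_fun_adapted filtF pG.
Let aH := pred_fun_adapted filtF pH.
Let sH := process_measure_sigma_finite filtF FM pH ndH cH nuHE.

Lemma process_measure_dominated (A : set PT) : measurable A -> nuH A = 0%E -> nuG A = 0%E.
Proof.
move=> mA /(process_measure_null filtF FM ndH cH aH nuHE mA) nullH.
apply/(process_measure_null filtF FM ndG cG aG nuGE mA).
have [N0 [mN N00 hN]] := GH.
have nN : P.-negligible N0 by apply/negligibleP.
apply: negligibleS (negligibleU nullH nN) => w /= nG.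
have [Nw|Nw] := pselect (N0 w); first by right.
left; apply: contra_neq nG; apply: hN => //.
by apply: measurableI; [exact: measurable_xsec|exact: measurable_pos0].
Qed.

Lemma process_density : exists g : PT -> R, [/\ measurable_fun setT g, forall p, 0 <= g p &
  forall A, measurable A -> nuG A = (\int[nuH]_(p in A) (g p)%:E)%E].
Proof.
apply: density_sigma_finite => //; last exact: process_measure_dominated.
exact: (process_measure_sigma_finite filtF FM pG ndG cG nuGE).
Qed.

Variable g : PT -> R.
Hypotheses (mg : measurable_fun setT g) (g0 : forall p, 0 <= g p)
  (gE : forall A, measurable A -> nuG A = (\int[nuH]_(p in A) (g p)%:E)%E).

(** This is the set on which dG/dH cannot be cancelled from a ratio. *)
Lemma density_zero_null : nuG [set p | g p = 0] = 0%E.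
Proof.
rewrite gE; last by rewrite -[X in measurable X]setTI; exact: (mg measurableT (measurable_set1 (0 : R))).
by apply: integral0_eq => p /= ->.
Qed.

Variables (a : Omega -> R -> R) (r : PT -> R).
Hypotheses (nda : forall w, nondec (a w)) (ca : forall w, cadlag (a w)) (aa : adapted F a).
Hypotheses (mr : measurable_fun setT r) (r0 : forall p, 0 <= r p)
  (aE : forall w (A : set mR), measurable A ->
    LSm (a w) A = (\int[LSm (G w)]_(s in A `&` pos0) (r (w, s))%:E)%E).

(** Chain rule: [r] is the pathwise density of [a] with respect to [G], and [g] that of P x G with
    respect to P x H. *)
Lemma process_measure_density (nu : {measure set PT -> \bar R}) (U : set PT) :
  process_measure P a nu -> measurable U -> nu U = (\int[nuH]_(p in U) (r p * g p)%:E)%E.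
Proof.
move=> nuE mU; rewrite nuE//.
have mrU : measurable_fun setT ((EFin \o r) \_ U).
  by apply/(measurable_restrictT _ mU); apply: measurable_funTS; exact/measurable_EFinP.
have rU0 p : (0 <= ((EFin \o r) \_ U) p)%E.
  by rewrite patchE; case: ifP => // _; rewrite lee_fin.
transitivity (\int[nuG]_p ((EFin \o r) \_ U) p)%E.
  rewrite (integral_process_measure filtF FM ndG cG aG nuGE)//.
  apply: eq_integral => w _; rewrite aE; last first.
    by apply: measurableI; [exact: measurable_xsec|exact: measurable_pos0].
  rewrite -setIA setIid setIC integral_mkcondr; apply: eq_integral => s _.
  by rewrite !patchE.
rewrite (integral_density mg g0 gE)// [RHS]integral_mkcond.
by apply: eq_integral => p _; rewrite !patchE; case: ifP => //=; rewrite mul0e.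
Qed.

Lemma lebesgue_deriv_density : lebesgue_deriv P F a H (fun w s => r (w, s) * g (w, s)).
Proof.
have [nu nuE] := process_measure_ex P filtF FM nda ca aa.
have mrg : @measurable_fun _ _ PT R setT (fun p => r p * g p) by exact: measurable_funM.
have mD := measurable_Dpos filtF.
split=> [|w t _|]; last exists set0.
- apply/(pred_funP filtF); apply: measurable_funTS.
  by apply: eq_measurable_fun mrg => -[].
- by rewrite mulr_ge0.
- split.
  + by apply/(predictableP filtF); split => //; exact: measurable0.
  + by rewrite (PxH1 ndH cH aH nuHE)//; exact: measure0.
  move=> A /(predictableP filtF)[mA _].
  rewrite setI0 !(PxH1 nda ca aa nuE)// measure0 adde0.
  rewrite (PxH_process_measure filtF FM ndH cH aH nuHE)//; last 2 first.
  + by apply: measurable_funTS; apply: eq_measurable_fun mrg => -[].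
  + by move=> w t _; rewrite mulr_ge0.
  rewrite -(process_measure_Dpos nuE mA).
  rewrite (process_measure_density nuE)//; last exact: measurableI.
  rewrite integral_mkcondr; apply: eq_integral => -[w s] _.
  by rewrite !patchE; case: ifP.
Qed.

(** Two densities agree outside an H-null set, which is also G-null. G-nullity is what is kept,
    since this is what [payoff_dominated] turns into nullity for the payoffs. *)
Lemma lebesgue_deriv_unique l : lebesgue_deriv P F a H l ->
  exists2 U : set PT, measurable U /\ nuG U = 0%E &
    forall w s, 0 < s -> ~ U (w, s) -> l w s = r (w, s) * g (w, s).
Proof.
have [nu nuE] := process_measure_ex P filtF FM nda ca aa.
move=> [pl l0 [Gam [/(predictableP filtF)[mGam _] Gam0 lE]]].
have mD := measurable_Dpos filtF; have ml := pred_fun_pos filtF pl.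
have mrg : @measurable_fun _ _ PT R setT (fun p => r p * g p) by exact: measurable_funM.
pose f1 : PT -> R := (fun p => l p.1 p.2) \_ Dpos.
pose f2 : PT -> R := (fun p => r p * g p) \_ Dpos.
have mf1 : measurable_fun setT f1 by exact/(measurable_restrictT _ mD).
have mf2 : measurable_fun setT f2.
  by apply/(measurable_restrictT _ mD); exact: measurable_funTS.
have f10 p : 0 <= f1 p.
  by rewrite /f1 patchE; case: ifPn => // /set_mem/DposE p0; apply: l0; exact: ltW.
have f20 p : 0 <= f2 p by rewrite /f2 patchE; case: ifPn => // _; rewrite mulr_ge0.
(* The set that comes with the given version is H-null, hence null for [a] too, and its singular
   term disappears. *)
have nuGam : nu Gam = 0%E.
  rewrite (process_measure_density nuE mGam); apply: null_set_integral => //.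
    by apply/measurable_EFinP; exact: measurable_funTS.
  by rewrite -(PxH1 ndH cH aH nuHE)//.
exists [set p | f1 p != f2 p]; last first.
  move=> w s s0; have sD : Dpos (w, s) by exact/DposE.
  by rewrite /= /f1 /f2 !patchE mem_set// => /negP; rewrite negbK => /eqP.
have mU : measurable [set p | f1 p != f2 p].
  rewrite (_ : [set p | _] = ~` ((fun p => f1 p - f2 p) @^-1` [set 0])).
    by apply: measurableC; rewrite -[X in measurable X]setTI; apply: measurable_funB.
  apply/seteqP; split => p /=; first by move=> /negP h /eqP; rewrite subr_eq0.
  by move=> h; apply/eqP => e; apply: h; rewrite e subrr.
split=> //; apply: process_measure_dominated => //; apply: density_unique => // A mA.
have mAD : measurable (A `&` Dpos) by exact: measurableI.
have pAD : predictable F (A `&` Dpos).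
  by apply/(predictableP filtF); split=> // p [_]; rewrite Dom0U; right.
have := lE _ pAD; rewrite !(PxH1 nda ca aa nuE)//; last exact: measurableI.
rewrite [X in (_ + X)%E](_ : _ = 0%E) ?adde0; last first.
  by apply: (subset_measure0 _ _ _ nuGam) => //; exact: measurableI.
rewrite (PxH_process_measure filtF FM ndH cH aH nuHE ml)//; last by move=> w t /ltW; exact: l0.
rewrite (process_measure_density nuE mAD) => e.
transitivity (\int[nuH]_(p in A `&` Dpos) (f1 p)%:E)%E.
  rewrite [RHS]integral_mkcondr; apply: eq_integral => p _.
  by rewrite /f1 !patchE; case: ifP.
rewrite -e integral_mkcondr; apply: eq_integral => p _.
by rewrite /f2 !patchE; case: ifP.
Qed.

End ProcessDerivative.

(** * The wealth equation *)

Lemma big_option {R : nmodType} (I : finType) (f : option I -> R) :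
  \sum_c f c = f None + \sum_i f (Some i).
Proof.
rewrite (bigD1 None)//=; congr (_ + _).
rewrite (reindex_omap Some id) => [|[i|]//]; apply: eq_bigl => i.
by rewrite /= eqxx.
Qed.

Lemma exists_bigcup {T : Type} {I : countType} (E : I -> set T) :
  [set x | exists i, E i x] = \bigcup_(k : nat) (if @choice.unpickle I k is Some i then E i else set0).
Proof.
apply/seteqP; split => x /= [].
  by move=> i Ei; exists (choice.pickle i) => //; rewrite choice.pickleK.
by move=> k _; case: choice.unpickle => //= i Ei; exists i.
Qed.

Lemma negligible_exists {d} {T : measurableType d} {R : realType} (mu : {measure set T -> \bar R})
  {I : countType} (E : I -> set T) :
  (forall i, mu.-negligible (E i)) -> mu.-negligible [set x | exists i, E i x].
Proof.
move=> nE; rewrite exists_bigcup; apply: negligible_bigcup => k.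
by case: choice.unpickle => [i|] /=; [exact: nE|exact: negligible_set0].
Qed.

Section WealthEquation.
Context {R : realType} {d : measure_display} {Omega : measurableType d}.
Variables (P : probability Omega R) (F : R -> set (set Omega)).
Hypotheses (filtF : filtration F) (FM : forall t A, 0 <= t -> F t A -> measurable A).
Context {M N : nat}.
Variables (X : Omega -> R -> 'I_N -> R) (B : Omega -> R -> R).
Hypotheses (payX : payoff F X) (compB : compensator P F (Ajump X) B).
Variables (L : 'I_M -> Omega -> (R -> 'I_M -> R) -> R -> 'I_N -> R).
Variables (v : 'I_M -> Omega -> R -> ('I_M -> R) -> 'I_N -> R).
Hypotheses (stratL : forall m, strategy F (L m))
  (C1v : forall m, C1 F (opG X B) (L m) m (v m)).
Local Notation mR := (measurableTypeR R).
Local Notation PT := (g_sigma_algebraType (pred_gen F)).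
Local Notation pmeas f := (@measurable_fun _ _ PT R Dpos f).
Local Notation G := (opG X B).

Let ndG := opG_nondec payX compB.
Let cG := opG_cadlag payX compB.
Let pG := opG_pred filtF payX compB.
Let aG := opG_adapted filtF payX compB.

Definition driver w (c : option 'I_N) : R -> R := if c is Some n then X w ^~ n else G w.

Lemma driver_nondec w c : nondec (driver w c).
Proof. by case: c => [n|]; [exact: payoff_nondec payX w n|exact: ndG]. Qed.

Lemma driver_cadlag w c : cadlag (driver w c).
Proof. by case: c => [n|]; [exact: payoff_cadlag payX w n|exact: cG]. Qed.

Lemma driver_adapted c : adapted F (driver ^~ c).
Proof. by case: c => [n|]; [exact: payoff_adapted payX n|exact: aG]. Qed.

Let v_ge0 w m t z n : 0 <= t -> nonneg z -> 0 <= v m w t z n.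
Proof. by case: (C1v m) => _ /(_ w t z n). Qed.

Section Investment.
Variable Y : Omega -> R -> 'I_M -> R.
Hypotheses (inY : forall w, inD (Y w)) (aY : adaptedv F Y).

Let cY w : cadlagv (Y w). Proof. by move=> k; case: (inY w k). Qed.
Let Y0 w : nonnegv (Y w). Proof. by move=> u k; case: (inY w k) => _; apply. Qed.

Definition coefY c w s m : R :=
  wealth_coef (fun k => v k w) c s (alivev (Y w) s) (lmv (Y w) s) m.

Definition rateY m n w s : R :=
  active_rate (fun k => v k w) (alivev (Y w) s) s (lmv (Y w) s) m n.

Lemma lmv_nonneg w s : 0 < s -> nonneg (lmv (Y w) s).
Proof.
move=> s0 k; apply: (ge_lm_cst (cY w k) s0 (lexx 0)) => u u0 _; exact: Y0.
Qed.

Let pos_Dpos p : (Dpos : set (Omega * R)) p -> nonneg (lmv (Y p.1) p.2).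
Proof. by move=> /DposE; exact: lmv_nonneg. Qed.

Lemma rateY_ge0 m n w s : 0 < s -> 0 <= rateY m n w s.
Proof.
move=> s0; apply: active_rate_ge0 => [k t z i t0 z0| |]; [exact: v_ge0|exact: ltW|].
exact: lmv_nonneg.
Qed.

Let pmeas_aliveY k : pmeas (fun p => (alivev (Y p.1) p.2 k)%:R).
Proof.
have mA := pred_alive filtF (fun w => cY w k) (aY k) (fun w u => @Y0 w u k).
apply: (pmeas_set mA).
by move=> p _; congr (nat_of_bool _)%:R; apply/idP/asboolP.
Qed.

Let pmeas_lmY k : pmeas (fun p => lmv (Y p.1) p.2 k).
Proof. exact: (pmeas_lm filtF (fun w => cY w k) (aY k)). Qed.

Lemma pmeas_rateY m n : pmeas (fun p => rateY m n p.1 p.2).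
Proof. by apply: pmeas_active_rate => // k; case: (C1v k). Qed.

Lemma pmeas_coefY c m : pmeas (fun p => coefY c p.1 p.2 m).
Proof.
have mv k : PB_fun F (v k) by case: (C1v k).
exact: (wealth_pred_coef filtF mv c m pmeas_aliveY pmeas_lmY pos_Dpos).
Qed.

Definition rate0 m n : PT -> R := (fun p => rateY m n p.1 p.2) \_ Dpos.

Lemma rate0_ge0 m n p : 0 <= rate0 m n p.
Proof. by rewrite /rate0 patchE; case: ifP => // /set_mem/DposE; exact: rateY_ge0. Qed.

Lemma rate0E m n w s : 0 < s -> rate0 m n (w, s) = rateY m n w s.
Proof. by move=> s0; rewrite /rate0 patchE mem_set//; exact/DposE. Qed.

Lemma measurable_rate0 m n : measurable_fun setT (rate0 m n).
Proof.
by apply/(measurable_restrictT _ (measurable_Dpos filtF)); exact: pmeas_rateY.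
Qed.

Let measurable_rate0w m n w : measurable_fun setT (fun s : mR => rate0 m n (w, s)).
Proof.
by apply: (measurableT_comp (measurable_rate0 m n)); exact: measurable_section.
Qed.

Let Lp m n w t := L m w (Y w) t n.

Lemma strategy_rate m n w t : 0 <= t ->
  (Lp m n w t)%:E = (\int[LSm (G w)]_(s in oc0 t) (rate0 m n (w, s))%:E)%E.
Proof.
move=> t0; have [_ _ /(_ w (Y w) t n (inY w) t0) LE _] := C1v m.
rewrite /Lp LE; apply: eq_integral => s /set_mem/oc0_pos0; rewrite /pos0/= in_itv/= andbT => s0.
congr (_%:E); rewrite rate0E// /rateY /active_rate /alivev /alive asboolb.
by case: ifP => _; rewrite ?mulr1 ?mulr0.
Qed.

(** (C1) equates the integral of the nonnegative rate with a real number; this finiteness is the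
    source of integrability. *)
Lemma locint_rate0 m n w : locint (LSm (G w)) (fun s => rate0 m n (w, s)).
Proof.
move=> t; have [t0|t0] := leP 0 t; last first.
  by rewrite /oc0 set_itv_ge ?bnd_simp -?leNgt ?ltW//; exact: integrable_set0.
apply/integrableP; split.
  by apply/measurable_EFinP; apply: measurable_funTS.
under eq_integral do rewrite /= ger0_norm ?rate0_ge0//.
by rewrite -strategy_rate// ltry.
Qed.

Lemma strategy_Rintegral m n w t : 0 <= t ->
  Lp m n w t = \int[LSm (G w)]_(s in oc0 t) rate0 m n (w, s).
Proof. by move=> t0; rewrite /Rintegral -strategy_rate. Qed.

(** Monotonicity and regularity belong to the notion of strategy; adaptedness along [Y] and the
    density with respect to [G] are read off the integral in (C1). *)
Lemma strategy_process m n : [/\ forall w, nondec (Lp m n w), forall w, cadlag (Lp m n w),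
  adapted F (Lp m n) & forall w (A : set mR), measurable A ->
    LSm (Lp m n w) A = (\int[LSm (G w)]_(s in A `&` pos0) (rate0 m n (w, s))%:E)%E].
Proof.
have [_ L0 Lnc] := stratL m.
have ndL w : nondec (Lp m n w) by have [] := Lnc w (Y w) n (inY w).
have cL w : cadlag (Lp m n w) by have [] := Lnc w (Y w) n (inY w).
split=> //.
  move=> t t0 C mC.
  have mr : pmeas (fun p => rate0 m n (p.1, p.2)).
    by apply: measurable_funTS; apply: eq_measurable_fun (measurable_rate0 m n) => -[].
  have := adapted_Rintegral filtF ndG cG aG mr (locint_rate0 m n) t0 mC.
  congr (F t _); apply/seteqP; split => w /=; by rewrite strategy_Rintegral.
move=> w A mA.
have [nu nuE] := density_ex (LSm (G w)) (@measurable_rate0w m n w) (fun s => rate0_ge0 m n (w, s)).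
rewrite -nuE; apply: LSm_unique => // t t0.
by rewrite nuE -strategy_rate// /Lp L0// subr0.
Qed.

Lemma ratioE (l : 'I_M -> Omega -> R -> R) (w : Omega) (s : R) (m : 'I_M) :
  Defs.ratio l w s m = l m w s / vnorm (fun k => l k w s).
Proof. by rewrite /Defs.ratio; case: eqP => // ->; rewrite invr0 mulr0. Qed.

Section Derivative.
Variable H : Omega -> R -> R.
Hypotheses (pH : pred_fun F H) (ndH : forall w, nondec (H w)) (cH : forall w, cadlag (H w)).
Hypothesis GH : abs_cont P G H.

Lemma strategy_deriv_ex : exists l : 'I_M -> 'I_N -> Omega -> R -> R,
  forall m n, lebesgue_deriv P F (Lp m n) H (l m n).
Proof.
have [nuG nuGE] := process_measure_ex P filtF FM ndG cG aG.
have [nuH nuHE] := process_measure_ex P filtF FM ndH cH (pred_fun_adapted filtF pH).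
have [g [mg g0 gE]] := process_density filtF FM pG ndG cG pH ndH cH GH nuGE nuHE.
exists (fun m n w s => rate0 m n (w, s) * g (w, s)) => m n.
have [ndL cL aL LE] := strategy_process m n.
apply: (lebesgue_deriv_density filtF FM pG ndG cG pH ndH cH nuGE nuHE mg g0 gE
  ndL cL aL _ _ LE).
- exact: measurable_rate0.
- exact: rate0_ge0.
Qed.

(* The density dG/dH cancels in the ratio, except where it vanishes; that set is G-null, hence
   null for the payoffs. *)
Lemma ratio_coefY (l : 'I_M -> 'I_N -> Omega -> R -> R) :
  (forall m n, lebesgue_deriv P F (Lp m n) H (l m n)) ->
  P.-negligible [set w | exists n, ~ exists2 S : set mR, measurable S /\ LSm (X w ^~ n) S = 0%E &
    forall s m, 0 < s -> ~ S s -> Defs.ratio (fun k => l k n) w s m = coefY (Some n) w s m].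
Proof.
move=> dl.
have [nuG nuGE] := process_measure_ex P filtF FM ndG cG aG.
have [nuH nuHE] := process_measure_ex P filtF FM ndH cH (pred_fun_adapted filtF pH).
have [g [mg g0 gE]] := process_density filtF FM pG ndG cG pH ndH cH GH nuGE nuHE.
have /choice[U hU] : forall i : 'I_M * 'I_N, exists U : set PT, [/\ measurable U, nuG U = 0%E &
    forall w s, 0 < s -> ~ U (w, s) -> l i.1 i.2 w s = rate0 i.1 i.2 (w, s) * g (w, s)].
  move=> [m n]; have [ndL cL aL LE] := strategy_process m n.
  have [U [mU U0] UE] := lebesgue_deriv_unique filtF FM pG ndG cG pH ndH cH GH nuGE nuHE mg g0 gE
    ndL cL aL (@measurable_rate0 m n) (@rate0_ge0 m n) LE (dl m n).
  by exists U.
have mg0 : measurable ([set p | g p = 0] : set PT).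
  by rewrite -[X in measurable X]setTI; have := mg measurableT _ (measurable_set1 (0 : R)); exact.
pose W : set PT := [set p | exists i, U i p].
have mW : measurable W.
  rewrite /W exists_bigcup; apply: bigcupT_measurable => k.
  by case: choice.unpickle => [i|] //=; case: (hU i).
have mV : measurable ([set p | g p = 0] `|` W) by exact: measurableU.
have V0 : nuG ([set p | g p = 0] `|` W) = 0%E.
  apply/negligibleP => //; apply: negligibleU.
    by apply/negligibleP => //; exact: (density_zero_null mg gE).
  by apply: negligible_exists => i; have [mU U0 _] := hU i; exact/negligibleP.
(* One predictable exceptional set covers the zeros of [g] and the sets [U] of all investors and
   assets. *)
have nX n := payoff_dominated filtF FM payX compB n nuGE mV V0.
apply: negligibleS (negligible_exists nX) => w /= [n hn]; exists n => /=.
apply: contra_notN hn => /eqP hn.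
exists ([set s | ([set p | g p = 0] `|` W) (w, s)] `&` pos0).
  by split=> //; apply: measurableI; [exact: measurable_xsec|exact: measurable_pos0].
move=> s m s0 nS; rewrite ratioE.
have nV : ~ ([set p | g p = 0] `|` W) (w, s).
  by move=> Vs; apply: nS; split=> //; rewrite /pos0/= in_itv/= s0.
have gs : g (w, s) != 0 by apply/eqP => gs; apply: nV; left.
have lE k : l k n w s = rateY k n w s * g (w, s).
  have [_ _ /= h] := hU (k, n); rewrite -rate0E//; apply: h => // Us; apply: nV; right.
  by exists (k, n).
have -> : vnorm (fun k => l k n w s) = (\sum_k rateY k n w s) * g (w, s).
  rewrite mulr_suml; apply: eq_bigr => k _.
  by rewrite lE ger0_norm// mulr_ge0// rateY_ge0.
by rewrite lE invfM mulrACA divff// mulr1.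
Qed.

Lemma integral_ratio (l : 'I_M -> 'I_N -> Omega -> R -> R) :
  (forall m n, lebesgue_deriv P F (Lp m n) H (l m n)) ->
  P.-negligible [set w | ~ forall n m t,
    (\int[LSm (X w ^~ n)]_(s in oc0 t) (Defs.ratio (fun k => l k n) w s m)%:E =
     \int[LSm (X w ^~ n)]_(s in oc0 t) (coefY (Some n) w s m)%:E)%E].
Proof.
move=> dl; apply: negligibleS (ratio_coefY dl) => w /=.
apply: contra_notP => /forallNP h n m t; have /contrapT[S [mS S0] hS] := h n.
have sub f : measurable_fun pos0 f -> measurable_fun (oc0 t) (fun s : mR => (f s : R)%:E).
  by move=> mf; apply/measurable_EFinP; apply: measurable_funS mf => //; exact: oc0_pos0.
have ml k : measurable_fun pos0 (l k n w : mR -> R).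
  by have [pl _ _] := dl k n; exact: (pred_measurable_section filtF w pl).
apply: ae_eq_integral.
- exact: measurable_oc0.
- apply: sub; apply: (@eq_measurable_fun _ _ _ _ _ (fun s => l m n w s / vnorm (fun k => l k n w s))).
    by move=> s _; rewrite ratioE.
  apply: measurable_funM => //; apply: (measurableT_comp (@measurable_invr R)).
  by apply: measurable_sum => k; apply: measurableT_comp => //; exact: ml.
- by apply: sub; exact: (measurable_Dpos_section filtF w (pmeas_coefY (Some n) m)).
- exists S; split=> // s /= nS; apply: contrapT => Ss; apply: nS.
  move=> /oc0_pos0; rewrite /pos0/= in_itv/= andbT => s0; congr (_%:E); exact: hS.
Qed.

Lemma coefY_sint w : sintv (driver w) (fun c s => coefY c w s).
Proof.
have mc c m : measurable_fun pos0 (fun s : mR => coefY c w s m).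
  exact: (measurable_Dpos_section filtF w (pmeas_coefY c m)).
move=> m [n|].
  apply: le_locint (@sint_cst _ _ (driver w) (driver_nondec w) (driver_cadlag w) 1 (Some n)) _ => //.
  move=> s s0; apply: (wealth_coef_signed _ _ _ s0 (lmv_nonneg w s0)).2.
  by move=> *; exact: v_ge0.
apply: (@eq_locint _ _ _ (fun s => - \sum_n rate0 m n (w, s))) => [s s0|].
  by rewrite /coefY /=; congr (- _); apply: eq_bigr => n _; rewrite rate0E.
apply: locintN => t; have := integrable_sum (measurable_oc0 t) (index_enum 'I_N)
  (P := xpredT) (fun n _ => @locint_rate0 m n w t).
by apply: eq_integrable => // s _; rewrite /= sumEFin.
Qed.

Lemma integral_coefY_None w m t : 0 <= t ->
  \int[LSm (driver w None)]_(s in oc0 t) coefY None w s m = - vnorm (L m w (Y w) t).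
Proof.
move=> t0; transitivity (\int[LSm (G w)]_(s in oc0 t) (- 1 * \sum_n rate0 m n (w, s))).
  apply: eq_Rintegral => s /set_mem/oc0_pos0; rewrite /pos0/= in_itv/= andbT => s0.
  by rewrite mulN1r /coefY /=; congr (- _); apply: eq_bigr => n _; rewrite rate0E.
have int : (LSm (G w)).-integrable (oc0 t) (fun s => (\sum_n rate0 m n (w, s))%:E).
  have := integrable_sum (measurable_oc0 t) (index_enum 'I_N)
    (P := xpredT) (fun n _ => @locint_rate0 m n w t).
  by apply: eq_integrable => // s _; rewrite /= sumEFin.
rewrite RintegralZl// mulN1r; congr (- _); rewrite /Rintegral.
under eq_integral do rewrite -sumEFin.
rewrite integral_sum//; last by move=> n; exact: (@locint_rate0 m n w t).
under eq_bigr do rewrite -strategy_rate//.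
rewrite sumEFin /=; apply: eq_bigr => n _; rewrite ger0_norm//.
rewrite -lee_fin -/(Lp m n w t) strategy_rate//; apply: integral_ge0 => s _.
by rewrite lee_fin rate0_ge0.
Qed.

Variable y0 : 'I_M -> R.

Lemma coefY_equation w t m : 0 <= t ->
  (y0 m + SIv (driver w) (fun c s => coefY c w s) t m)%:E =
  ((y0 m - vnorm (L m w (Y w) t))%:E +
    \sum_(n < N) \int[LSm (X w ^~ n)]_(s in oc0 t) (coefY (Some n) w s m)%:E)%E.
Proof.
move=> t0; rewrite /SIv /SI big_option integral_coefY_None// addrA EFinD; congr (_ + _)%E.
rewrite -sumEFin; apply: eq_bigr => n _; rewrite /Rintegral fineK//.
exact: (integrable_fin_num (measurable_oc0 t) (@coefY_sint w m (Some n) t)).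
Qed.

Lemma solves_coefY w :
  (forall t m, 0 <= t -> Y w t m = y0 m + SIv (driver w) (fun c s => coefY c w s) t m) <->
  solves (driver w) (wealth_coef (fun k => v k w)) y0 M.+1 (Y w).
Proof.
have E : stage_coef (wealth_coef (fun k => v k w)) M.+1 (Y w) = fun c s => coefY c w s.
  by apply/funext => c; apply/funext => s; apply/funext => m; rewrite stage_coef_full.
rewrite /solves E; split=> [h|[]//]; split=> //; exact: coefY_sint.
Qed.

(** An equivalence for any candidate [Y] and any versions of the derivatives, off a null set that
    may depend on them. One direction serves existence, the other uniqueness. *)
Lemma wealth_equation_solves (l : 'I_M -> 'I_N -> Omega -> R -> R) :
  (forall m n, lebesgue_deriv P F (Lp m n) H (l m n)) ->
  P.-negligible [set w | ~ ((forall t m, 0 <= t -> (Y w t m)%:E =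
     ((y0 m - vnorm (L m w (Y w) t))%:E +
      \sum_(n < N) \int[LSm (fun s => X w s n)]_(s in oc0 t)
        (Defs.ratio (fun k => l k n) w s m)%:E)%E) <->
    solves (driver w) (wealth_coef (fun k => v k w)) y0 M.+1 (Y w))].
Proof.
move=> dl; apply: negligibleS (integral_ratio dl) => w /=.
apply: contra_not => h; rewrite -solves_coefY.
split=> e t m t0; have := e t m t0.
  move=> {}e; apply: EFin_inj; rewrite coefY_equation// e; congr (_ + _)%E.
  by apply: eq_bigr => n _; exact: h.
move=> ->; rewrite coefY_equation//; congr (_ + _)%E.
by apply: eq_bigr => n _; rewrite h.
Qed.

End Derivative.
End Investment.

Lemma driver_box_lipschitz w : (forall m, C2 F m (v m)) ->
  box_lipschitz (wealth_coef (fun k => v k w)).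
Proof.
move=> C2v; apply: wealth_coef_lipschitz => [m t z n|m j T T0]; first exact: v_ge0.
have [Pi [C [delta [_ C0 [_ cd d0] vPi vC]]]] := C2v m.
apply: (@boxed_rateP _ _ _ (v m w) m (fun n t => Pi n (w, t)) C (delta w)) => //.
- by move=> t; exact: d0.
- by move=> t z n; exact: v_ge0.
- by move=> n t z; exact: vPi.
- by move=> n t z zt a; exact: vC.
Qed.

Lemma driver_budget w : budget_coef (driver w) (wealth_coef (fun k => v k w)).
Proof.
apply: wealth_coef_budget => [m t z n|n t t0|m z t]; first exact: v_ge0.
  exact: (jump_ge0 (driver_nondec w (Some n)) (driver_cadlag w (Some n)) (ltW t0)).
by case: (C1v m) => _ _ _; exact.
Qed.

End WealthEquation.

Theorem theorem1 (R : realType) (d : measure_display) (Omega : measurableType d)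
  (P : probability Omega R) (F : R -> set (set Omega)) (M N : nat)
  (X : Omega -> R -> 'I_N -> R) (B : Omega -> R -> R)
  (L : 'I_M -> Omega -> (R -> 'I_M -> R) -> R -> 'I_N -> R) :
  (2 <= M)%N -> (1 <= N)%N ->
  usual_filtration P F ->
  payoff F X ->
  compensator P F (Ajump X) B ->
  (forall m, strategy F (L m)) ->
  (forall m, exists v, C1 F (opG X B) (L m) m v /\ C2 F m v) ->
  forall y0 : 'I_M -> R, (forall m, 0 < y0 m) ->
  forall H : Omega -> R -> R,
    pred_fun F H -> (forall w, nondec (H w) /\ cadlag (H w)) ->
    abs_cont P (opG X B) H ->
  exists Y, wealth_solution P F X H L y0 Y /\
    forall Y', wealth_solution P F X H L y0 Y' -> indist P Y Y'.
Proof.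
move=> _ _ [sF FM Fmono _ _] payX compB stratL /choice[v vP] y0 y0_gt0 H pH ncH GH.
have filtF : filtration F by [].
have C1v m : C1 F (opG X B) (L m) m (v m) by case: (vP m).
have C2v m : C2 F m (v m) by case: (vP m).
have ndH w : nondec (H w) by case: (ncH w).
have cH w : cadlag (H w) by case: (ncH w).
have v_ge0 w m t z n : 0 <= t -> nonneg z -> 0 <= v m w t z n.
  by case: (C1v m) => _ /(_ w t z n).
have lip w := driver_box_lipschitz C1v w C2v.
have dead w : dead_coef (wealth_coef (fun k => v k w)) by exact: wealth_coef_dead.
(* Stage [M.+1] is the equation with no restriction on the number of deaths. *)
have [|Y [solY aY]] := sde_existence filtF (driver_nondec payX compB) (driver_cadlag payX compB)
  (driver_adapted filtF payX compB) lip dead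
  (fun w => wealth_coef_signed (fun m t z n => @v_ge0 w m t z n))
  (driver_budget payX compB C1v)
  (wealth_pred_coef filtF (fun m => let: And4 h _ _ _ := C1v m in h)) (y0 := y0) _ M.+1.
  by move=> m; exact: ltW.
have inY w : inD (Y w).
  by have [cY Y0 _ _] := solY w; split=> [|t t0]; [exact: cY|exact: Y0].
exists Y; split.
  split=> //; have [l lP] :=
    strategy_deriv_ex filtF FM payX compB stratL C1v inY aY pH ndH cH GH.
  exists l; split=> //.
  have [N0 [mN N00 sN]] :=
    wealth_equation_solves filtF FM payX compB stratL C1v inY aY pH ndH cH GH y0 lP.
  exists N0; split=> // w nN; have /contrapT[_ h] := contra_not (sN w) nN.
  by move=> t m; exact: (h (solY w)).
(* Outside two null sets a competitor solves the same pathwise equation, so uniqueness is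
   deterministic from here on. *)
move=> Y' [inY' aY' [l' [lP' [N1 [mN1 N10 eq']]]]].
have [N0 [mN N00 sN]] :=
  wealth_equation_solves filtF FM payX compB stratL C1v inY' aY' pH ndH cH GH y0 lP'.
exists (N0 `|` N1); split; first exact: measurableU.
  by apply/negligibleP; [exact: measurableU|apply: negligibleU; exact/negligibleP].
move=> w /not_orP[nN0 nN1] t t0.
apply: (solves_unique (driver_nondec payX compB w) (driver_cadlag payX compB w) (lip w) (dead w)
  (solY w) _ t0).
have /contrapT[h _] := contra_not (sN w) nN0.
by apply: h => s m; exact: eq'.
Qed.
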